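(* Let $u_0\in\mathcal{M}$. There exist positive constants $C_u$, $C_g$ and $C_\alpha$, with $C_\alpha\le 1$, depending only on $\mathcal{D}$, $d$, $\beta$, $V$, $\Omega$ and $\|u_0\|_{H_0^1}$, such that for any sequence of step sizes $\{\alpha_n\}_{n=0}^\infty$ satisfying $0<\alpha_{\min}\le\alpha_n\le\alpha_{\max}\le C_\alpha$, the sequence $\{u_n\}_{n=0}^\infty$ generated from $u_0$ by the $H_0^1$ scheme $$u_{n+1}=R\big(u_n-\alpha_n\nabla^{\mathcal{R}}_{H_0^1}E(u_n)\big)$$ satisfies, for all $n\ge 0$: (i) $\|u_n\|_{H_0^1}\le C_u$; (ii) $\|\nabla^{\mathcal{R}}_{H_0^1}E(u_n)\|_{H_0^1}\le\|\nabla_{H_0^1}E(u_n)\|_{H_0^1}\le C_g$; (iii) $E(u_n)-E(u_{n+1})\ge\frac{\alpha_{\min}}{2}\|\nabla^{\mathcal{R}}_{H_0^1}E(u_n)\|_{H_0^1}^2$.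
   Context: Setting: $\mathcal{D}\subseteq\mathbb{R}^d$ ($d=2,3$) is a bounded domain; points are written $r=(x,y)$ or $r=(x,y,z)$. $V\in L^\infty(\mathcal{D};\mathbb{R}_{\ge0})$, $\beta>0$, $\Omega\ge0$, $L_z=-\mathrm{i}(x\partial_y-y\partial_x)$. Standing assumption: there is a constant $K>0$ with $V(r)\ge\frac{1+K}{4}\Omega^2(x^2+y^2)$ for all $r\in\mathcal{D}$. All function spaces are complex valued; $(v,w)_{L^2}=\int_{\mathcal{D}}\overline{v}w\,dr$. $\Re$ denotes the real part. Energy: $E(u)=\int_{\mathcal{D}}\big(\frac12|\nabla u|^2+\frac12V|u|^2+\frac\beta4|u|^4-\frac\Omega2\overline{u}L_zu\big)dr$ for $u\in H_0^1(\mathcal{D})$. Constraint manifold: $\mathcal{M}=\{u\in H_0^1(\mathcal{D};\mathbb{C}):\|u\|_{L^2}=1\}$. The real Fréchet derivative is $\langle E'(u),v\rangle=\Re(\nabla u,\nabla v)_{L^2}+\Re(Vu+\beta|u|^2u-\Omega L_zu,v)_{L^2}$. $H_0^1$ inner product: $(v,w)_{H_0^1}=(\nabla v,\nabla w)_{L^2}$, with norm $\|v\|_{H_0^1}=\|\nabla v\|_{L^2}$. With $X=H_0^1$: the Sobolev gradient $\nabla_XE(u)\in H_0^1(\mathcal{D})$ is the unique function with $\Re(\nabla_XE(u),h)_X=\langle E'(u),h\rangle$ for all $h\in H_0^1(\mathcal{D})$; $\mathcal{G}_X$ is defined by $(\mathcal{G}_Xw,h)_X=(w,h)_{L^2}$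 for all $h\in H_0^1(\mathcal{D})$ (so $\mathcal{G}_{H_0^1}=(-\Delta)^{-1}$); the projected gradient is $\nabla^{\mathcal{R}}_XE(u)=\mathcal{P}_{u,X}(\nabla_XE(u))$, where $\mathcal{P}_{u,X}w=w-\frac{\Re(w,\mathcal{G}_Xu)_X}{\|\mathcal{G}_Xu\|_X^2}\mathcal{G}_Xu$ is the $X$-orthogonal projection onto $T_u\mathcal{M}=\{v\in H_0^1(\mathcal{D}):\Re(u,v)_{L^2}=0\}$. Retraction: $R(v)=v/\|v\|_{L^2}$ for $v\in H_0^1(\mathcal{D})\setminus\{0\}$. *)

(* Defs.v *)
From HB Require Import structures.
From mathcomp Require Import all_boot all_order all_algebra.
From mathcomp Require Import complex.
From mathcomp Require Import all_classical all_reals all_analysis.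

Set Implicit Arguments.
Unset Strict Implicit.
Unset Printing Implicit Defensive.

Import Order.TTheory GRing.Theory Num.Theory.
Import numFieldNormedType.Exports.

Local Open Scope classical_set_scope.
Local Open Scope ring_scope.

Definition rV_display : measure_display. Proof. exact: default_measure_display. Qed.

Section measurable_rV.
Context {R : realType} {n : nat}.

Definition rV_coord (i : 'I_n) (r : 'rV[R]_n) : R := r ord0 i.

Let rV_set0 : g_sigma_preimage rV_coord set0.
Proof. exact: sigma_algebra0. Qed.

Let rV_setC A : g_sigma_preimage rV_coord A -> g_sigma_preimage rV_coord (~` A).
Proof. exact: sigma_algebraC. Qed.

Let rV_bigcup (F : (set 'rV[R]_n)^nat) :
  (forall i, g_sigma_preimage rV_coord (F i)) ->
  g_sigma_preimage rV_coord (\bigcup_i (F i)).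
Proof. exact: sigma_algebra_bigcup. Qed.

(* The sigma-algebra generated by the coordinates is the Borel one. *)
HB.instance Definition _ := @isMeasurable.Build rV_display
  'rV[R]_n (g_sigma_preimage rV_coord) rV_set0 rV_setC rV_bigcup.

Lemma measurable_rV_coord (i : 'I_n) :
  measurable_fun [set: 'rV[R]_n] (rV_coord i).
Proof.
move=> _ Y mY; rewrite setTI; apply: sub_sigma_algebra => /=.
rewrite -bigcup_seq/=; exists i => /=; first by rewrite mem_index_enum.
by exists Y => //; rewrite setTI.
Qed.

Lemma measurable_fun_rVP d (T : measurableType d) (f : T -> 'rV[R]_n) :
  measurable_fun [set: T] f <->
  forall i, measurable_fun [set: T] (rV_coord i \o f).
Proof.
split=> [mf i|mf].
  exact: (measurableT_comp (measurable_rV_coord i)).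
suff H : measurable `<=` [set A | measurable (f @^-1` A)].
  by move=> _ A mA; rewrite setTI; exact: H.
apply: smallest_sub.
  split=> /=.
  - by rewrite preimage_set0.
  - by move=> A mA; rewrite setTD preimage_setC; exact: measurableC.
  - by move=> F mF; rewrite preimage_bigcup; exact: bigcup_measurable.
rewrite -bigcup_seq => A [i _ [B mB <-]] /=.
by rewrite setTI; have := mf i measurableT B mB; rewrite setTI.
Qed.

End measurable_rV.

Section rV_cons.
Context {R : realType} {n : nat}.

Definition rV_cons (p : R * 'rV[R]_n) : 'rV[R]_n.+1 :=
  row_mx (const_mx p.1 : 'rV[R]_1) p.2.

Definition rV_uncons (r : 'rV[R]_n.+1) : R * 'rV[R]_n :=
  (r 0 0, \row_i r 0 (lift 0 i)).

Let rV_cons0 p : rV_cons p 0 0 = p.1.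
Proof.
have -> : (0 : 'I_n.+1) = lshift n (0 : 'I_1) by exact: val_inj.
by rewrite [LHS]row_mxEl mxE.
Qed.

Let rV_consS p i : rV_cons p 0 (lift 0 i) = p.2 0 i.
Proof.
have -> : lift 0 i = rshift 1 i by exact: val_inj.
by rewrite [LHS]row_mxEr.
Qed.

Lemma rV_consK : cancel rV_cons rV_uncons.
Proof.
move=> [a r]; rewrite /rV_uncons rV_cons0; congr (_, _).
by apply/rowP => i; rewrite mxE rV_consS.
Qed.

Lemma rV_unconsK : cancel rV_uncons rV_cons.
Proof.
move=> r; apply/rowP => i.
by case: (unliftP 0 i) => [j ->|->]; rewrite ?rV_consS ?rV_cons0//= mxE.
Qed.

Lemma measurable_rV_cons : measurable_fun [set: R * 'rV[R]_n] rV_cons.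
Proof.
apply/measurable_fun_rVP => i.
case: (unliftP 0 i) => [j ->|->].
  rewrite (_ : _ \o _ = rV_coord j \o snd).
    exact: (measurableT_comp (measurable_rV_coord j)).
  by apply/funext => p; rewrite /= /rV_coord rV_consS.
rewrite (_ : _ \o _ = fst); first exact: measurable_fst.
by apply/funext => p; rewrite /= /rV_coord rV_cons0.
Qed.

Lemma measurable_rV_uncons : measurable_fun [set: 'rV[R]_n.+1] rV_uncons.
Proof.
pose tl (r : 'rV[R]_n.+1) : 'rV[R]_n := \row_i r 0 (lift 0 i).
apply: (@measurable_fun_pair _ _ _ _ _ _ (rV_coord 0) tl).
  exact: measurable_rV_coord.
apply/measurable_fun_rVP => i.
rewrite (_ : _ \o _ = rV_coord (lift 0 i)); first exact: measurable_rV_coord.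
by apply/funext => r; rewrite /= /rV_coord mxE.
Qed.

End rV_cons.

Section rV_prod.
Local Open Scope ereal_scope.
Context {R : realType} {n : nat}.
Variable m : {sigma_finite_measure set 'rV[R]_n -> \bar R}.

Definition rV_prod : set 'rV[R]_n.+1 -> \bar R :=
  pushforward (lebesgue_measure \x m) rV_cons.

Let rV_prod0 : rV_prod set0 = 0.
Proof. by rewrite /rV_prod /pushforward preimage_set0 measure0. Qed.

Let rV_prod_ge0 A : 0 <= rV_prod A.
Proof. by rewrite /rV_prod /pushforward; exact: measure_ge0. Qed.

Let rV_prod_sigma_additive : semi_sigma_additive rV_prod.
Proof.
move=> F mF tF mUF; rewrite /rV_prod /pushforward preimage_bigcup.
have mcons A : measurable A -> measurable (rV_cons @^-1` A).
  by move=> mA; rewrite -[X in measurable X]setTI; exact: measurable_rV_cons.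
apply: measure_semi_sigma_additive.
- by move=> k; exact: mcons.
- apply/trivIsetP => /= i j _ _ ij; rewrite -preimage_setI.
  by move/trivIsetP : tF => /(_ _ _ _ _ ij) ->//; rewrite preimage_set0.
- by rewrite -preimage_bigcup; exact: mcons.
Qed.

HB.instance Definition _ := isMeasure.Build _ _ _
  rV_prod rV_prod0 rV_prod_ge0 rV_prod_sigma_additive.

Let rV_prod_sigma_finite : sigma_finite setT rV_prod.
Proof.
have /sigma_finiteP[F [FT ndF mF]] := sigma_finiteT (@lebesgue_measure R).
have /sigma_finiteP[G [GT ndG mG]] := sigma_finiteT m.
exists (fun k => rV_uncons @^-1` (F k `*` G k)).
  apply/seteqP; split=> // r _.
  have : [set: R] (rV_uncons r).1 by [].
  have : [set: 'rV[R]_n] (rV_uncons r).2 by [].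
  rewrite [in X in X -> _]GT => -[j _ Gj]; rewrite [in X in X -> _]FT => -[i _ Fi].
  exists (maxn i j) => //; split.
  - by move: Fi; exact/subsetPset/ndF/leq_maxl.
  - by move: Gj; exact/subsetPset/ndG/leq_maxr.
move=> k; have [mFk Fkoo] := mF k; have [mGk Gkoo] := mG k; split.
  rewrite -[X in measurable X]setTI; apply: measurable_rV_uncons => //.
  exact: measurableX.
rewrite /rV_prod /pushforward -comp_preimage.
rewrite (_ : _ \o _ = id); last by apply/funext => p /=; rewrite rV_consK.
by rewrite preimage_id product_measure1E// lte_mul_pinfty// ge0_fin_numE.
Qed.

HB.instance Definition _ := Measure_isSigmaFinite.Build _ _ _
  rV_prod rV_prod_sigma_finite.

End rV_prod.

Fixpoint lebesgue_rV (R : realType) (n : nat) :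
    {sigma_finite_measure set 'rV[R]_n -> \bar R} :=
  match n with
  | 0 => \d_(0 : 'rV[R]_0)
  | k.+1 => rV_prod (lebesgue_rV R k)
  end.

Section complex_L2.
Context {R : realType} {n : nat}.
Implicit Types (D : set 'rV[R]_n) (f g : 'rV[R]_n -> R[i]).

Definition cmeasurable D f :=
  measurable_fun D (fun r => complex.Re (f r)) /\
  measurable_fun D (fun r => complex.Im (f r)).

Definition cintegral D f : R[i] :=
  Complex (\int[lebesgue_rV R n]_(r in D) complex.Re (f r))
          (\int[lebesgue_rV R n]_(r in D) complex.Im (f r)).

Definition in_L2 D f :=
  cmeasurable D f /\
  (\int[lebesgue_rV R n]_(r in D) (Normc.normc (f r) ^+ 2)%:E < +oo)%E.

Definition L2_ip D f g : R[i] := cintegral D (fun r => conjc (f r) * g r).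

Definition L2_norm D f : R := Num.sqrt (complex.Re (L2_ip D f f)).

End complex_L2.

Section sobolev.
Context {R : realType} {n : nat}.
Implicit Types (D : set 'rV[R]_n) (u v w : 'rV[R]_n -> R[i]).

Definition partial (i : 'I_n) (f : 'rV[R]_n -> R) : 'rV[R]_n -> R :=
  fun r => 'D_(delta_mx 0 i) f r.

Definition iter_partial (s : seq 'I_n) (f : 'rV[R]_n -> R) :=
  foldr partial f s.

Definition smooth (f : 'rV[R]_n -> R) :=
  forall (s : seq 'I_n) r, differentiable (iter_partial s f) r.

Definition test_fun D (phi : 'rV[R]_n -> R) :=
  smooth phi /\
  exists K, [/\ compact K, K `<=` D & forall r, ~ K r -> phi r = 0].

Definition ctest_fun D (phi : 'rV[R]_n -> R[i]) :=
  test_fun D (fun r => complex.Re (phi r)) /\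
  test_fun D (fun r => complex.Im (phi r)).

(* By complex linearity, it is enough to test against real-valued phi. *)
Definition is_weak_partial D (i : 'I_n) u v :=
  in_L2 D v /\
  forall phi, test_fun D phi ->
    cintegral D (fun r => u r * real_complex R (partial i phi r)) =
    - cintegral D (fun r => v r * real_complex R (phi r)).

(* Elements of function spaces are represented by functions, considered up to
   equality a.e. on D; [weak_partial] picks a representative. *)
Definition weak_partial D (i : 'I_n) u : 'rV[R]_n -> R[i] :=
  xget 0 [set v | is_weak_partial D i u v].

Definition in_H1 D u :=
  in_L2 D u /\ forall i, exists v, is_weak_partial D i u v.

Definition H1_norm D u : R :=
  Num.sqrt (L2_norm D u ^+ 2 + \sum_(i < n) L2_norm D (weak_partial D i u) ^+ 2).

Definition in_H10 D u :=
  in_H1 D u /\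
  forall e : R, 0 < e -> exists2 phi, ctest_fun D phi & H1_norm D (u - phi) < e.

Definition H10_ip D v w : R[i] :=
  \sum_(i < n) L2_ip D (weak_partial D i v) (weak_partial D i w).

Definition H10_norm D v : R := Num.sqrt (complex.Re (H10_ip D v v)).

End sobolev.

Section gross_pitaevskii.
Context {R : realType} {n : nat}.
Variables (D : set 'rV[R]_n.+2) (V : 'rV[R]_n.+2 -> R) (beta Omega : R).
Implicit Types u v w h : 'rV[R]_n.+2 -> R[i].

Local Notation "x %:C" := (real_complex R x).

(* The coordinates x and y are those of index 0 and 1. *)
Definition Lz u : 'rV[R]_n.+2 -> R[i] := fun r =>
  - 'i%C * ((r 0 0)%:C * weak_partial D 1 u r - (r 0 1)%:C * weak_partial D 0 u r).

(* The integral of conjc u * Lz u is real on H^1_0, so taking the real part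
   discards nothing. *)
Definition energy u : R :=
  complex.Re (cintegral D (fun r =>
    (2^-1 * (\sum_(i < n.+2) Normc.normc (weak_partial D i u r) ^+ 2)
     + 2^-1 * V r * Normc.normc (u r) ^+ 2
     + beta / 4 * Normc.normc (u r) ^+ 4)%:C
    - (Omega / 2)%:C * conjc (u r) * Lz u r)).

(* The value at v of the real Frechet derivative of [energy] at u. *)
Definition energy_deriv u v : R :=
  complex.Re (H10_ip D u v) +
  complex.Re (L2_ip D (fun r =>
    (V r)%:C * u r + (beta * Normc.normc (u r) ^+ 2)%:C * u r
    - Omega%:C * Lz u r) v).

Definition manifold u := in_H10 D u /\ L2_norm D u = 1.

(* Riesz representatives, unique up to equality a.e. on D. *)
Definition sobolev_grad u : 'rV[R]_n.+2 -> R[i] :=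
  xget 0 [set g | in_H10 D g /\
    forall h, in_H10 D h -> complex.Re (H10_ip D g h) = energy_deriv u h].

Definition green w : 'rV[R]_n.+2 -> R[i] :=
  xget 0 [set z | in_H10 D z /\
    forall h, in_H10 D h -> H10_ip D z h = L2_ip D w h].

Definition tangent_proj u w : 'rV[R]_n.+2 -> R[i] := fun r =>
  w r - (complex.Re (H10_ip D w (green u)) / H10_norm D (green u) ^+ 2)%:C
        * green u r.

Definition proj_grad u := tangent_proj u (sobolev_grad u).

Definition retraction v : 'rV[R]_n.+2 -> R[i] :=
  fun r => v r / (L2_norm D v)%:C.

Fixpoint H10_scheme (alpha : nat -> R) u0 (k : nat) : 'rV[R]_n.+2 -> R[i] :=
  match k with
  | 0 => u0
  | j.+1 => let u := H10_scheme alpha u0 j in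
      retraction (fun r => u r - (alpha j)%:C * proj_grad u r)
  end.

End gross_pitaevskii.

(* Main.v *)
(* On a bounded domain in dimension 2 or 3 the energy is a quadratic form plus a
   quartic term. The lower bound on V makes the quadratic form coercive on H^1_0:
   pointwise, Omega Re(conj(u) L_z u) is absorbed by V |u|^2 and the part
   1/(1+K) of |grad u|^2. The Poincare and Ladyzhenskaya inequalities
   (||f||_4 <= C ||grad f||_2) bound all the terms of the energy and of its
   derivative by powers of the H^1_0 norm. Hence E(u - a g) is at most
   E(u) - a (1 - C a) ||g||^2 when g is the projected gradient, because
   <E'(u), g> = ||g||^2, and C depends only on bounds for ||u|| and ||g||. As g is
   tangent, the L^2 norm of u - a g is at least 1, so the retraction divides by a
   number at least 1 and, both parts of the energy being nonnegative, does not
   increase it. The energy thus stays below its initial value, which by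
   coercivity bounds the H^1_0 norm of all the iterates, and the constants are
   uniform. *)

Require Import Defs.
From mathcomp Require Import all_boot all_order all_algebra.
From mathcomp Require Import complex ring lra.
From mathcomp Require Import all_classical all_reals all_analysis.
From mathcomp Require Import measurable_realfun.

Set Implicit Arguments.
Unset Strict Implicit.
Unset Printing Implicit Defensive.

Import Order.TTheory GRing.Theory Num.Theory.
Import numFieldNormedType.Exports.

Local Open Scope classical_set_scope.
Local Open Scope ring_scope.

(** * Square-integrable functions *)

(** A weak derivative is a representative selected by [xget], so it depends linearly on the function
    only on H^1_0 and only almost everywhere. The descent is therefore proved for a set [H] in a
    real vector space and for semidefinite forms that are linear on [H]; no quotient by null
    functions is formed. That [xget] does not return its default 0 is a matter of existence: Riesz
    representation, hence completeness of H^1_0, provides the Sobolev gradient and the Green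
    function.

    H^1_0 is split into real and imaginary parts and identified with the L^2 closure of the graph of
    the gradient on test functions, to which identities and inequalities pass by density. The
    comparison with the selected representatives is the uniqueness of weak derivatives, which rests
    on smooth bumps approximating indicators of boxes.

    The constants come from the half-side [M] of a cube containing [D], an essential bound of [V],
    and [beta], [Omega], [K], [rho]. The Poincare constant is [4 * M], the coercivity constant
    [K / (1 + K)], and the initial energy is replaced by a bound in terms of [rho]. *)

Lemma cvg0_le (R : realType) (u v : nat -> R) :
  (forall k, 0 <= u k <= v k) -> v k @[k --> \oo] --> 0 -> u k @[k --> \oo] --> 0.
Proof.
move=> uv v0; apply: (@squeeze_cvgr _ _ _ _ (fun=> 0) v) => //.
  exact: nearW.
exact: cvg_cst.
Qed.

Lemma cvg_eqN (R : realType) (u v : nat -> R) a b : (forall k, u k = - v k) ->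
  u k @[k --> \oo] --> a -> v k @[k --> \oo] --> b -> a = - b.
Proof.
move=> uv ua vb; have uE : u = fun k => - v k by exact/funext.
rewrite -(cvg_lim _ ua)// uE; apply: cvg_lim => //; exact: cvgN.
Qed.

Section square_integrable.
Context {d : measure_display} {T : measurableType d} {R : realType}.
Variables (mu : {measure set T -> \bar R}) (D : set T).
Hypothesis mD : measurable D.
Implicit Types (f g h : T -> R) (F G : nat -> T -> R).

Definition sq_int f :=
  measurable_fun D f /\ (\int[mu]_(x in D) (f x ^+ 2)%:E < +oo)%E.

Definition ip f g : R := \int[mu]_(x in D) (f x * g x).

Definition nm f : R := Num.sqrt (ip f f).

Lemma sq_int_integrable_sqr f :
  sq_int f -> mu.-integrable D (EFin \o (fun x => f x ^+ 2)).
Proof.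
move=> [mf foo]; apply/integrableP; split.
  by apply/measurable_EFinP; exact: measurable_funX.
by under eq_integral do rewrite /= ger0_norm ?sqr_ge0//.
Qed.

Lemma sq_int_integrable_mul f g :
  sq_int f -> sq_int g -> mu.-integrable D (EFin \o (fun x => f x * g x)).
Proof.
move=> sf sg.
have mf := sf.1; have mg := sg.1.
apply: (@le_integrable _ _ _ mu D mD _
   (fun x => (EFin \o (fun x => f x ^+ 2)%R) x + (EFin \o (fun x => g x ^+ 2)%R) x)%E).
- by apply/measurable_EFinP; exact: measurable_funM.
- move=> x Dx /=; rewrite lee_fin normrM [leRHS]ger0_norm ?addr_ge0 ?sqr_ge0//.
  rewrite -(real_normK (num_real (f x))) -(real_normK (num_real (g x))).
  by have := sqr_ge0 (`|f x| - `|g x|); nra.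
- by apply: integrableD => //; exact: sq_int_integrable_sqr.
Qed.

Lemma integrable_sq_int f : measurable_fun D f ->
  mu.-integrable D (EFin \o (fun x => f x ^+ 2)) -> sq_int f.
Proof.
move=> mf /integrableP[_ foo]; split => //.
by under eq_integral do rewrite -[_%:E]gee0_abs ?lee_fin ?sqr_ge0//.
Qed.

Lemma le_sq_int f g c : measurable_fun D f -> sq_int g ->
  {ae mu, forall x, D x -> `|f x| <= c * `|g x|} -> sq_int f.
Proof.
move=> mf sg fg; split => //.
have := @ae_ge0_le_integral _ _ _ mu D mD (fun x => (f x ^+ 2)%:E)
  (fun x => (c ^+ 2 * g x ^+ 2)%:E).
move=> /(_ _ _ _ _ _)/le_lt_trans; apply.
- by move=> x _; rewrite lee_fin sqr_ge0.
- by apply/measurable_EFinP; exact: measurable_funX.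
- by move=> x _; rewrite lee_fin mulr_ge0 ?sqr_ge0.
- by apply/measurable_EFinP/measurable_funM => //; apply: measurable_funX; case: sg.
- apply: filterS fg => x /[swap] Dx /(_ Dx) fg; rewrite lee_fin.
  rewrite -(real_normK (num_real (f x))) -(real_normK (num_real (g x))) -exprMn.
  by rewrite lerXn2r// nnegrE// (le_trans _ fg).
- under eq_integral do rewrite EFinM.
  rewrite integralZl ?sq_int_integrable_sqr//.
  by rewrite lte_mul_pinfty ?lee_fin ?sqr_ge0//; case: sg.
Qed.

Lemma sq_intD f g : sq_int f -> sq_int g -> sq_int (fun x => f x + g x).
Proof.
move=> sf sg; apply: integrable_sq_int; first by apply: measurable_funD; [case: sf|case: sg].
rewrite (_ : _ \o _ =
    ((EFin \o (fun x => f x ^+ 2)%R) \+ (EFin \o (fun x => g x ^+ 2)%R) \+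
     ((EFin \o (fun x => f x * g x)%R) \+ (EFin \o (fun x => f x * g x)%R)))%E).
  by do !apply: integrableD => //;
    [exact: sq_int_integrable_sqr|exact: sq_int_integrable_sqr|
     exact: sq_int_integrable_mul|exact: sq_int_integrable_mul].
by apply/funext => x /=; rewrite -!EFinD; congr EFin; ring.
Qed.

Lemma sq_intZ c f : sq_int f -> sq_int (fun x => c * f x).
Proof.
move=> sf; apply: (@le_sq_int _ f `|c|) => //.
  by apply: measurable_funM => //; case: sf.
by apply: aeW => x _; rewrite normrM.
Qed.

Lemma sq_intN f : sq_int f -> sq_int (fun x => - f x).
Proof. by move=> /(sq_intZ (-1)); under eq_fun do rewrite mulN1r. Qed.

Lemma sq_intB f g : sq_int f -> sq_int g -> sq_int (fun x => f x - g x).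
Proof. by move=> sf /sq_intN; exact: sq_intD. Qed.

Lemma ipE f g : ip f g = \int[mu]_(x in D) (f x * g x).
Proof. by []. Qed.

Lemma ipC f g : ip f g = ip g f.
Proof. by apply: eq_Rintegral => x _; rewrite mulrC. Qed.

Lemma ipDl f g h : sq_int f -> sq_int g -> sq_int h ->
  ip (fun x => f x + g x) h = ip f h + ip g h.
Proof.
move=> sf sg sh; rewrite /ip -RintegralD//; try exact: sq_int_integrable_mul.
by apply: eq_Rintegral => x _; rewrite mulrDl.
Qed.

Lemma ipZl c f h : sq_int f -> sq_int h ->
  ip (fun x => c * f x) h = c * ip f h.
Proof.
move=> sf sh; rewrite /ip -RintegralZl//; last exact: sq_int_integrable_mul.
by apply: eq_Rintegral => x _; rewrite mulrA.
Qed.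

Lemma ipNl f h : sq_int f -> sq_int h -> ip (fun x => - f x) h = - ip f h.
Proof.
move=> sf sh; rewrite -mulN1r -ipZl//; congr ip.
by apply/funext => x; rewrite mulN1r.
Qed.

Lemma ipBl f g h : sq_int f -> sq_int g -> sq_int h ->
  ip (fun x => f x - g x) h = ip f h - ip g h.
Proof. by move=> sf sg sh; rewrite ipDl// ?ipNl//; exact: sq_intN. Qed.

Lemma ipDr f g h : sq_int f -> sq_int g -> sq_int h ->
  ip h (fun x => f x + g x) = ip h f + ip h g.
Proof. by move=> *; rewrite ipC ipDl// ![ip _ h]ipC. Qed.

Lemma ipZr c f h : sq_int f -> sq_int h ->
  ip h (fun x => c * f x) = c * ip h f.
Proof. by move=> *; rewrite ipC ipZl// ipC. Qed.

Lemma ipNr f h : sq_int f -> sq_int h -> ip h (fun x => - f x) = - ip h f.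
Proof. by move=> *; rewrite ipC ipNl// ipC. Qed.

Lemma ipBr f g h : sq_int f -> sq_int g -> sq_int h ->
  ip h (fun x => f x - g x) = ip h f - ip h g.
Proof. by move=> *; rewrite ipC ipBl// ![ip _ h]ipC. Qed.

Lemma ip_ge0 f : 0 <= ip f f.
Proof. by apply: Rintegral_ge0 => x _; rewrite -expr2 sqr_ge0. Qed.

Lemma ae_eq_ip f f' g g' : measurable_fun D f -> measurable_fun D f' ->
  measurable_fun D g -> measurable_fun D g' ->
  {ae mu, forall x, D x -> f x = f' x} ->
  {ae mu, forall x, D x -> g x = g' x} -> ip f g = ip f' g'.
Proof.
move=> mf mf' mg mg' ff' gg'; rewrite /ip /Rintegral; congr fine.
apply: ae_eq_integral => //; try by apply/measurable_EFinP; exact: measurable_funM.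
by apply: filterS2 ff' gg' => x fx gx Dx /=; rewrite fx// gx.
Qed.

Lemma nm_ge0 f : 0 <= nm f. Proof. exact: sqrtr_ge0. Qed.

Lemma sqr_nm f : nm f ^+ 2 = ip f f.
Proof. by rewrite sqr_sqrtr// ip_ge0. Qed.

Lemma ip_CS f g : sq_int f -> sq_int g -> `|ip f g| <= nm f * nm g.
Proof.
move=> sf sg.
have H t : 0 <= t ^+ 2 * ip f f + 2 * t * ip f g + ip g g.
  have stf := sq_intZ t sf.
  have := ip_ge0 (fun x => t * f x + g x).
  rewrite ipDl ?ipDr ?ipZl ?ipZr// ?(ipC g f); last exact: sq_intD.
  by set a := ip f f; set b := ip f g; set c := ip g g; lra.
rewrite -(@ler_pXn2r _ 2)// ?nnegrE ?mulr_ge0 ?nm_ge0//.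
rewrite real_normK ?num_real// exprMn !sqr_nm.
have [f0|f0] := eqVneq (ip f f) 0.
  suff -> : ip f g = 0 by rewrite expr0n f0 mul0r.
  apply/eqP; apply/negPn/negP => fg0.
  (* When [ip f f = 0] the polynomial of [H] is affine in [t], and this argument makes it equal to
     -1. *)
  have := H (- (ip g g + 1) / (2 * ip f g)); rewrite f0 mulr0 add0r.
  have -> : 2 * (- (ip g g + 1) / (2 * ip f g)) * ip f g = - (ip g g + 1) by field.
  by lra.
have fp : 0 < ip f f by rewrite lt_def f0 ip_ge0.
(* The minimizer of the quadratic polynomial. *)
have := H (- ip f g / ip f f).
have -> : (- ip f g / ip f f) ^+ 2 * ip f f + 2 * (- ip f g / ip f f) * ip f g + ip g g
  = ip g g - ip f g ^+ 2 / ip f f by field.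
by rewrite subr_ge0 ler_pdivrMr// mulrC.
Qed.

Lemma nmD f g : sq_int f -> sq_int g -> nm (fun x => f x + g x) <= nm f + nm g.
Proof.
move=> sf sg; rewrite -(@ler_pXn2r _ 2)// ?nnegrE ?addr_ge0 ?nm_ge0//.
rewrite sqr_nm ipDl ?ipDr//; last exact: sq_intD.
have := ip_CS sf sg; rewrite (ipC g f) sqrrD !sqr_nm => /ler_normlP[_].
by rewrite -[X in _ -> _ <= _ + X + _]mulr_natl; lra.
Qed.

Lemma nmZ c f : sq_int f -> nm (fun x => c * f x) = `|c| * nm f.
Proof.
move=> sf; rewrite /nm ipZl ?ipZr//; last exact: sq_intZ.
by rewrite mulrA -expr2 sqrtrM ?sqr_ge0// sqrtr_sqr.
Qed.

Lemma nmN f : nm (fun x => - f x) = nm f.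
Proof. by congr Num.sqrt; apply: eq_Rintegral => x _; rewrite mulrNN. Qed.

Lemma nmB f g : nm (fun x => f x - g x) = nm (fun x => g x - f x).
Proof. by rewrite -nmN; congr nm; apply/funext => x; rewrite opprB. Qed.

Lemma nm0 : nm (fun=> 0) = 0.
Proof.
rewrite /nm /ip (_ : \int[mu]_(x in D) _ = 0) ?sqrtr0//.
by under eq_Rintegral do rewrite mulr0; rewrite /Rintegral integral0_eq.
Qed.

Lemma integral_sqr_ip f : sq_int f ->
  (\int[mu]_(x in D) (f x ^+ 2)%:E)%E = (ip f f)%:E.
Proof.
move=> sf; rewrite /ip /Rintegral fineK; first by under eq_integral do rewrite expr2.
exact/integrable_fin_num/sq_int_integrable_mul.
Qed.

Lemma integral_mul_ip f g : sq_int f -> sq_int g ->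
  (\int[mu]_(x in D) (f x * g x)%:E)%E = (ip f g)%:E.
Proof.
by move=> sf sg; rewrite /ip /Rintegral fineK//; exact/integrable_fin_num/sq_int_integrable_mul.
Qed.

Lemma sq_int_normr f : sq_int f -> sq_int (fun x => `|f x|).
Proof.
move=> sf; apply: (@le_sq_int _ f 1) => //.
  by apply: measurableT_comp => //; case: sf.
by apply: aeW => x _; rewrite mul1r normr_id.
Qed.

Lemma nm_normr f : nm (fun x => `|f x|) = nm f.
Proof.
by congr Num.sqrt; apply: eq_Rintegral => r _; rewrite -normrM ger0_norm// -expr2 sqr_ge0.
Qed.

Lemma ae_eq_nm f g : measurable_fun D f -> measurable_fun D g ->
  {ae mu, forall x, D x -> f x = g x} -> nm f = nm g.
Proof. by move=> mf mg fg; congr Num.sqrt; exact: ae_eq_ip. Qed.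

Lemma le_nm f g c : 0 <= c -> measurable_fun D f -> sq_int g ->
  {ae mu, forall x, D x -> `|f x| <= c * `|g x|} -> nm f <= c * nm g.
Proof.
move=> c0 mf sg fg; have sf := le_sq_int mf sg fg.
rewrite -(@ler_pXn2r _ 2)// ?nnegrE ?mulr_ge0 ?nm_ge0// exprMn !sqr_nm -lee_fin.
rewrite EFinM -!integral_sqr_ip// -integralZl//; last exact: sq_int_integrable_sqr.
apply: ae_ge0_le_integral => //.
- by move=> x _; rewrite lee_fin sqr_ge0.
- by apply/measurable_EFinP; exact: measurable_funX.
- by move=> x _; rewrite lee_fin mulr_ge0 ?sqr_ge0.
- by apply/measurable_EFinP/measurable_funM => //; apply: measurable_funX; case: sg.
apply: filterS fg => x /[swap] Dx /(_ Dx) fg; rewrite lee_fin.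
rewrite -(real_normK (num_real (f x))) -(real_normK (num_real (g x))) -exprMn.
by rewrite lerXn2r// nnegrE// (le_trans _ fg).
Qed.

(** Fatou's lemma for an almost everywhere limit. As the bound is known only from the index [N] on,
    the sequence is shifted by [N] before the limit inferior is taken. *)
Lemma fatou_le (G : nat -> T -> R) (g : T -> R) (C : \bar R) (N : nat) :
  (forall k, measurable_fun D (G k)) -> measurable_fun D g ->
  (forall k x, D x -> 0 <= G k x) ->
  {ae mu, forall x, D x -> G k x @[k --> \oo] --> g x} ->
  (forall k, (N <= k)%N -> (\int[mu]_(x in D) (G k x)%:E <= C)%E) ->
  (\int[mu]_(x in D) (g x)%:E <= C)%E.
Proof.
move=> mG mg g0 gcvg gC.
pose u k x := (G (k + N)%N x)%:E.
have mu_ k : measurable_fun D (u k) by apply/measurable_EFinP.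
have einf_le (v : (\bar R)^nat) : (forall k, v k <= C)%E -> (limn_einf v <= C)%E.
  move=> vC; rewrite limn_einf_lim; apply: lime_le; first exact: is_cvg_einfs.
  apply: nearW => k; apply: le_trans (vC k).
  by apply: ereal_inf_lbound; exists k => //=.
have ug : {ae mu, forall x, D x -> limn_einf (u^~ x) = (g x)%:E}.
  apply: filterS gcvg => x /[swap] Dx /(_ Dx) gx.
  have : (u k x) @[k --> \oo] --> (g x)%:E.
    apply: cvg_EFin; first exact: nearW.
    by rewrite (cvg_shiftn N (fun k => G k x)).
  by move=> /cvg_limn_einf_sup[].
have mlim : measurable_fun D (fun x => limn_einf (u^~ x)).
  (* Measurability of the limit inferior comes from that of a limit superior, by negation. *)
  rewrite (_ : (fun _ => _) = (fun x => - limn_esup ((fun k => -%E \o (u k))^~ x))%E).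
    apply: measurableT_comp => //; apply: measurable_fun_limn_esup => k.
    exact: (measurableT_comp (@oppe_measurable R _)).
  by apply/funext => x; rewrite -limn_einfN; congr limn_einf; apply/funext => k /=; rewrite opprK.
have -> : (\int[mu]_(x in D) (g x)%:E = \int[mu]_(x in D) limn_einf (u^~ x))%E.
  apply: ae_eq_integral => //; first exact/measurable_EFinP.
  by apply: filterS ug => x + Dx => ->.
apply: le_trans (fatou mu mD mu_ _) _; first by move=> k x Dx; rewrite lee_fin g0.
by apply: einf_le => k; apply: gC; rewrite leq_addl.
Qed.

(* The sum of the [4 ^ k * h k ^ 2] is integrable, hence finite almost everywhere. *)
Lemma ae_geometric (h : nat -> T -> R) :
  (forall k, sq_int (h k)) -> (forall k, nm (h k) <= 4^-1 ^+ k) ->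
  {ae mu, forall x, D x -> exists M : R, forall k, `|h k x| <= M * 2^-1 ^+ k}.
Proof.
move=> sh hk.
pose w k x := (4 ^+ k * h k x ^+ 2)%:E.
have w0 k x : D x -> (0 <= w k x)%E by rewrite lee_fin mulr_ge0 ?sqr_ge0// exprn_ge0.
have mw k : measurable_fun D (w k).
  apply/measurable_EFinP/measurable_funM => //; apply: measurable_funX.
  by case: (sh k).
have Iw k : (\int[mu]_(x in D) w k x <= (4^-1 ^+ k)%:E)%E.
  rewrite /w; under eq_integral do rewrite EFinM.
  rewrite integralZl//; last exact: sq_int_integrable_sqr.
  rewrite integral_sqr_ip// -EFinM lee_fin -sqr_nm.
  have : nm (h k) ^+ 2 <= (4^-1 ^+ k) ^+ 2.
    by rewrite lerXn2r// nnegrE ?nm_ge0// exprn_ge0.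
  move=> H; apply: le_trans (ler_wpM2l _ H) _; first by rewrite exprn_ge0.
  by rewrite expr2 mulrA -exprMn divff// expr1n mul1r.
pose S : T -> \bar R := fun x => (\big[+%E/0%R]_(0 <= k <oo) w k x)%E.
have mS : measurable_fun D S.
  by apply: ge0_emeasurable_sum => // k x Dx _; exact: w0.
have IS : (\int[mu]_(x in D) S x < +oo)%E.
  rewrite /S integral_nneseries//.
  apply: (@le_lt_trans _ _ (\big[+%E/0%R]_(0 <= k <oo) (4^-1 ^+ k)%:E)%E).
    by apply: lee_nneseries => // k _; rewrite integral_ge0// => x; exact: w0.
  have := @cvg_geometric_series R 1 4^-1; rewrite gtr0_norm// => /(_ _) gc.
  have /gc gcv : (4^-1 : R) < 1 by lra.
  rewrite (_ : limn _ = (1 / (1 - 4^-1))%:E) ?ltry//.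
  apply/cvg_lim => //.
  under eq_fun do rewrite sumEFin; apply: cvg_EFin; first exact: nearW.
  rewrite (_ : _ \o _ = series (geometric 1 4^-1))//.
  by apply/funext => m; apply: eq_bigr => k _ /=; rewrite mul1r.
have S0 x : D x -> (0 <= S x)%E.
  by move=> Dx; apply: nneseries_ge0 => k _ _; exact: w0.
have iS : mu.-integrable D S.
  apply/integrableP; split => //.
  by under eq_integral => x /[!inE] Dx do rewrite gee0_abs ?S0//.
have := integrable_ae mD iS; apply: filterS => x /[swap] Dx /(_ Dx) fS.
exists (Num.sqrt (fine (S x))) => k.
have : (w k x <= S x)%E.
  apply: le_trans (nneseries_lim_ge k.+1 _); last by move=> i _ _; exact: w0.
  rewrite big_nat_recr//= leeDr// sume_ge0// => i _; exact: w0.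
rewrite -{1}(fineK fS) lee_fin => wk.
rewrite -(@ler_pXn2r _ 2)// ?nnegrE ?mulr_ge0 ?sqrtr_ge0 ?exprn_ge0//.
rewrite exprMn sqr_sqrtr ?fine_ge0 ?S0// real_normK ?num_real//.
have -> : (2^-1 ^+ k) ^+ 2 = (4 ^+ k)^-1 :> R.
  by rewrite -exprM mulnC exprM -exprVn; congr (_ ^+ k); field.
by rewrite ler_pdivlMr ?exprn_gt0// mulrC.
Qed.

Definition L2_cvg (F : nat -> T -> R) f :=
  nm (fun x => F k x - f x) @[k --> \oo] --> 0.

Lemma L2_cvgP F f : L2_cvg F f <->
  forall e, 0 < e -> exists N, forall k, (N <= k)%N -> nm (fun x => F k x - f x) <= e.
Proof.
split=> [H e e0|H].
  move/cvgrPdist_le : H => /(_ e e0)[N _ H]; exists N => k Nk.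
  by have := H k Nk; rewrite /= sub0r normrN ger0_norm// nm_ge0.
apply/cvgrPdist_le => e e0; have [N HN] := H e e0; exists N => // k Nk /=.
by rewrite sub0r normrN ger0_norm ?nm_ge0// HN.
Qed.

(** Distances at most [4^-1 ^+ k] along [s] make the pointwise errors decay geometrically, by
    [ae_geometric]. Of a subsequence only [k <= s k] is recorded: it carries bounds valid for large
    indices over to [s]. *)
Lemma L2_cvg_ae F f : (forall k, sq_int (F k)) -> sq_int f -> L2_cvg F f ->
  exists2 s : nat -> nat, (forall k, k <= s k)%N &
    {ae mu, forall x, D x -> F (s k) x @[k --> \oo] --> f x}.
Proof.
move=> sF sf /L2_cvgP ff.
have /choice[s sP] k : exists m, (k <= m)%N /\ nm (fun x => F m x - f x) <= 4^-1 ^+ k.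
  have [|N NP] := ff (4^-1 ^+ k); first by rewrite exprn_gt0// invr_gt0.
  by exists (maxn N k); rewrite leq_maxr NP// leq_maxl.
exists s; first by move=> k; case: (sP k).
have := @ae_geometric (fun k x => F (s k) x - f x) _ _.
move=> /(_ (fun k => sq_intB (sF _) sf) (fun k => (sP k).2)).
apply: filterS => x /[swap] Dx /(_ Dx)[M HM].
apply/subr_cvg0; apply/norm_cvg0P.
apply: (@cvg0_le _ _ (fun k => M * 2^-1 ^+ k)).
- by move=> k; rewrite normr_ge0 HM.
- have := @cvg_geometric R M 2^-1; apply.
  by rewrite gtr0_norm//; lra.
Qed.

(** Riesz-Fischer. A rapidly Cauchy subsequence converges almost everywhere, and Fatou's lemma
    applied to [F n - F (s k)], with [n] fixed, turns this into convergence in norm of the whole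
    sequence. *)
Lemma L2_complete F : (forall k, sq_int (F k)) ->
  (forall e, 0 < e -> exists N, forall m n, (N <= m)%N -> (N <= n)%N ->
     nm (fun x => F m x - F n x) <= e) ->
  exists2 f, sq_int f & L2_cvg F f.
Proof.
move=> sF fC.
have /choice[N NP] k : exists N, forall m n, (N <= m)%N -> (N <= n)%N ->
     nm (fun x => F m x - F n x) <= 4^-1 ^+ k.
  by apply: fC; rewrite exprn_gt0// invr_gt0.
(* A running sum is nondecreasing, dominates each [N k] and is at least [k]. *)
pose s k := (\sum_(i < k.+1) (N i).+1)%N.
have Ns k : (N k <= s k)%N by rewrite /s big_ord_recr/= (leq_trans (leqnSn _))// leq_addl.
have sS k : (s k <= s k.+1)%N by rewrite /s [leqRHS]big_ord_recr/= leq_addr.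
have ks k : (k <= s k)%N.
  by elim: k => // k IH; rewrite /s big_ord_recr/= addnS ltnS (leq_trans IH)// leq_addr.
pose h k x := F (s k.+1) x - F (s k) x.
have sh k : sq_int (h k) by exact: sq_intB.
have aeM : {ae mu, forall x, D x -> exists M : R, forall k, `|h k x| <= M * 2^-1 ^+ k}.
  by apply: ae_geometric => // k; apply: NP; rewrite ?(leq_trans (Ns k)).
have aec : {ae mu, forall x, D x -> cvgn (fun k => F (s k) x)}.
  apply: filterS aeM => x /[swap] Dx /(_ Dx)[M HM].
  have M0 : 0 <= M by have := HM 0%N; rewrite expr0 mulr1; exact: le_trans.
  have : cvgn (series (fun k => h k x)).
    apply: normed_cvg; apply: (@series_le_cvg _ _ (fun k => M * 2^-1 ^+ k)) => //.
    - by move=> k; rewrite /= normr_ge0.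
    - by move=> k; rewrite mulr_ge0// exprn_ge0.
    - by apply: is_cvg_geometric_series; rewrite gtr0_norm//; lra.
  move=> cs; rewrite (_ : (fun k => _) = (fun k => F (s 0%N) x + series (fun k => h k x) k)).
    by apply: is_cvgD => //; exact: is_cvg_cst.
  by apply/funext => k; rewrite /series/= /h telescope_sumr// addrC subrK.
(* The limit superior is measurable on all of [D] and is the limit wherever there is one. *)
pose f x := fine (limn_esup (fun k => (F (s k) x)%:E)).
have mf : measurable_fun D f.
  apply: (measurableT_comp (@fine_measurable _ _ measurableT)) => //.
  apply: measurable_fun_limn_esup => k; apply/measurable_EFinP.
  by case: (sF (s k)).
have fcvg : {ae mu, forall x, D x -> F (s k) x @[k --> \oo] --> f x}.
  apply: filterS aec => x /[swap] Dx /(_ Dx) c.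
  rewrite /f; have : (F (s k) x)%:E @[k --> \oo] --> (limn (fun k => F (s k) x))%:E.
    by apply: cvg_EFin => //; exact: nearW.
  by move=> /cvg_limn_einf_sup[_ ->].
have key e : 0 < e -> exists N, forall n, (N <= n)%N ->
    sq_int (fun x => F n x - f x) /\ nm (fun x => F n x - f x) <= e.
  move=> e0; have [M MP] := fC e e0; exists M => n Mn.
  have mfn : measurable_fun D (fun x => F n x - f x).
    by apply: measurable_funB => //; case: (sF n).
  have I : (\int[mu]_(x in D) ((F n x - f x) ^+ 2)%:E <= (e ^+ 2)%:E)%E.
    apply: (@fatou_le (fun k x => (F n x - F (s k) x) ^+ 2) _ _ M).
    - by move=> k; apply: measurable_funX; case: (sq_intB (sF n) (sF (s k))).
    - exact: measurable_funX.
    - by move=> k x _; rewrite sqr_ge0.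
    - apply: filterS fcvg => x /[swap] Dx /(_ Dx) fx.
      by under eq_fun do rewrite expr2; rewrite expr2; apply: cvgM; apply: cvgB => //; exact: cvg_cst.
    - move=> k Mk; rewrite integral_sqr_ip; last exact: sq_intB.
      rewrite lee_fin -sqr_nm lerXn2r ?nnegrE ?nm_ge0 ?(ltW e0)//.
      by apply: MP => //; rewrite (leq_trans Mk).
  have si : sq_int (fun x => F n x - f x) by split => //; exact: le_lt_trans I (ltry _).
  split => //; move: I; rewrite integral_sqr_ip// lee_fin -sqr_nm.
  by rewrite ler_pXn2r// nnegrE ?nm_ge0 ?ltW.
exists f.
  have [M /(_ M (leqnn _))[si _]] := key 1 ltr01.
  rewrite (_ : f = fun x => F M x - (F M x - f x)); first exact: sq_intB.
  by apply/funext => x; rewrite subKr.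
apply/L2_cvgP => e /key[M MP]; exists M => n /MP[].
by [].
Qed.

Lemma L2_cvg_ip F f G g :
  (forall k, sq_int (F k)) -> sq_int f -> (forall k, sq_int (G k)) -> sq_int g ->
  L2_cvg F f -> L2_cvg G g -> ip (F k) (G k) @[k --> \oo] --> ip f g.
Proof.
move=> sF sf sG sg ff gg; apply/subr_cvg0; apply/norm_cvg0P.
apply: (@cvg0_le _ _ (fun k =>
   nm (fun x => F k x - f x) * nm (fun x => G k x - g x) +
   nm (fun x => F k x - f x) * nm g + nm f * nm (fun x => G k x - g x))).
- move=> k; rewrite normr_ge0/=.
  have s1 := sq_intB (sF k) sf; have s2 := sq_intB (sG k) sg.
  have -> : ip (F k) (G k) - ip f g = ip (fun x => F k x - f x) (fun x => G k x - g x) +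
     ip (fun x => F k x - f x) g + ip f (fun x => G k x - g x).
    by rewrite ipBr ?ipBl ?ipBr//; ring.
  rewrite (le_trans (ler_normD _ _))// lerD ?ip_CS// (le_trans (ler_normD _ _))//.
  by rewrite lerD ?ip_CS.
- rewrite [X in _ --> X](_ : 0 = 0 * 0 + 0 * nm g + nm f * 0); last by ring.
  by apply: cvgD; [apply: cvgD|]; apply: cvgM => //; exact: cvg_cst.
Qed.

Lemma L2_cvg_nm F f : (forall k, sq_int (F k)) -> sq_int f ->
  L2_cvg F f -> nm (F k) @[k --> \oo] --> nm f.
Proof.
move=> sF sf ff; apply: continuous_cvg; first exact: sqrt_continuous.
exact: L2_cvg_ip.
Qed.

Lemma L2_cvgD F f G g :
  (forall k, sq_int (F k)) -> sq_int f -> (forall k, sq_int (G k)) -> sq_int g ->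
  L2_cvg F f -> L2_cvg G g ->
  L2_cvg (fun k x => F k x + G k x) (fun x => f x + g x).
Proof.
move=> sF sf sG sg ff gg.
apply: (@cvg0_le _ _ (fun k =>
   nm (fun x => F k x - f x) + nm (fun x => G k x - g x))).
- move=> k; rewrite nm_ge0/=.
  apply: le_trans (nmD (sq_intB (sF k) sf) (sq_intB (sG k) sg)).
  by rewrite le_eqVlt; apply/orP/or_introl/eqP; congr nm; apply/funext => x; ring.
- by rewrite -[X in _ --> X]addr0; apply: cvgD.
Qed.

Lemma L2_cvgZ c F f : (forall k, sq_int (F k)) -> sq_int f -> L2_cvg F f ->
  L2_cvg (fun k x => c * F k x) (fun x => c * f x).
Proof.
move=> sF sf ff; rewrite /L2_cvg.
rewrite (_ : (fun k => _) = (fun k => `|c| * nm (fun x => F k x - f x))).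
  by rewrite -[X in _ --> X](mulr0 `|c|); apply: cvgM => //; exact: cvg_cst.
apply/funext => k; rewrite -nmZ; last exact: sq_intB.
by congr nm; apply/funext => x; rewrite mulrBr.
Qed.

End square_integrable.

(** * Lebesgue measure on row vectors *)

Section rV_topology.
Context {R : realType} {n : nat}.
Implicit Types (a b : 'I_n -> R) (A : set 'rV[R]_n).

Lemma cvg_rV (U : Type) (F : set_system U) {FF : Filter F}
    (f : U -> 'rV[R]_n) (l : 'rV[R]_n) :
  (forall i, f x 0 i @[x --> F] --> l 0 i) -> f x @[x --> F] --> l.
Proof.
move=> fl A [P lP PA]; apply: (filterS PA).
apply: filter_forall => i; apply: filter_forall => j.
by rewrite !ord1; apply: fl; rewrite -(ord1 i); exact: lP.
Qed.

Definition obox a b : set 'rV[R]_n := [set r | forall i, a i < r 0 i < b i].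

Definition cbox a b : set 'rV[R]_n := [set r | forall i, a i <= r 0 i <= b i].

Lemma obox_sub_cbox a b : obox a b `<=` cbox a b.
Proof. by move=> r ab i; have /andP[/ltW-> /ltW->] := ab i. Qed.

Lemma measurable_obox a b : measurable (obox a b).
Proof.
rewrite (_ : obox a b =
    \bigcap_(i in [set` finset.setT]) (rV_coord i @^-1` `]a i, b i[%classic)).
  apply: fin_bigcap_measurable => // i _; rewrite -[X in measurable X]setTI.
  exact: measurable_rV_coord.
apply/seteqP; split => r rab i.
  by move=> _ /=; rewrite in_itv/=; exact: rab.
have : [set` finset.setT] i by rewrite /= inE.
by move=> /rab /=; rewrite in_itv.
Qed.

(** Cubes with rational centre and half-side [q.2.+1%:R^-1]. The index type is countable, which
    serves both to measure open sets and, later, to glue almost everywhere statements. *)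
Definition rat_box (q : {ffun 'I_n -> rat} * nat) : ('I_n -> R) * ('I_n -> R) :=
  (fun i => ratr (q.1 i) - q.2.+1%:R^-1, fun i => ratr (q.1 i) + q.2.+1%:R^-1).

Lemma open_rat_box A r : open A -> A r ->
  exists2 q, cbox (rat_box q).1 (rat_box q).2 `<=` A &
             obox (rat_box q).1 (rat_box q).2 r.
Proof.
move=> oA Ar.
have : nbhs r A by exact: open_nbhs_nbhs.
move=> /nbhs_ballP[e /= e0 eA].
(* Half of [e], because the rational centre may be off by [k.+1%:R^-1] and the cube extends by as
   much again. *)
have [k ke] : exists k : nat, k.+1%:R^-1 < e / 2.
  have : 0 < e / 2 by rewrite divr_gt0.
  by move=> /ltr_add_invr[k]; rewrite add0r => H; exists k.
have k0 : 0 < k.+1%:R^-1 :> R by rewrite invr_gt0.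
have H i : exists q : rat, r 0 i - k.+1%:R^-1 < ratr q < r 0 i + k.+1%:R^-1.
  have [|q] := @rat_in_itvoo R (r 0 i - k.+1%:R^-1) (r 0 i + k.+1%:R^-1).
    by rewrite ltrD2l gtrN.
  by rewrite in_itv/= => ?; exists q.
pose q := [ffun i => xchoose (H i)].
have qP i : r 0 i - k.+1%:R^-1 < ratr (q i) < r 0 i + k.+1%:R^-1.
  by rewrite ffunE; exact: (xchooseP (H i)).
exists (q, k).
  move=> s sq; apply: eA; split => // i j; rewrite ord1 -ball_normE/=.
  have /= := sq j; have := qP j; move: ke.
  set x := ratr (q j); set c := k.+1%:R^-1 => ke /andP[h1 h2] /andP[h3 h4].
  by rewrite ltr_norml; apply/andP; split; lra.
move=> i /=; have := qP i.
set x := ratr (q i); set c := k.+1%:R^-1 => /andP[h1 h2].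
by apply/andP; split; lra.
Qed.

Lemma open_bigcup_rat_box A : open A ->
  A = \bigcup_(q in [set q | cbox (rat_box q).1 (rat_box q).2 `<=` A])
        obox (rat_box q).1 (rat_box q).2.
Proof.
move=> oA; apply/seteqP; split => [r Ar|r [q /= qA qr]].
  by have [q qA qr] := open_rat_box oA Ar; exists q.
exact/qA/obox_sub_cbox.
Qed.

(** An open set is a countable union of rational cubes, each of them a finite intersection of
    preimages of intervals by coordinates. *)
Lemma measurable_open_rV A : open A -> measurable A.
Proof.
move=> /open_bigcup_rat_box ->; rewrite bigcup_mkcond.
apply: countable_bigcupT_measurable; first exact: countableP.
by move=> q; case: ifP => _ //; exact: measurable_obox.
Qed.

Lemma measurable_continuous_rV (f : 'rV[R]_n -> R) : continuous f ->
  measurable_fun setT f.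
Proof.
move=> cf; apply: (measurability _ (RGenOpens.measurableE R)).
move=> _ [_ [a [b ->] <-]]; rewrite setTI; apply: measurable_open_rV.
by apply: open_comp => // x _; exact: cf.
Qed.

Lemma bounded_set_rVP A : bounded_set A ->
  exists2 M : R, 0 < M & A `<=` cbox (fun=> - M) (fun=> M).
Proof.
move=> [M [Mr MA]]; exists (`|M| + 1); first by rewrite ltr_wpDl.
move=> r Ar i; rewrite -ler_norml.
have /MA/(_ r Ar)/= : M < `|M| + 1 by rewrite (le_lt_trans (ler_norm M))// ltrDl.
apply: le_trans; rewrite [leRHS]/Num.norm/= mx_normrE.
by apply: (@le_bigmax _ _ _ 0 (fun i => `|r i.1 i.2|) (0, i)).
Qed.

End rV_topology.

Section rV_cons_topology.
Context {R : realType} {n : nat}.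

Lemma rV_cons_lift (p : R * 'rV[R]_n) i : rV_cons p 0 (lift 0 i) = p.2 0 i.
Proof.
by rewrite -[in RHS](rV_consK p) /rV_uncons /= mxE.
Qed.

Lemma rV_cons_0 (p : R * 'rV[R]_n) : rV_cons p 0 0 = p.1.
Proof. by rewrite -[in RHS](rV_consK p). Qed.

Lemma continuous_rV_consr (t : R) : continuous (fun r : 'rV[R]_n => rV_cons (t, r)).
Proof.
move=> r; apply: (@cvg_rV _ _ _ (nbhs r)) => i; case: (unliftP 0 i) => [j ->|->].
  by rewrite rV_cons_lift; under eq_fun do rewrite rV_cons_lift; exact: coord_continuous.
by rewrite rV_cons_0; under eq_fun do rewrite rV_cons_0; exact: cvg_cst.
Qed.

Lemma continuous_rV_consl (r : 'rV[R]_n) : continuous (fun t : R => rV_cons (t, r)).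
Proof.
move=> t; apply: (@cvg_rV _ _ _ (nbhs t)) => i; case: (unliftP 0 i) => [j ->|->].
  by rewrite rV_cons_lift; under eq_fun do rewrite rV_cons_lift; exact: cvg_cst.
by rewrite rV_cons_0; under eq_fun do rewrite rV_cons_0; exact: cvg_id.
Qed.

Lemma rV_consD_lift (t h : R) (r : 'rV[R]_n) i :
  rV_cons (t, h *: delta_mx 0 i + r) = h *: delta_mx 0 (lift 0 i) + rV_cons (t, r).
Proof.
apply/rowP => k; rewrite [RHS]mxE; case: (unliftP 0 k) => [j ->|->].
  by rewrite !rV_cons_lift/= !mxE (inj_eq lift_inj).
by rewrite !rV_cons_0/= !mxE (negbTE (neq_lift _ _)) andbF mulr0 add0r.
Qed.

Lemma rV_consD_0 (t h : R) (r : 'rV[R]_n) :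
  rV_cons (h + t, r) = h *: delta_mx 0 0 + rV_cons (t, r).
Proof.
apply/rowP => k; rewrite [RHS]mxE; case: (unliftP 0 k) => [j ->|->].
  by rewrite !rV_cons_lift/= !mxE eq_sym (negbTE (neq_lift _ _)) andbF mulr0 add0r.
by rewrite !rV_cons_0/= !mxE mulr1.
Qed.

End rV_cons_topology.

(** * Tonelli and Fubini along the first coordinate *)

Section lebesgue_rV_fubini.
Context {R : realType} {n : nat}.
Local Notation mu := (@lebesgue_rV R).
Local Open Scope ereal_scope.

(** A definitional unfolding, which exposes the pushforward to the change of variables;
    [lebesgue_rV] is made opaque further on. *)
Lemma integral_rV_pushforward D (f : 'rV[R]_n.+1 -> \bar R) :
  \int[mu n.+1]_(r in D) f r =
  \int[pushforward (lebesgue_measure \x mu n) rV_cons]_(r in D) f r.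
Proof. exact: erefl. Qed.

Lemma ge0_integral_rV_cons (f : 'rV[R]_n.+1 -> \bar R) :
  measurable_fun setT f -> (forall r, 0 <= f r) ->
  \int[mu n.+1]_r f r = \int[lebesgue_measure]_t \int[mu n]_r f (rV_cons (t, r)).
Proof.
move=> mf f0; rewrite integral_rV_pushforward ge0_integral_pushforward//.
  rewrite preimage_setT fubini_tonelli1//; last by move=> x; exact: f0.
  by apply: measurableT_comp => //; exact: measurable_rV_cons.
exact: measurable_rV_cons.
Qed.

Lemma ge0_integral_rV_cons_swap (f : 'rV[R]_n.+1 -> \bar R) :
  measurable_fun setT f -> (forall r, 0 <= f r) ->
  \int[mu n.+1]_r f r = \int[mu n]_r \int[lebesgue_measure]_t f (rV_cons (t, r)).
Proof.
move=> mf f0; rewrite integral_rV_pushforward ge0_integral_pushforward//.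
  rewrite preimage_setT fubini_tonelli2//; last by move=> x; exact: f0.
  by apply: measurableT_comp => //; exact: measurable_rV_cons.
exact: measurable_rV_cons.
Qed.

Lemma integrable_rV_cons (f : 'rV[R]_n.+1 -> \bar R) :
  (mu n.+1).-integrable setT f ->
  (lebesgue_measure \x mu n).-integrable setT (f \o rV_cons).
Proof.
move=> /integrableP[mf foo]; apply/integrableP; split.
  by apply: measurableT_comp mf _; exact: measurable_rV_cons.
move: foo; rewrite integral_rV_pushforward ge0_integral_pushforward//.
  exact: measurable_rV_cons.
exact: measurableT_comp.
Qed.

Lemma integral_rV_cons (f : 'rV[R]_n.+1 -> \bar R) : (mu n.+1).-integrable setT f ->
  \int[mu n.+1]_r f r = \int[lebesgue_measure]_t \int[mu n]_r f (rV_cons (t, r)).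
Proof.
move=> intf; have /integrableP[mf _] := intf.
have intfc := integrable_rV_cons intf.
rewrite integral_rV_pushforward integral_pushforward//.
  by rewrite preimage_setT -integral12_prod_meas1.
exact: measurable_rV_cons.
Qed.

Lemma integral_rV_cons_swap (f : 'rV[R]_n.+1 -> \bar R) : (mu n.+1).-integrable setT f ->
  \int[mu n.+1]_r f r = \int[mu n]_r \int[lebesgue_measure]_t f (rV_cons (t, r)).
Proof.
move=> intf; have /integrableP[mf _] := intf.
have intfc := integrable_rV_cons intf.
rewrite integral_rV_pushforward integral_pushforward//.
  by rewrite preimage_setT -integral21_prod_meas1.
exact: measurable_rV_cons.
Qed.

End lebesgue_rV_fubini.

Lemma measurable_cbox {R : realType} {n} (a b : 'I_n -> R) : measurable (cbox a b).
Proof.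
rewrite (_ : cbox a b =
    \bigcap_(i in [set` finset.setT]) (rV_coord i @^-1` `[a i, b i]%classic)).
  apply: fin_bigcap_measurable => // i _; rewrite -[X in measurable X]setTI.
  exact: measurable_rV_coord.
apply/seteqP; split => r rab i.
  by move=> _ /=; rewrite in_itv/=; exact: rab.
have : [set` finset.setT] i by rewrite /= inE.
by move=> /rab /=; rewrite in_itv.
Qed.

Lemma lebesgue_rV_cbox {R : realType} n (a b : R) :
  (lebesgue_rV R n (cbox (fun=> a) (fun=> b)) < +oo)%E.
Proof.
elim: n => [|n IH] /=; first by rewrite /dirac/= indicE ltry.
rewrite /rV_prod /pushforward.
rewrite (_ : _ @^-1` _ = `[a, b]%classic `*` cbox (fun=> a) (fun=> b)).
  rewrite product_measure1E//=; last exact: measurable_cbox.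
  rewrite lte_mul_pinfty//; first by rewrite ge0_fin_numE// lebesgue_measure_itv; case: ifP => _; rewrite -?EFinB ltry.
apply/seteqP; split => [[t r] /= H|[t r] /= [tab rab] i].
  split; first by have := H 0; rewrite rV_cons_0 in_itv.
  by move=> i; have := H (lift 0 i); rewrite rV_cons_lift.
case: (unliftP 0 i) => [j ->|->]; first by rewrite rV_cons_lift; exact: rab.
by rewrite rV_cons_0; move: tab; rewrite in_itv.
Qed.

(** The measure is the Dirac mass at the only point, and every function on a one-point space is
    measurable. *)
Lemma integral_rV0 {R : realType} (f : 'rV[R]_0 -> \bar R) :
  (\int[lebesgue_rV R 0]_r f r)%E = f 0.
Proof.
rewrite [LHS](@integral_dirac _ _ _ _ _ measurableT) ?diracT ?mul1e//.
move=> _ Y _; rewrite setTI.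
have [f0|f0] := pselect (Y (f 0)).
  rewrite (_ : _ @^-1` _ = setT)//; apply/seteqP; split => // r _ /=.
  by rewrite (_ : r = 0)//; apply/rowP => -[].
rewrite (_ : _ @^-1` _ = set0)//; apply/seteqP; split => // r /=.
by rewrite (_ : r = 0)//; apply/rowP => -[].
Qed.

(* Unification would otherwise unfold the integrals. *)
Opaque lebesgue_rV ip nm.

(** * Poincare and Ladyzhenskaya inequalities *)

Section compact_support_dim1.
Context {R : realType}.
Local Notation mu := (@lebesgue_measure R).
Variables (g : R -> R) (M : R).
Hypothesis dg : forall t, derivable g t 1.
Hypothesis cg' : continuous g^`()%classic.
Hypothesis g0 : forall t, M < `|t| -> g t = 0.

Let FTC a b : a < b ->
  (\int[mu]_(x in `[a, b]) (g^`()%classic x)%:E = (g b)%:E - (g a)%:E)%E.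
Proof.
move=> ab; apply: (@continuous_FTC2 _ g^`()%classic g a b ab); last by move=> ?.
  exact: continuous_subspaceT.
have cg t : {for t, continuous g} by exact/differentiable_continuous/derivable1_diffP.
split; first by move=> x _; exact: dg.
- exact: (cvg_at_right_filter (cg a)).
- exact: (cvg_at_left_filter (cg b)).
Qed.

Let mg' : measurable_fun setT g^`()%classic.
Proof. exact: continuous_measurable_fun. Qed.

Lemma deriv1_eq0_out t : M < `|t| -> g^`()%classic t = 0.
Proof.
move=> Mt; rewrite derive1E (@near_eq_derive _ _ _ _ (cst 0)) ?derive_cst//.
have : \forall x \near t, M < `|x|.
  exact: (cvgr_gt (`|t|) (@norm_continuous _ R^o t)).
by apply: filterS => x /g0.
Qed.

Lemma integral_deriv1_eq0 : (\int[mu]_x (g^`()%classic x)%:E = 0)%E.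
Proof.
(* [M] may be negative; [N] is positive and above [M], so [g] vanishes at both ends of the
   interval. *)
pose N := `|M| + 1.
have MN : M < N by rewrite (le_lt_trans (ler_norm M))// ltrDl.
have N0 : 0 < N by rewrite ltr_wpDl.
have := @FTC (- N) N; rewrite !g0 ?normrN ?gtr0_norm// subee// => <-; last by rewrite gt0_cp.
rewrite [RHS]integral_mkcond; apply: eq_integral => x _.
rewrite patchE; case: ifPn => //; rewrite notin_setE/= in_itv/= => /negP.
rewrite -ler_norml -ltNge => Nx; rewrite deriv1_eq0_out//.
exact: lt_trans Nx.
Qed.

Lemma le_integral_deriv1 t : (`|g t|%:E <= \int[mu]_x `|g^`()%classic x|%:E)%E.
Proof.
(* A point to the left of [t] where [g] vanishes. *)
pose a := - (`|M| + 1 + `|t|).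
have Ma : M < `|a|.
  rewrite normrN ger0_norm ?addr_ge0//.
  by have := ler_norm M; have := normr_ge0 t; lra.
have at_ : a < t by have := ler_norm (- t); rewrite normrN /a; have := normr_ge0 M; lra.
have := FTC at_; rewrite (g0 Ma) sube0 => gt.
have mg'D (A : set R) : measurable_fun A g^`()%classic by exact: measurable_funTS.
apply: (@le_trans _ _ (\int[mu]_(x in `[a, t]) `|g^`()%classic x|%:E)%E).
  rewrite -abse_EFin -gt; apply: le_abse_integral => //.
  by apply/measurable_EFinP; exact: mg'D.
apply: ge0_subset_integral => //.
by apply/measurable_EFinP; exact: measurableT_comp.
Qed.

End compact_support_dim1.

(** * Functions of class C^1 with bounded support *)

Section C1c.
Context {R : realType}.

Lemma continuous_mulr (T : topologicalType) (f g : T -> R) :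
  continuous f -> continuous g -> continuous (fun x => f x * g x).
Proof. by move=> cf cg x; exact: (cvgM (cf x) (cg x)). Qed.

(** The support lies in the cube of half-side [M]; the condition on a single coordinate is inherited
    by slices. *)
Definition supp_in n (M : R) (f : 'rV[R]_n -> R) :=
  forall r : 'rV[R]_n, (exists i, M < `|r 0 i|) -> f r = 0.

(** A class that contains the test functions and is stable under products and under freezing the
    first coordinate, as inductions on the dimension require. *)
Definition C1c n (f : 'rV[R]_n -> R) :=
  [/\ continuous f,
      forall i r, derivable f r (delta_mx 0 i),
      forall i, continuous (partial i f) &
      exists M, supp_in M f].

Lemma supp_in_partial n M (f : 'rV[R]_n -> R) i : supp_in M f -> supp_in M (partial i f).
Proof.
move=> fM r [j Mr]; rewrite /partial (@near_eq_derive _ _ _ _ (cst 0)) ?derive_cst//.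
have : \forall x \near r, M < `|(x : 'rV[R]_n) 0 j|.
  have c : `|(x : 'rV[R]_n) 0 j| @[x --> r] --> `|r 0 j|.
    exact: (cvg_norm (@coord_continuous R 1 n 0 j r)).
  by have := cvgr_gt _ c; apply.
by apply: filterS => x Mx; apply: fM; exists j.
Qed.

Lemma supp_inM n M (f g : 'rV[R]_n -> R) : supp_in M f -> supp_in M (fun r => f r * g r).
Proof. by move=> fM r /fM ->; rewrite mul0r. Qed.

Lemma partialM n (f g : 'rV[R]_n -> R) i r :
  derivable f r (delta_mx 0 i) -> derivable g r (delta_mx 0 i) ->
  partial i (fun r => f r * g r) r = f r * partial i g r + g r * partial i f r.
Proof. by move=> df dg; rewrite /partial (deriveM df dg). Qed.

Lemma C1cM n (f g : 'rV[R]_n -> R) :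
  C1c f -> continuous g -> (forall i r, derivable g r (delta_mx 0 i)) ->
  (forall i, continuous (partial i g)) -> C1c (fun r => f r * g r).
Proof.
move=> [cf df cf' [M fM]] cg dg cg'; split.
- exact: continuous_mulr.
- by move=> i r; apply: derivableM.
- move=> i; rewrite (_ : partial i _ = fun r => f r * partial i g r + g r * partial i f r).
    by move=> r; apply: (@continuousD _ _ _ (fun r => f r * partial i g r)
      (fun r => g r * partial i f r)); apply: continuous_mulr.
  by apply/funext => r; exact: partialM.
- by exists M; exact: supp_inM.
Qed.

Lemma supp_in_slice n M t (f : 'rV[R]_n.+1 -> R) : supp_in M f ->
  supp_in M (fun r => f (rV_cons (t, r))).
Proof. by move=> fM r [i Mr]; apply: fM; exists (lift 0 i); rewrite rV_cons_lift. Qed.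

Lemma partial_slice n t (f : 'rV[R]_n.+1 -> R) i r :
  partial i (fun r => f (rV_cons (t, r))) r = partial (lift 0 i) f (rV_cons (t, r)).
Proof.
have E : (fun h : R => h^-1 *: (((fun r => f (rV_cons (t, r))) \o shift r)
    (h *: delta_mx 0 i) - f (rV_cons (t, r)))) =
  (fun h => h^-1 *: ((f \o shift (rV_cons (t, r))) (h *: delta_mx 0 (lift 0 i))
    - f (rV_cons (t, r)))) by apply/funext => h /=; rewrite rV_consD_lift.
by rewrite /partial /derive E.
Qed.

Lemma derivable_slice n t (f : 'rV[R]_n.+1 -> R) i r :
  derivable f (rV_cons (t, r)) (delta_mx 0 (lift 0 i)) ->
  derivable (fun r => f (rV_cons (t, r))) r (delta_mx 0 i).
Proof.
rewrite /derivable; under [in X in _ -> X]eq_fun do rewrite /= rV_consD_lift.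
by [].
Qed.

Lemma deriv1_slice n (f : 'rV[R]_n.+1 -> R) t r :
  (fun t => f (rV_cons (t, r)))^`()%classic t = partial 0 f (rV_cons (t, r)).
Proof.
have E : (fun h : R => h^-1 *: (((fun t => f (rV_cons (t, r))) \o shift t)
    (h *: 1) - f (rV_cons (t, r)))) =
  (fun h => h^-1 *: ((f \o shift (rV_cons (t, r))) (h *: delta_mx 0 0)
    - f (rV_cons (t, r)))).
  by apply/funext => h /=; rewrite -rV_consD_0 /GRing.scale/= mulr1.
by rewrite derive1E /partial /derive E.
Qed.

Lemma derivable1_slice n (f : 'rV[R]_n.+1 -> R) t r :
  derivable f (rV_cons (t, r)) (delta_mx 0 0) ->
  derivable (fun t => f (rV_cons (t, r))) t 1.
Proof.
rewrite /derivable; under eq_fun do rewrite /= -rV_consD_0.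
by under [in X in _ -> X]eq_fun do rewrite /= scaler1.
Qed.

Lemma C1c_slice n t (f : 'rV[R]_n.+1 -> R) : C1c f -> C1c (fun r => f (rV_cons (t, r))).
Proof.
move=> [cf df cf' [M fM]]; split.
- by move=> r; apply: continuous_comp; [exact: continuous_rV_consr|exact: cf].
- by move=> i r; exact: derivable_slice.
- move=> i; rewrite (_ : partial i _ = fun r => partial (lift 0 i) f (rV_cons (t, r))).
    by move=> r; apply: continuous_comp; [exact: continuous_rV_consr|exact: cf'].
  by apply/funext => r; exact: partial_slice.
- by exists M; exact: supp_in_slice.
Qed.

Lemma compact_cbox n (a b : 'I_n -> R) : compact (cbox a b).
Proof.
have := @rV_compact R n (fun i => `[a i, b i]%classic).
rewrite (_ : [set v | _] = cbox a b); first by apply => i; exact: segment_compact.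
by apply/seteqP; split => r rab i; have := rab i; rewrite /= in_itv.
Qed.

Lemma supp_in_out n M (f : 'rV[R]_n -> R) r :
  supp_in M f -> ~ cbox (fun=> - M) (fun=> M) r -> f r = 0.
Proof.
move=> fM Hr; apply: fM; apply: contrapT => H; apply: Hr => i.
by rewrite -ler_norml leNgt; apply/negP => ?; apply: H; exists i.
Qed.

Lemma integrable_continuous_supp n M (f : 'rV[R]_n -> R) :
  continuous f -> supp_in M f -> (lebesgue_rV R n).-integrable setT (EFin \o f).
Proof.
move=> cf fM; pose K : set 'rV[R]_n := cbox (fun=> - M) (fun=> M).
have mK : measurable K by exact: measurable_cbox.
have : (lebesgue_rV R n).-integrable K (EFin \o f).
  apply: measurable_bounded_integrable => //.
  - exact: lebesgue_rV_cbox.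
  - by apply: measurable_funTS; exact: measurable_continuous_rV.
  - have : bounded_set (f @` K).
      apply: (@compact_bounded _ R^o); apply: continuous_compact.
        exact: continuous_subspaceT.
      exact: compact_cbox.
    move=> [B [Br HB]]; exists B; split=> // x /HB H r Kr.
    by apply: (H (f r)); exists r.
move=> /integrable_mkcond => /(_ mK); apply: eq_integrable => // r _.
rewrite patchE; case: ifPn => //; rewrite notin_setE => /(supp_in_out fM) /= ->//.
Qed.

Lemma C1c_partial_integrable n (f : 'rV[R]_n -> R) i :
  C1c f -> (lebesgue_rV R n).-integrable setT (EFin \o partial i f).
Proof.
move=> [_ _ cf' [M fM]]; apply: integrable_continuous_supp (cf' i) _.
exact: supp_in_partial fM.
Qed.

Lemma C1c_sq_int n (f : 'rV[R]_n -> R) : C1c f -> sq_int (lebesgue_rV R n) setT f.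
Proof.
move=> [cf _ _ [M fM]]; apply: integrable_sq_int => //.
  exact: measurable_continuous_rV.
apply: (@integrable_continuous_supp _ M); first exact: continuous_mulr.
exact: supp_inM.
Qed.

Lemma C1c_partial_sq_int n (f : 'rV[R]_n -> R) i :
  C1c f -> sq_int (lebesgue_rV R n) setT (partial i f).
Proof.
move=> [_ _ cf' [M fM]]; apply: integrable_sq_int => //.
  exact: measurable_continuous_rV.
apply: (@integrable_continuous_supp _ M); first exact: continuous_mulr.
exact/supp_inM/supp_in_partial.
Qed.

(** By Fubini: along the first coordinate the inner integral vanishes by the one-dimensional case,
    along another one by induction on the slices. *)
Lemma integral_partial_eq0 n (f : 'rV[R]_n -> R) i : C1c f ->
  (\int[lebesgue_rV R n]_r (partial i f r)%:E = 0)%E.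
Proof.
elim: n f i => [f []//|n IH f i C1f].
have intf := C1c_partial_integrable i C1f.
case: (unliftP 0 i) intf => [j ->|->] intf.
  rewrite integral_rV_cons// integral0_eq// => t _.
  under eq_integral do rewrite -partial_slice.
  by apply: IH; exact: C1c_slice.
rewrite integral_rV_cons_swap// integral0_eq// => r _.
under eq_integral do rewrite -deriv1_slice.
have [cf df cf' [M fM]] := C1f.
apply: (@integral_deriv1_eq0 _ _ M).
- by move=> t; exact: derivable1_slice.
- rewrite (_ : derive1 _ = fun t => partial 0 f (rV_cons (t, r))).
    by move=> t; apply: continuous_comp; [exact: continuous_rV_consl|exact: cf'].
  by apply/funext => t; exact: deriv1_slice.
- by move=> t Mt; apply: fM; exists 0; rewrite rV_cons_0.
Qed.

(** The fundamental theorem of calculus for [f ^+ 2] on the line through the point in the first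
    direction. Both the Poincare and the Ladyzhenskaya inequalities are integrated forms of this
    bound. *)
Lemma sqr_le_integral_partial n (f : 'rV[R]_n.+1 -> R) t r : C1c f ->
  ((f (rV_cons (t, r)) ^+ 2)%:E <=
   \int[lebesgue_measure]_s (2 * `|f (rV_cons (s, r)) * partial 0 f (rV_cons (s, r))|)%:E)%E.
Proof.
move=> C1f; have [cf df cf' [M fM]] := C1f.
have [cff dff cff' _] := C1cM C1f cf df cf'.
pose g t := f (rV_cons (t, r)) * f (rV_cons (t, r)).
have g'E s : g^`()%classic s = 2 * (f (rV_cons (s, r)) * partial 0 f (rV_cons (s, r))).
  rewrite (@deriv1_slice _ (fun r => f r * f r)) partialM//; ring.
have g2 : g t = f (rV_cons (t, r)) ^+ 2 by rewrite expr2.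
have := @le_integral_deriv1 _ g M _ _ _ t.
rewrite g2 ger0_norm ?sqr_ge0// => /(_ _ _ _)/le_trans; apply.
- by move=> s; apply: (@derivable1_slice _ (fun r => f r * f r)).
- rewrite (_ : derive1 _ = fun t => partial 0 (fun r => f r * f r) (rV_cons (t, r))).
    by move=> s; apply: continuous_comp; [exact: continuous_rV_consl|exact: cff'].
  by apply/funext => s; exact: (@deriv1_slice _ (fun r => f r * f r)).
- by move=> s Ms; rewrite /g fM ?mul0r//; exists 0; rewrite rV_cons_0.
by under eq_integral do rewrite g'E normrM ger0_norm//.
Qed.


Lemma mul4E (a b c : R) : ((2 * a * b)%:E * (2 * a * c)%:E <= (4 * a ^+ 2 * c * b)%:E)%E.
Proof. by rewrite -EFinM lee_fin le_eqVlt; apply/orP/or_introl/eqP; ring. Qed.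

Lemma mul4_addE (a b c d : R) :
  ((2 * (2 * a * b))%:E * (c%:E + d%:E) <= (4 * a * b * (c + d))%:E)%E.
Proof. by rewrite -EFinD -EFinM lee_fin le_eqVlt; apply/orP/or_introl/eqP; ring. Qed.

Lemma integral_scale_add (c : R) (p q : R -> \bar R) : 0 <= c ->
  measurable_fun setT p -> measurable_fun setT q ->
  (forall t, 0 <= p t)%E -> (forall t, 0 <= q t)%E ->
  (\int[lebesgue_measure]_t (c%:E * (p t + q t)) =
   c%:E * (\int[lebesgue_measure]_t p t + \int[lebesgue_measure]_t q t))%E.
Proof.
move=> c0 mp mq p0 q0; rewrite ge0_integralZl//.
- by rewrite ge0_integralD.
- exact: emeasurable_funD.
- by move=> t _; rewrite adde_ge0.
Qed.

Opaque partial.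

Lemma C1c_sqr_partial_measurable n (f : 'rV[R]_n -> R) i : C1c f ->
  measurable_fun setT (fun r => (2 * `|f r * partial i f r|)%:E).
Proof.
move=> [cf _ cf' _]; apply/measurable_EFinP/measurable_funM => //.
apply: measurableT_comp => //.
by apply: measurable_continuous_rV; exact: continuous_mulr.
Qed.

(* Bounds the L^1 norm of [2 f (partial i f)], to which all the inequalities
   below reduce. *)
Lemma integral_sqr_partial_le n (f : 'rV[R]_n -> R) i : C1c f ->
  (\int[lebesgue_rV R n]_r (2 * `|f r * partial i f r|)%:E <=
   (2 * nm (lebesgue_rV R n) setT f * nm (lebesgue_rV R n) setT (partial i f))%:E)%E.
Proof.
move=> C1f; have sf := C1c_sq_int C1f; have sf' := C1c_partial_sq_int i C1f.
have saf := sq_int_normr measurableT sf; have saf' := sq_int_normr measurableT sf'.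
have int := sq_int_integrable_mul measurableT saf saf'.
under eq_integral do rewrite EFinM normrM.
rewrite integralZl// (integral_mul_ip measurableT saf saf').
have := ip_CS measurableT saf saf'; rewrite !nm_normr => /(le_trans (ler_norm _)).
by rewrite -EFinM lee_fin -mulrA ler_pM2l.
Qed.

(** The bound of [f ^+ 2] on each line is constant along the line, and only the segment of length
    [2 * M] matters. Integrating, [||f||^2 <= 2 M * 2 ||f|| ||partial 0 f||]. *)
Lemma C1c_poincare n (f : 'rV[R]_n.+1 -> R) M : 0 < M -> C1c f -> supp_in M f ->
  nm (lebesgue_rV R n.+1) setT f <=
  4 * M * nm (lebesgue_rV R n.+1) setT (partial 0 f).
Proof.
move=> M0 C1f fM; set mu := lebesgue_rV R n.+1.
have sf := C1c_sq_int C1f.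
have mf2 : measurable_fun setT (fun r => (f r ^+ 2)%:E).
  by apply/measurable_EFinP/measurable_funX; case: sf.
have mff := C1c_sqr_partial_measurable 0 C1f.
pose F (r : 'rV[R]_n) := (\int[lebesgue_measure]_s
  (2 * `|f (rV_cons (s, r)) * partial 0 f (rV_cons (s, r))|)%:E)%E.
have mF : measurable_fun setT F.
  apply: (measurable_fun_fubini_tonelli_G (m1 := lebesgue_measure)
    (fun p => (2 * `|f (rV_cons p) * partial 0 f (rV_cons p)|)%:E)%E) => //.
  exact: (measurableT_comp mff measurable_rV_cons).
have F0 r : (0 <= F r)%E by apply: integral_ge0 => s _; rewrite lee_fin mulr_ge0.
have H : (\int[mu]_r (f r ^+ 2)%:E <=
    (2 * M)%:E * \int[mu]_r (2 * `|f r * partial 0 f r|)%:E)%E.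
  rewrite ge0_integral_rV_cons_swap//; last by move=> r; rewrite lee_fin sqr_ge0.
  rewrite [X in (_ * X)%E]ge0_integral_rV_cons_swap//.
  rewrite [X in (_ * X)%E](_ : _ = \int[lebesgue_rV R n]_r F r)%E//.
  rewrite -ge0_integralZl//; last by rewrite lee_fin mulr_ge0 ?ltW.
  apply: ge0_le_integral => //.
  - by move=> r _; apply: integral_ge0 => s _; rewrite lee_fin sqr_ge0.
  - apply: (measurable_fun_fubini_tonelli_G (m1 := lebesgue_measure)
      (fun p => (f (rV_cons p) ^+ 2)%:E)%E).
      exact: (measurableT_comp mf2 measurable_rV_cons).
    by move=> p; rewrite lee_fin sqr_ge0.
  - by apply: emeasurable_funM.
  move=> r _.
  have -> : (\int[lebesgue_measure]_s (f (rV_cons (s, r)) ^+ 2)%:E =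
     \int[lebesgue_measure]_(s in `[(- M)%R, M]) (f (rV_cons (s, r)) ^+ 2)%:E)%E.
    rewrite [RHS]integral_mkcond; apply: eq_integral => s _.
    rewrite patchE; case: ifPn => //; rewrite notin_setE/= in_itv/= => /negP.
    rewrite -ler_norml -ltNge => Ms; rewrite fM ?expr0n//.
    by exists 0; rewrite rV_cons_0.
  apply: (@le_trans _ _ (\int[lebesgue_measure]_(s in `[(- M)%R, M]) F r)%E).
    apply: ge0_le_integral.
    - exact: measurable_itv.
    - by move=> s _; rewrite lee_fin sqr_ge0.
    - apply: measurable_funTS; apply/measurable_EFinP/measurable_funX.
      apply: continuous_measurable_fun => s; apply: continuous_comp.
        exact: continuous_rV_consl.
      by case: C1f => cf _ _ _; exact: cf.
    - exact: measurable_cst.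
    - by move=> s _; exact: sqr_le_integral_partial.
  rewrite [leLHS](_ : _ = F r * lebesgue_measure `[(- M)%R, M])%E ?integral_cst//.
  rewrite lebesgue_measure_itv/= lte_fin gtrN//.
  by rewrite muleC -EFinB opprK -mulr2n mulr_natl.
have := le_trans H (lee_wpmul2l _ (integral_sqr_partial_le 0 C1f)).
rewrite integral_sqr_ip// -EFinM !lee_fin -sqr_nm => /(_ _)H'.
have {}H' := H' (mulr_ge0 (ler0n _ 2) (ltW M0)).
(* The inequality is to be divided by the norm of [f], hence the separate zero case. *)
have [->|nf0] := eqVneq (nm mu setT f) 0; first by rewrite !mulr_ge0 ?nm_ge0 ?ltW.
have nfp : 0 < nm mu setT f by rewrite lt_def nf0 nm_ge0.
rewrite -(ler_pM2l nfp) -expr2; apply: le_trans H' _.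
by rewrite le_eqVlt; apply/orP/or_introl/eqP; rewrite /mu; ring.
Qed.

Local Notation nrm f := (nm (lebesgue_rV R _) setT f).

Lemma measurable_integral_sqr_partial n (f : 'rV[R]_n.+1 -> R) : C1c f ->
  measurable_fun setT (fun r : 'rV[R]_n => (\int[lebesgue_measure]_s
    (2 * `|f (rV_cons (s, r)) * partial 0 f (rV_cons (s, r))|)%:E)%E).
Proof.
move=> C1f; apply: (measurable_fun_fubini_tonelli_G (m1 := lebesgue_measure)
    (fun p => (2 * `|f (rV_cons p) * partial 0 f (rV_cons p)|)%:E)%E) => //.
exact: (measurableT_comp (C1c_sqr_partial_measurable 0 C1f) measurable_rV_cons).
Qed.

(** In dimension 1 the only line is the whole space, the remaining factor being the one-point
    space. *)
Lemma C1c_rV1_sqr_le (f : 'rV[R]_1 -> R) r : C1c f ->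
  ((f r ^+ 2)%:E <= \int[lebesgue_rV R 1]_r (2 * `|f r * partial 0 f r|)%:E)%E.
Proof.
move=> C1f; rewrite -(rV_unconsK r) ge0_integral_rV_cons_swap//; last 1 first.
  exact: C1c_sqr_partial_measurable.
case: (rV_uncons r) => t {}r.
rewrite integral_rV0; have -> : (0 : 'rV[R]_0) = r by apply/rowP => -[].
exact: sqr_le_integral_partial.
Qed.


(** The bound separates the variables, so its double integral is a product of integrals. *)
Lemma integral_exp4_le_mul n (f : 'rV[R]_n.+1 -> R) (G : R -> \bar R) (F : 'rV[R]_n -> \bar R) :
  continuous f -> measurable_fun setT G -> measurable_fun setT F ->
  (forall t, 0 <= G t)%E -> (forall r, 0 <= F r)%E ->
  (forall t r, (f (rV_cons (t, r)) ^+ 4)%:E <= G t * F r)%E ->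
  (\int[lebesgue_rV R n.+1]_r (f r ^+ 4)%:E <=
   \int[lebesgue_measure]_t G t * \int[lebesgue_rV R n]_r F r)%E.
Proof.
move=> cf mG mF G0 F0 f4.
have mf4 : measurable_fun setT (fun r => (f r ^+ 4)%:E).
  by apply/measurable_EFinP/measurable_funX; exact: measurable_continuous_rV.
have f40 r : (0 <= (f r ^+ 4)%:E)%E by rewrite lee_fin (exprM _ 2 2) sqr_ge0.
have I0 : (0 <= \int[lebesgue_rV R n]_r F r)%E by exact: integral_ge0.
rewrite ge0_integral_rV_cons// -ge0_integralZr//.
apply: ge0_le_integral => //.
- by move=> t _; apply: integral_ge0.
- apply: (measurable_fun_fubini_tonelli_F (m2 := lebesgue_rV R n)
    (fun p => (f (rV_cons p) ^+ 4)%:E)%E) => //.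
  exact: (measurableT_comp mf4 measurable_rV_cons).
- by apply: emeasurable_funM.
move=> t _; rewrite -ge0_integralZl//; apply: ge0_le_integral => //.
- apply/measurable_EFinP/measurable_funX; apply: measurable_continuous_rV => r.
  by apply: continuous_comp; [exact: continuous_rV_consr|exact: cf].
- by apply: emeasurable_funM.
Qed.

(** [f ^+ 2] is at most [F], an integral along the first coordinate and thus a function of the
    second, and at most [G], obtained the other way round. So [f ^+ 4 <= G t * F r], and the two
    factors are integrated independently. *)
Lemma C1c_ladyzhenskaya2 (f : 'rV[R]_2 -> R) : C1c f ->
  (\int[lebesgue_rV R 2]_r (f r ^+ 4)%:E <=
   (4 * nrm f ^+ 2 * nrm (partial 0 f) * nrm (partial 1 f))%:E)%E.
Proof.
move=> C1f; have sf := C1c_sq_int C1f; have mf := sf.1.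
have mff0 := C1c_sqr_partial_measurable 0 C1f.
have mff1 := C1c_sqr_partial_measurable 1 C1f.
pose F (r : 'rV[R]_1) := (\int[lebesgue_measure]_s
  (2 * `|f (rV_cons (s, r)) * partial 0 f (rV_cons (s, r))|)%:E)%E.
pose G (t : R) := (\int[lebesgue_rV R 1]_r
  (2 * `|f (rV_cons (t, r)) * partial 1 f (rV_cons (t, r))|)%:E)%E.
have mF : measurable_fun setT F by exact: measurable_integral_sqr_partial.
have mG : measurable_fun setT G.
  apply: (measurable_fun_fubini_tonelli_F (m2 := lebesgue_rV R 1)
    (fun p => (2 * `|f (rV_cons p) * partial 1 f (rV_cons p)|)%:E)%E) => //.
  exact: (measurableT_comp mff1 measurable_rV_cons).
have F0 r : (0 <= F r)%E by apply: integral_ge0 => s _; rewrite lee_fin mulr_ge0.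
have G0 t : (0 <= G t)%E by apply: integral_ge0 => s _; rewrite lee_fin mulr_ge0.
have f4 t r : ((f (rV_cons (t, r)) ^+ 4)%:E <= G t * F r)%E.
  rewrite (exprM _ 2 2) expr2 EFinM; apply: lee_pmul; rewrite ?lee_fin ?sqr_ge0//.
    have := C1c_rV1_sqr_le r (C1c_slice t C1f).
    rewrite /G; under eq_integral do rewrite partial_slice.
    by rewrite (_ : lift 0 0 = 1 :> 'I_2)//; exact: val_inj.
  exact: sqr_le_integral_partial.
have [cf _ _ _] := C1f.
apply: le_trans (integral_exp4_le_mul cf mG mF G0 F0 f4) _.
have -> : (\int[lebesgue_measure]_t G t =
    \int[lebesgue_rV R 2]_r (2 * `|f r * partial 1 f r|)%:E)%E.
  by rewrite ge0_integral_rV_cons.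
have -> : (\int[lebesgue_rV R 1]_r F r =
    \int[lebesgue_rV R 2]_r (2 * `|f r * partial 0 f r|)%:E)%E.
  have nn (r : 'rV[R]_2) : (0 <= (2 * `|f r * partial 0 f r|)%:E)%E.
    by rewrite lee_fin mulr_ge0.
  exact: esym (ge0_integral_rV_cons_swap mff0 nn).
have i0 i : (0 <= \int[lebesgue_rV R 2]_r (2 * `|f r * partial i f r|)%:E)%E.
  by apply: integral_ge0 => r _; rewrite lee_fin mulr_ge0.
apply: le_trans (lee_pmul (i0 1) (i0 0) (integral_sqr_partial_le 1 C1f)
  (integral_sqr_partial_le 0 C1f)) _.
exact: mul4E.
Qed.

(** The inequality of means on [y * x], so that the product of two slice norms becomes a sum of
    squares, which can be integrated over the slices. *)
Lemma mul4_le (x y z A : R) : 0 <= x -> 0 <= y -> z ^+ 2 <= A ->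
  4 * z ^+ 2 * y * x <= 2 * A * (y ^+ 2 + x ^+ 2).
Proof.
move=> x0 y0 zA; have A0 : 0 <= A by apply: le_trans zA; rewrite sqr_ge0.
have yx : 2 * (y * x) <= y ^+ 2 + x ^+ 2 by have := sqr_ge0 (y - x); lra.
rewrite -mulrA; apply: (@le_trans _ _ (4 * A * (y * x))).
  by rewrite ler_wpM2r ?mulr_ge0// ler_wpM2l.
by rewrite (_ : 4 * A * (y * x) = 2 * A * (2 * (y * x))) ?ler_wpM2l ?mulr_ge0//; ring.
Qed.

(** Lifts the planar inequality by one dimension. The squared norm of each slice is at most
    [A = 2 ||f|| ||partial 0 f||], uniformly in [t], by [sqr_le_integral_partial]; what depends on
    [t] is then, after [mul4_le], a sum of squared norms of slices of the partial derivatives, which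
    integrates to their full squared norms. *)
Lemma C1c_slice_ladyzhenskaya n (f : 'rV[R]_n.+2 -> R) (i j : 'I_n.+1) : C1c f ->
  (forall t, let g r := f (rV_cons (t, r)) in
    (\int[lebesgue_rV R n.+1]_r (g r ^+ 4)%:E <=
    (4 * nrm g ^+ 2 * nrm (partial i g) * nrm (partial j g))%:E)%E) ->
  (\int[lebesgue_rV R n.+2]_r (f r ^+ 4)%:E <=
   (4 * nrm f * nrm (partial 0 f) *
     (nrm (partial (lift 0 i) f) ^+ 2 + nrm (partial (lift 0 j) f) ^+ 2))%:E)%E.
Proof.
move=> C1f; set i' := lift 0 i; set j' := lift 0 j => slice4.
have sf := C1c_sq_int C1f; have mf := sf.1.
have mf4 : measurable_fun setT (fun r => (f r ^+ 4)%:E).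
  by apply/measurable_EFinP/measurable_funX.
set A : R := 2 * nrm f * nrm (partial 0 f).
have A0 : 0 <= A by rewrite !mulr_ge0 ?nm_ge0.
have C1t t := C1c_slice t C1f.
have slice_le t : nrm (fun r => f (rV_cons (t, r))) ^+ 2 <= A.
  rewrite -lee_fin sqr_nm -integral_sqr_ip//; last exact: C1c_sq_int.
  apply: le_trans (integral_sqr_partial_le 0 C1f).
  rewrite ge0_integral_rV_cons_swap//; last exact: C1c_sqr_partial_measurable.
  apply: ge0_le_integral => //.
  - by move=> r _; rewrite lee_fin sqr_ge0.
  - apply/measurable_EFinP/measurable_funX.
    by have [c _ _ _] := C1t t; exact: measurable_continuous_rV.
  - exact: measurable_integral_sqr_partial.
  - by move=> r _; exact: sqr_le_integral_partial.
pose P k t := (\int[lebesgue_rV R n.+1]_r (partial k f (rV_cons (t, r)) ^+ 2)%:E)%E.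
have mp k : measurable_fun setT (fun r => (partial k f r ^+ 2)%:E).
  by apply/measurable_EFinP/measurable_funX; case: (C1c_partial_sq_int k C1f).
have mP k : measurable_fun setT (P k).
  apply: (measurable_fun_fubini_tonelli_F (m2 := lebesgue_rV R n.+1)
      (fun p => (partial k f (rV_cons p) ^+ 2)%:E)%E).
    exact: (measurableT_comp (mp k) measurable_rV_cons).
  by move=> p; rewrite lee_fin sqr_ge0.
have P0 k t : (0 <= P k t)%E.
  by apply: integral_ge0 => r _; rewrite lee_fin sqr_ge0.
have mPP : measurable_fun setT (fun t => P i' t + P j' t)%E.
  by apply: emeasurable_funD.
have PE (k : 'I_n.+1) t : P (lift 0 k) t = (nrm (partial k (fun r => f (rV_cons (t, r)))) ^+ 2)%:E.
  rewrite sqr_nm -(integral_sqr_ip measurableT (C1c_partial_sq_int k (C1t t))).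
  by apply: eq_integral => r _; rewrite partial_slice.
have f4 t : (\int[lebesgue_rV R n.+1]_r (f (rV_cons (t, r)) ^+ 4)%:E <=
    (2 * A)%:E * (P i' t + P j' t))%E.
  apply: le_trans (slice4 t) _.
  rewrite !PE -EFinD -EFinM lee_fin; move: (slice_le t).
  by move=> zA; apply: mul4_le zA; exact: nm_ge0.
rewrite ge0_integral_rV_cons//; last by move=> r; rewrite lee_fin (exprM _ 2 2) sqr_ge0.
apply: (@le_trans _ _ (\int[lebesgue_measure]_t ((2 * A)%:E * (P i' t + P j' t)))%E).
  apply: ge0_le_integral => //.
  - by move=> t _; apply: integral_ge0 => r _; rewrite lee_fin (exprM _ 2 2) sqr_ge0.
  - apply: (measurable_fun_fubini_tonelli_F (m2 := lebesgue_rV R n.+1)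
      (fun p => (f (rV_cons p) ^+ 4)%:E)%E).
      exact: (measurableT_comp mf4 measurable_rV_cons).
    by move=> p; rewrite lee_fin (exprM _ 2 2) sqr_ge0.
  - by apply: emeasurable_funM.
have IP k : (\int[lebesgue_measure]_t P k t = (nrm (partial k f) ^+ 2)%:E)%E.
  rewrite sqr_nm -(integral_sqr_ip measurableT (C1c_partial_sq_int k C1f)).
  by rewrite ge0_integral_rV_cons// => r; rewrite lee_fin sqr_ge0.
clear slice4 slice_le PE f4 mPP; clearbody P i' j'.
rewrite (integral_scale_add _ (mP i') (mP j') (P0 i') (P0 j')); last exact: mulr_ge0.
rewrite (IP i') (IP j'); exact: mul4_addE.
Qed.

Lemma C1c_ladyzhenskaya3 (f : 'rV[R]_3 -> R) : C1c f ->
  (\int[lebesgue_rV R 3]_r (f r ^+ 4)%:E <=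
   (4 * nrm f * nrm (partial 0 f) *
     (nrm (partial (lift 0 0) f) ^+ 2 + nrm (partial (lift 0 1) f) ^+ 2))%:E)%E.
Proof.
move=> C1f; apply: C1c_slice_ladyzhenskaya => // t.
exact: C1c_ladyzhenskaya2 (C1c_slice t C1f).
Qed.

End C1c.

Transparent partial.

(** * Bump functions and uniqueness against test functions *)

Section smooth_dim1.
Context {R : realType}.
Implicit Types f g : R -> R.

(** Differentiability counted up to a finite order, so that stability under sums, products and
    affine substitutions goes by induction; smoothness is [Sm m] for every [m]. *)
Fixpoint Sm (m : nat) f : Prop :=
  if m is m'.+1 then (forall x, derivable f x 1) /\ Sm m' f^`()%classic else True.

Lemma SmW m f : Sm m.+1 f -> Sm m f.
Proof. by elim: m f => // m IH f [df sf]; split => //; apply: IH. Qed.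

Lemma Sm_cst m (c : R) : Sm m (fun=> c).
Proof.
elim: m c => // m IH c; split; first by move=> x; exact: derivable_cst.
rewrite (_ : _^`()%classic = fun=> 0); first exact: IH.
by apply/funext => x; rewrite derive1_cst.
Qed.

Lemma SmD m f g : Sm m f -> Sm m g -> Sm m (fun x => f x + g x).
Proof.
elim: m f g => // m IH f g [df sf] [dg sg]; split; first by move=> x; exact: derivableD.
rewrite (_ : _^`()%classic = fun x => f^`()%classic x + g^`()%classic x); first exact: IH.
by apply/funext => x; rewrite !derive1E (deriveD (df x) (dg x)).
Qed.

Lemma SmM m f g : Sm m f -> Sm m g -> Sm m (fun x => f x * g x).
Proof.
elim: m f g => // m IH f g [df sf] [dg sg]; split; first by move=> x; exact: derivableM.
rewrite (_ : _^`()%classic = fun x => f x * g^`()%classic x + g x * f^`()%classic x).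
  by apply: SmD; apply: IH => //; apply: SmW.
by apply/funext => x; rewrite !derive1E (deriveM (df x) (dg x)).
Qed.

Lemma is_derive_affine f a c x : derivable f (a * x + c) 1 ->
  is_derive x 1 (fun x => f (a * x + c)) (a * f^`()%classic (a * x + c)).
Proof.
move=> df; have H : is_derive (a * x + c) 1 f (f^`()%classic (a * x + c)).
  by rewrite derive1E; exact: derivableP.
have := @is_derive1_comp _ f (fun x => a * x + c) x _ a H; rewrite mulrC; apply.
have D1 : is_derive x (1 : R) (fun x : R => a * x) (a *: 1) := is_deriveZ a (is_derive_id x 1).
have D2 := is_deriveD D1 (is_derive_cst c x 1).
by apply: is_derive_eq D2 _; rewrite addr0 /GRing.scale/= mulr1.
Qed.

Lemma Sm_affine m f a c : Sm m f -> Sm m (fun x => f (a * x + c)).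
Proof.
elim: m f => // m IH f [df sf]; split.
  by move=> x; have [] := is_derive_affine (df (a * x + c)).
rewrite (_ : _^`()%classic = fun x => a * f^`()%classic (a * x + c)).
  by apply: SmM; [exact: Sm_cst|exact: IH].
apply/funext => x; rewrite derive1E.
by have [_] := is_derive_affine (df (a * x + c)).
Qed.

(** The classical [exp (- 1 / x)] extended by 0, with powers of [1 / x]: the linear span of this
    family is stable under derivation ([is_derive_flat]). *)
Definition flat (k : nat) (x : R) : R := if 0 < x then x^-1 ^+ k * expR (- x^-1) else 0.

Lemma flat_ge0 k x : 0 <= flat k x.
Proof. by rewrite /flat; case: ifP => // x0; rewrite mulr_ge0 ?expR_ge0// exprn_ge0// invr_ge0 ltW. Qed.

Lemma flat_le k x : flat k x <= k.+1`!%:R * `|x|.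
Proof.
rewrite /flat; case: ifPn => [x0|_]; last by rewrite mulr_ge0.
rewrite gtr0_norm//; set t := x^-1.
have t0 : 0 < t by rewrite invr_gt0.
have xt : x = t^-1 by rewrite invrK.
have := @expR_ge1Dxn R t k (ltW t0) => H.
rewrite expRN ler_pdivrMr ?expR_gt0// xt.
have {}H : t ^+ k.+1 / k.+1`!%:R <= expR t by apply: le_trans H; rewrite lerDr.
have f0 : 0 < k.+1`!%:R :> R by rewrite ltr0n fact_gt0.
rewrite ler_pdivrMr// in H.
rewrite -mulrA mulrCA -ler_pdivrMl ?invr_gt0// invrK -exprS mulrC //.
Qed.

Lemma flat_cvg0 k : flat k x @[x --> (0 : R)] --> 0.
Proof.
apply: (@squeeze_cvgr _ _ _ _ (fun=> 0) (fun x => k.+1`!%:R * `|x|)).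
- by apply: nearW => x; rewrite flat_ge0 flat_le.
- exact: cvg_cst.
- have := @norm_continuous _ R^o (0 : R); rewrite /continuous_at normr0 => n0.
  by rewrite -[X in _ --> X](mulr0 k.+1`!%:R); apply: cvgM n0; exact: cvg_cst.
Qed.

Lemma is_derive_flat k (x : R) :
  is_derive x (1 : R) (flat k) (flat k.+2 x - k%:R * flat k.+1 x).
Proof.
have [x0|x0|x0] := ltgtP 0 x.
- have H : \forall y \near x, y^-1 ^+ k * expR (- y^-1) = flat k y.
    have : \forall y \near x, 0 < y by exact: lt_nbhsr.
    by apply: filterS => y y0; rewrite /flat y0.
  apply: (near_eq_is_derive H).
  have xn0 : x != 0 by rewrite gt_eqF.
  have dV : is_derive x (1 : R) (fun y : R => y^-1) (- x ^- 2 *: 1) by exact: is_deriveV.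
  have dN : is_derive x (1 : R) (fun y : R => - y^-1) (- (- x ^- 2 *: 1)) by exact: is_deriveN.
  have dE : is_derive x (1 : R) (fun y : R => expR (- y^-1))
      (expR (- x^-1) * (- (- x ^- 2 *: 1))).
    exact: (@is_derive1_comp _ expR (fun y => - y^-1)).
  have dX : is_derive x (1 : R) (fun y : R => y^-1 ^+ k)
      (k%:R * x^-1 ^+ k.-1 *: (- x ^- 2 *: 1)).
    rewrite (_ : (fun y => _) = (fun y => y^-1) ^+ k); first exact: is_deriveX.
    by apply/funext => y; rewrite exprfctE.
  apply: is_derive_eq (is_deriveM dX dE) _.
  rewrite /flat x0 -exprVn /GRing.scale/=; case: k {H dX} => [|k] /=; rewrite !exprS; ring.
- have H : \forall y \near x, cst 0 y = flat k y.
    have : \forall y \near x, y < 0 by exact: lt_nbhsl.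
    by apply: filterS => y y0; rewrite /flat ltNge ltW.
  apply: (near_eq_is_derive H); apply: is_derive_eq (is_derive_cst 0 x 1) _.
  by rewrite /flat ltNge ltW//= mulr0 subrr.
- rewrite -x0 [X in is_derive _ _ _ X](_ : _ = 0); last by rewrite /flat ltxx mulr0 subrr.
  (* At 0 the difference quotient of [flat k] is [flat k.+1], which tends to 0. *)
  have Q : (fun h => h^-1 *: ((flat k \o shift 0) (h *: (1 : R)) - flat k 0)) = flat k.+1.
    apply/funext => h; rewrite /flat/= ltxx subr0 addr0 /GRing.scale/= mulr1.
    by case: ifPn => h0; rewrite ?mulr0// exprS mulrA.
  have cQ : flat k.+1 h @[h --> 0^'] --> (0 : R).
    by apply: cvg_within_filter; exact: flat_cvg0.
  split; first by rewrite /derivable Q; apply/cvg_ex; exists 0.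
  by rewrite /derive Q; exact: cvg_lim.
Qed.

Lemma Sm_flat m k : Sm m (flat k).
Proof.
elim: m k => // m IH k; split.
  by move=> x; have [] := is_derive_flat k x.
rewrite (_ : _^`()%classic = fun x => flat k.+2 x + (- k%:R) * flat k.+1 x).
  by apply: SmD => //; apply: SmM => //; exact: Sm_cst.
by apply/funext => x; rewrite derive1E mulNr; have [_] := is_derive_flat k x.
Qed.

End smooth_dim1.

(** * Products of one-variable functions and smooth bumps on boxes *)

Section prod_fun.
Context {R : realType} {n : nat}.
Implicit Types (h : 'I_n -> R -> R) (r : 'rV[R]_n).

Definition prod_fun h r : R := \prod_(i < n) h i (r 0 i).

Definition deriv_at (j : 'I_n) h : 'I_n -> R -> R :=
  fun i => if i == j then (h i)^`()%classic else h i.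

Lemma differentiable_prod_fun h r : (forall i x, derivable (h i) x 1) ->
  differentiable (prod_fun h) r.
Proof.
move=> dh; have dc i : differentiable (fun r : 'rV[R]_n => h i (r 0 i)) r.
  apply: (@differentiable_comp _ _ _ _ (fun r : 'rV[R]_n => r 0 i) (h i)).
    exact: differentiable_coord.
  exact/derivable1_diffP/dh.
rewrite /prod_fun; elim: (index_enum _) => [|i s IH].
  by under eq_fun do rewrite big_nil; exact: differentiable_cst.
by under eq_fun do rewrite big_cons; apply: differentiableM.
Qed.

(** All factors but the [j]-th are constant in the [j]-th direction, so partial derivatives do not
    leave the class of products. *)
Lemma partial_prod_fun h j : (forall i x, derivable (h i) x 1) ->
  partial j (prod_fun h) = prod_fun (deriv_at j h).
Proof.
move=> dh; apply/funext => r.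
pose c := \prod_(i < n | i != j) h i (r 0 i).
have E : (fun t : R => t^-1 *: ((prod_fun h \o shift r) (t *: delta_mx 0 j) - prod_fun h r)) =
    (fun t => c * (t^-1 *: ((h j \o shift (r 0 j)) (t *: (1 : R)) - h j (r 0 j)))).
  apply/funext => t; rewrite /= /prod_fun (bigD1 j)//= [X in _ - X](bigD1 j)//= -/c.
  rewrite (eq_bigr (fun i => h i (r 0 i))); last first.
    by move=> i ij; rewrite !mxE (negbTE ij) andbF mulr0 add0r.
  by rewrite -/c !mxE !eqxx mulr1 /GRing.scale/= mulr1; ring.
rewrite /partial /derive E /prod_fun (bigD1 j)//= /deriv_at eqxx.
rewrite (eq_bigr (fun i => h i (r 0 i))); last by move=> i /negbTE ->.
rewrite -/c mulrC; apply: cvg_lim => //; apply: cvgM; first exact: cvg_cst.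
by rewrite derive1E; exact: dh.
Qed.

Lemma iter_partial_prod_fun (s : seq 'I_n) h : (forall i m, Sm m (h i)) ->
  exists2 h', (forall i m, Sm m (h' i)) & iter_partial s (prod_fun h) = prod_fun h'.
Proof.
move=> sh; elim: s => [|j s [h' sh' IH]]; first by exists h.
exists (deriv_at j h').
  move=> i m; rewrite /deriv_at; case: ifP => _ //.
  by have [] := sh' i m.+1.
by rewrite /= IH partial_prod_fun// => i x; have [] := sh' i 1%N.
Qed.

Lemma smooth_prod_fun h : (forall i m, Sm m (h i)) -> smooth (prod_fun h).
Proof.
move=> sh s r; have [h' sh' ->] := iter_partial_prod_fun s sh.
by apply: differentiable_prod_fun => i x; have [] := sh' i 1%N.
Qed.

(** A bump supported in the box with values between 0 and 1. It tends pointwise to the indicator of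
    the open box, since [flat 0 (k.+1%:R * c)] tends to [expR 0] for [c > 0]. *)
Definition box_fun (a b : 'I_n -> R) (k : nat) : 'rV[R]_n -> R :=
  prod_fun (fun i x => flat 0 (k.+1%:R * (x - a i)) * flat 0 (k.+1%:R * (b i - x))).

Lemma smooth_box_fun a b k : smooth (box_fun a b k).
Proof.
apply: smooth_prod_fun => i m; apply: SmM.
  rewrite (_ : (fun x => _) = fun x => flat 0 (k.+1%:R * x + (- k.+1%:R * a i))).
    exact/Sm_affine/Sm_flat.
  by apply/funext => x; rewrite mulrBr mulNr.
rewrite (_ : (fun x => _) = fun x => flat 0 ((- k.+1%:R) * x + k.+1%:R * b i)).
  exact/Sm_affine/Sm_flat.
by apply/funext => x; rewrite mulrBr mulNr addrC.
Qed.

Lemma flat0_le1 (x : R) : 0 <= flat 0 x <= 1.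
Proof.
rewrite flat_ge0/= /flat; case: ifPn => // x0; rewrite mul1r -expR0 ler_expR.
by rewrite oppr_le0 invr_ge0 ltW.
Qed.

Lemma box_fun_ge0_le1 a b k r : 0 <= box_fun a b k r <= 1.
Proof.
apply/andP; split.
  by apply: prodr_ge0 => i _; rewrite mulr_ge0 ?flat_ge0.
apply: prodr_ile1 => i _; rewrite mulr_ge0 ?flat_ge0//=.
have /andP[h1 h2] := flat0_le1 (k.+1%:R * (r 0 i - a i)).
have /andP[h3 h4] := flat0_le1 (k.+1%:R * (b i - r 0 i)).
exact: mulr_ile1.
Qed.

Lemma flat_le0 k (x : R) : x <= 0 -> flat k x = 0.
Proof. by move=> x0; rewrite /flat ltNge x0. Qed.

Lemma box_fun_out a b k r : ~ obox a b r -> box_fun a b k r = 0.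
Proof.
move=> abr; have [i /negP] : exists i, ~ (a i < r 0 i < b i).
  by apply/existsNP => H; exact: abr.
rewrite negb_and -!leNgt => abi.
rewrite /box_fun /prod_fun (bigD1 i)//=.
case/orP: abi => H; [rewrite (@flat_le0 0 (_ * (_ - a i)))|
   rewrite (@flat_le0 0 (_ * (b i - _)))]; rewrite ?mul0r ?mulr0 ?mul0r//.
  by rewrite mulr_ge0_le0// subr_le0.
by rewrite mulr_ge0_le0// subr_le0.
Qed.

Lemma flat0_cvg1 (c : R) : 0 < c -> flat 0 (k.+1%:R * c) @[k --> \oo] --> (1 : R).
Proof.
move=> c0; rewrite (_ : (fun k => _) = fun k : nat => expR (- (c^-1 * k.+1%:R^-1))); last first.
  apply/funext => k; rewrite /flat mulr_gt0// mul1r invfM mulrC //.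
have e0 : - (c^-1 * k.+1%:R^-1) @[k --> \oo] --> (0 : R).
  rewrite -[X in _ --> X]oppr0; apply: cvgN; rewrite -[X in _ --> X](mulr0 c^-1).
  by apply: cvgM; [exact: cvg_cst|exact: cvg_harmonic].
rewrite [X in _ --> X](_ : 1 = expR 0); last by rewrite expR0.
exact: (cvg_comp _ _ e0 (@continuous_expR R 0)).
Qed.

Lemma box_fun_cvg a b r : obox a b r -> box_fun a b k r @[k --> \oo] --> (1 : R).
Proof.
move=> abr; rewrite /box_fun /prod_fun.
rewrite [X in _ --> X](_ : 1 = \prod_(i < n) 1); last by rewrite big1.
elim: (index_enum _) => [|i s IH].
  by under eq_fun do rewrite big_nil; rewrite big_nil; exact: cvg_cst.
under eq_fun do rewrite big_cons; rewrite big_cons; apply: cvgM => //.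
have /andP[ai bi] := abr i.
by rewrite -[X in _ --> X]mulr1; apply: cvgM; apply: flat0_cvg1; rewrite subr_gt0.
Qed.

Lemma test_fun_box_fun D a b k : cbox a b `<=` D -> test_fun D (box_fun a b k).
Proof.
move=> abD; split; first exact: smooth_box_fun.
exists (cbox a b); split => //; first exact: compact_cbox.
by move=> r abr; apply: box_fun_out => /obox_sub_cbox.
Qed.

End prod_fun.

(** * The fundamental lemma of the calculus of variations *)

Section box_uniqueness.
Context {R : realType} {n : nat}.
Local Notation mu := (lebesgue_rV R n).
Implicit Types (a b : 'I_n -> R) (A : set 'rV[R]_n).

Definition oboxes : set (set 'rV[R]_n) := [set A | exists a b, A = obox a b].

Lemma oboxI a b a' b' : obox a b `&` obox a' b' =
  obox (fun i => Num.max (a i) (a' i)) (fun i => Num.min (b i) (b' i)).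
Proof.
apply/seteqP; split => [r [ab ab'] i|r H].
  have /andP[h1 h2] := ab i; have /andP[h3 h4] := ab' i.
  by rewrite gt_max lt_min h1 h2 h3 h4.
by split=> i; have := H i; rewrite gt_max lt_min => /andP[/andP[h1 h2] /andP[h3 h4]];
  rewrite ?h1 ?h3 ?h2 ?h4.
Qed.

Lemma setI_closed_oboxes : setI_closed oboxes.
Proof. by move=> _ _ [a [b ->]] [a' [b' ->]]; rewrite oboxI; eexists; eexists. Qed.

(** It suffices to treat the strips [x < r 0 i < y], and a strip is the union over [k] of the boxes
    cut at [- k] and [k] in the other coordinates. *)
Lemma measurable_sub_oboxes A : measurable A -> <<s oboxes >> A.
Proof.
move: A; apply: smallest_sub; first exact: smallest_sigma_algebra.
rewrite -bigcup_seq => _ [i _ [B mB <-]] /=; rewrite setTI.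
suff : (measurable : set (set R)) `<=` [set B | <<s oboxes >> (rV_coord i @^-1` B)] by exact.
rewrite (_ : measurable = <<s @RGenOpens.G R >>); last exact: RGenOpens.measurableE.
apply: smallest_sub.
  split=> /=.
  - by rewrite preimage_set0; exact: sigma_algebra0.
  - by move=> C; rewrite setTD preimage_setC; exact: sigma_algebraC.
  - by move=> F mF; rewrite preimage_bigcup; exact: sigma_algebra_bigcup.
move=> _ [x [y ->]] /=.
rewrite (_ : _ @^-1` _ = \bigcup_k obox (fun j => if j == i then x else - k%:R)
    (fun j => if j == i then y else k%:R)).
  by apply: sigma_algebra_bigcup => k; apply: sub_sigma_algebra; eexists; eexists.
apply/seteqP; split => [r /=|r [k _ /(_ i)]]; rewrite ?eqxx/= in_itv//= => xy.
exists (Num.truncn `|r|).+1 => // j; case: eqP => [->//|_].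
rewrite -ltr_norml (le_lt_trans _ (truncnS_gt _))//.
rewrite [leRHS]/Num.norm/= mx_normrE.
by apply: (@le_bigmax _ _ _ 0 (fun i => `|r i.1 i.2|) (0, j)).
Qed.

(** Dynkin's argument: the sets on which the positive and negative parts of [w] have equal integrals
    form a lambda-system, and it contains the open boxes, which are stable under intersection. The
    two parts are kept apart to use monotone convergence; both integrals are finite, so proper
    differences can be handled by cancellation. *)
Lemma ae_eq0_obox (w : 'rV[R]_n -> \bar R) a b : mu.-integrable (obox a b) w ->
  (forall a' b', (\int[mu]_(r in obox a' b' `&` obox a b) w r = 0)%E) ->
  ae_eq mu (obox a b) w (cst 0%E).
Proof.
move=> iw w0; have mab := measurable_obox a b; have [mw _] := integrableP _ _ _ iw.
have sub A : A `&` obox a b `<=` obox a b by exact: subIsetr.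
pose H := [set A : set 'rV[R]_n | measurable A /\
  (\int[mu]_(r in A `&` obox a b) w^\+ r = \int[mu]_(r in A `&` obox a b) w^\- r)%E].
have mAb A : measurable A -> measurable (A `&` obox a b) by move=> mA; exact: measurableI.
have mp A : measurable A -> measurable_fun (A `&` obox a b) (w^\+)%E.
  by move=> mA; apply: measurable_funepos; exact: measurable_funS mw.
have mn A : measurable A -> measurable_fun (A `&` obox a b) (w^\-)%E.
  by move=> mA; apply: measurable_funeneg; exact: measurable_funS mw.
have iA A : measurable A -> mu.-integrable (A `&` obox a b) w.
  by move=> mA; apply: integrableS iw => //; exact: mAb.
have finp A : measurable A -> (\int[mu]_(r in A `&` obox a b) w^\+ r \is a fin_num)%E.
  by move=> mA; apply: integrable_fin_num; [exact: mAb|apply: integrable_funepos; [exact: mAb|exact: iA]].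
have finn A : measurable A -> (\int[mu]_(r in A `&` obox a b) w^\- r \is a fin_num)%E.
  by move=> mA; apply: integrable_fin_num; [exact: mAb|apply: integrable_funeneg; [exact: mAb|exact: iA]].
have diffE A : measurable A -> (\int[mu]_(r in A `&` obox a b) w r = 0)%E ->
    (\int[mu]_(r in A `&` obox a b) w^\+ r = \int[mu]_(r in A `&` obox a b) w^\- r)%E.
  by move=> mA; rewrite integralE => /eqP; rewrite sube_eq ?fin_num_adde_defl ?add0e ?finp ?finn// => /eqP.
have cov : obox a b = setT `&` obox a b by rewrite setTI.
have lamH : lambda_system setT H.
  split=> //.
  - split=> //; apply: diffE => //; rewrite setTI.
    by have := w0 a b; rewrite setIid.
  - move=> A B BA [mA HA] [mB HB]; have mAB : measurable (A `\` B) by exact: measurableD.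
    split=> //.
    have AE : A `&` obox a b = (B `&` obox a b) `|` ((A `\` B) `&` obox a b).
      by rewrite -setIUl setDUK.
    have dj : [disjoint B `&` obox a b & (A `\` B) `&` obox a b].
      by apply/disj_setPS => r [[Br _] [[_ nBr] _]].
    move: HA; rewrite AE ge0_integral_setU ?ge0_integral_setU//; try (by apply: mAb).
    + rewrite HB ![(\int[mu]_(r in B `&` _) w^\- r + _)%E]addeC.
      move=> /(congr1 (fun z => z - \int[mu]_(r in B `&` obox a b) w^\- r)%E).
      by rewrite !addeK ?finn.
    + by rewrite -AE; exact: mn.
    + by rewrite -AE; exact: mp.
  - move=> F ndF HF; have mF k : measurable (F k) by case: (HF k).
    split; first exact: bigcupT_measurable.
    rewrite setI_bigcupl.
    have ndF' : {homo (fun k => F k `&` obox a b) : k l / (k <= l)%N >-> (k <= l)%O}.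
      by move=> k l kl; apply/subsetPset; apply: setSI; exact/subsetPset/ndF.
    have cp := @ge0_nondecreasing_set_cvg_integral _ _ R _ w^\+%E mu ndF'
      (fun k => mAb _ (mF k)) (fun k => mp _ (mF k)) (fun _ _ _ => funepos_ge0 _ _).
    have cn := @ge0_nondecreasing_set_cvg_integral _ _ R _ w^\-%E mu ndF'
      (fun k => mAb _ (mF k)) (fun k => mn _ (mF k)) (fun _ _ _ => funeneg_ge0 _ _).
    apply: (cvg_unique (@ereal_hausdorff R) cp).
    rewrite /= (_ : (fun k => _) = fun k => \int[mu]_(r in F k `&` obox a b) w^\- r)%E//.
    by apply/funext => k; have [_ ->] := HF k.
have GH : oboxes `<=` H.
  move=> _ [a' [b' ->]]; split; first exact: measurable_obox.
  by apply: diffE; [exact: measurable_obox|exact: w0].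
have HT := lambda_system_subset setI_closed_oboxes lamH GH (fun _ _ => @subsetT _ _).
apply: (integral_ae_eq mab iw); first exact: measurable_cst.
move=> E Eab mE; rewrite integral0.
have [_ HE] : H E by apply: HT; exact: measurable_sub_oboxes.
have EE : E `&` obox a b = E by apply/setIidPl.
rewrite -EE integralE HE subee//; exact: finn.
Qed.

(** Testing against the bumps of a box whose closure lies in [D] and letting [k] grow gives, by
    convergence dominated by [|v|], a zero integral over the open box. So [ae_eq0_obox] applies to
    each of the countably many rational cubes that cover [D]. *)
Lemma test_fun_uniqueness (D : set 'rV[R]_n) (v : 'rV[R]_n -> R) : open D ->
  mu.-integrable D (EFin \o v) ->
  (forall phi, test_fun D phi -> \int[mu]_(r in D) (v r * phi r) = 0) ->
  {ae mu, forall r, D r -> v r = 0}.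
Proof.
move=> oD iv vphi; have mD := measurable_open_rV oD.
have mv : measurable_fun D v by apply/measurable_EFinP; case/integrableP: iv.
have box0 a b : cbox a b `<=` D -> (\int[mu]_(r in obox a b) (v r)%:E = 0)%E.
  move=> abD; have oabD : obox a b `<=` D by move=> r /obox_sub_cbox; exact: abD.
  pose u k r := (v r * box_fun a b k r)%:E.
  have mphi k : measurable_fun D (box_fun a b k).
    apply: measurable_funTS; apply: measurable_continuous_rV => r.
    exact/differentiable_continuous/(smooth_box_fun a b k [::]).
  have mub k : measurable_fun D (u k).
    by apply/measurable_EFinP; exact: measurable_funM.
  pose l r := (v r * \1_(obox a b) r)%:E.
  have ml : measurable_fun D l.
    apply/measurable_EFinP; apply: measurable_funM => //.
    by apply: measurable_indic; exact: measurable_obox.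
  have ul : {ae mu, forall r, D r -> u k r @[k --> \oo] --> l r}.
    apply: aeW => r Dr; apply: cvg_EFin; first exact: nearW.
    apply: cvgM; first exact: cvg_cst.
    rewrite indicE; have [/set_mem abr|/negP abr] := boolP (r \in obox a b).
      exact: box_fun_cvg.
    rewrite (_ : (fun k => _) = fun=> 0); first exact: cvg_cst.
    by apply/funext => k; apply: box_fun_out => ?; apply: abr; rewrite inE.
  have iav : mu.-integrable D (abse \o (EFin \o v)) by exact: integrable_abse.
  have dom : {ae mu, forall r, forall k, D r -> (`|u k r| <= (abse \o (EFin \o v)) r)%E}.
    apply: aeW => r k Dr; rewrite lee_fin normrM ler_piMr//.
    by have /andP[h0 h1] := box_fun_ge0_le1 a b k r; rewrite ger0_norm.
  have [il _ +] := dominated_convergence mD mub ml ul iav dom.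
  rewrite (_ : (fun k => _) = fun=> 0%E); last first.
    apply/funext => k /=; have := vphi _ (test_fun_box_fun k abD).
    rewrite /Rintegral => /eqP.
    have iu : mu.-integrable D (u k).
      apply: (le_integrable mD (mub k) _ iav) => r Dr.
      rewrite lee_fin normrM [leRHS]normr_id ler_piMr//.
      by have /andP[h0 h1] := box_fun_ge0_le1 a b k r; rewrite ger0_norm.
    by rewrite fine_eq0 ?(integrable_fin_num mD iu)// => /eqP.
  move=> H; have /esym : (0 = \int[mu]_(x in D) l x)%E.
    by apply: (cvg_unique (@ereal_hausdorff R) _ H); exact: cvg_cst.
  rewrite integral_mkcond => l0; rewrite integral_mkcond -[RHS]l0.
  apply: eq_integral => r _.
  rewrite !patchE /l indicE; case: ifPn => /= abr; last by rewrite mulr0; case: ifP.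
  by rewrite mulr1 mem_set//; apply: oabD; exact: set_mem abr.
have iS A : measurable A -> A `<=` D -> mu.-integrable A (EFin \o v).
  by move=> mA AD; apply: integrableS iv.
have ae_box (q : {ffun 'I_n -> rat} * nat) : cbox (rat_box q).1 (rat_box q).2 `<=` D ->
    {ae mu, forall r, obox (rat_box q).1 (rat_box q).2 r -> v r = 0}.
  set a := (rat_box q).1; set b := (rat_box q).2 => abD.
  have oabD : obox a b `<=` D by move=> r /obox_sub_cbox; exact: abD.
  have : ae_eq mu (obox a b) (EFin \o v) (cst 0%E).
    apply: ae_eq0_obox; first by apply: iS => //; exact: measurable_obox.
    move=> a' b'; rewrite oboxI; apply: box0 => r H; apply: abD => i.
    by have := H i; rewrite ge_max le_min => /andP[/andP[_ ->] /andP[_ ->]].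
  by apply: filterS => r /[apply] /= -[].
(* Decoding [k] turns the countable family of null sets into a sequence. *)
pose P k r := if unpickle k is Some q then
  cbox (rat_box q).1 (rat_box q).2 `<=` D -> obox (rat_box q).1 (rat_box q).2 r -> v r = 0
  else True.
have : {ae mu, forall r, forall k, P k r}.
  apply: ae_foralln => k; rewrite /P; case: unpickle => [q|]; last exact: aeW.
  have [qD|qD] := pselect (cbox (rat_box q).1 (rat_box q).2 `<=` D).
    by apply: filterS (ae_box q qD) => r H _.
  exact: aeW.
apply: filterS => r Pr; rewrite (open_bigcup_rat_box oD) => -[q /= qD qr].
by have := Pr (pickle q); rewrite /P pickleK; exact.
Qed.

End box_uniqueness.

Transparent ip nm partial.

(** * The gradient on the real space H^1_0 *)

Section restriction.
Context {d : measure_display} {T : measurableType d} {R : realType}.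
Variables (mu : {measure set T -> \bar R}) (D : set T).
Hypothesis mD : measurable D.
Implicit Types f g : T -> R.

Lemma integral_zero_out (f : T -> \bar R) : (forall x, ~ D x -> f x = 0%E) ->
  (\int[mu]_(x in D) f x = \int[mu]_x f x)%E.
Proof.
move=> f0; rewrite integral_mkcond; apply: eq_integral => x _.
by rewrite patchE; case: ifPn => //; rewrite notin_setE => /f0.
Qed.

Lemma ip_zero_out f g : (forall x, ~ D x -> f x = 0) -> ip mu D f g = ip mu setT f g.
Proof.
move=> f0; rewrite /ip /Rintegral integral_zero_out// => x /f0 ->.
by rewrite mul0r.
Qed.

Lemma nm_zero_out f : (forall x, ~ D x -> f x = 0) -> nm mu D f = nm mu setT f.
Proof. by move=> f0; rewrite /nm ip_zero_out. Qed.

Lemma sq_int_restrict f : sq_int mu setT f -> sq_int mu D f.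
Proof.
move=> [mf foo]; split; first exact: measurable_funS mf.
apply: le_lt_trans foo; apply: ge0_subset_integral => //.
- by apply/measurable_EFinP/measurable_funX.
- by move=> x _; rewrite lee_fin sqr_ge0.
Qed.

End restriction.

Section test_functions.
Context {R : realType} {n : nat}.
Local Notation mu := (lebesgue_rV R n).
Variable D : set 'rV[R]_n.
Implicit Types (phi psi : 'rV[R]_n -> R) (r : 'rV[R]_n).

Lemma test_fun_continuous phi : test_fun D phi -> continuous phi.
Proof. by move=> [sphi _] r; exact/differentiable_continuous/(sphi [::]). Qed.

Lemma test_fun_derivable phi i r : test_fun D phi -> derivable phi r (delta_mx 0 i).
Proof. by move=> [sphi _]; exact/diff_derivable/(sphi [::]). Qed.

Lemma test_fun_partial_continuous phi i : test_fun D phi -> continuous (partial i phi).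
Proof. by move=> [sphi _] r; exact/differentiable_continuous/(sphi [:: i]). Qed.

Lemma test_fun_out phi r : test_fun D phi -> ~ D r -> phi r = 0.
Proof. by move=> [_ [K [_ KD phi0]]] Dr; apply: phi0 => /KD. Qed.

Lemma test_fun_partial_out phi i r : test_fun D phi -> ~ D r -> partial i phi r = 0.
Proof.
move=> [_ [K [cK KD phi0]]] Dr.
rewrite /partial (@near_eq_derive _ _ _ _ (cst 0)) ?derive_cst//.
have oK : open (~` K).
  by apply: closed_openC; apply: compact_closed => //; exact: norm_hausdorff.
have : nbhs r (~` K) by apply: open_nbhs_nbhs; split => // /KD.
by apply: filterS => s /phi0.
Qed.

Lemma test_fun_C1c phi : test_fun D phi -> C1c phi.
Proof.
move=> tphi; split.
- exact: test_fun_continuous.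
- by move=> i r; exact: test_fun_derivable.
- by move=> i; exact: test_fun_partial_continuous.
have [_ [K [/compact_bounded/bounded_set_rVP[M _ KM] _ phi0]]] := tphi.
exists M => r [i Mr]; apply: phi0 => /KM/(_ i).
by rewrite -ler_norml leNgt Mr.
Qed.

Hypothesis mD : measurable D.

Lemma test_fun_sq_int phi : test_fun D phi -> sq_int mu D phi.
Proof. by move=> /test_fun_C1c/C1c_sq_int; exact: sq_int_restrict. Qed.

Lemma test_fun_partial_sq_int phi i : test_fun D phi -> sq_int mu D (partial i phi).
Proof. by move=> /test_fun_C1c/(C1c_partial_sq_int i); exact: sq_int_restrict. Qed.

Lemma test_fun_nm phi : test_fun D phi -> nm mu D phi = nm mu setT phi.
Proof. by move=> tphi; apply: nm_zero_out => r; exact: test_fun_out. Qed.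

Lemma test_fun_partial_nm phi i : test_fun D phi ->
  nm mu D (partial i phi) = nm mu setT (partial i phi).
Proof. by move=> tphi; apply: nm_zero_out => r; exact: test_fun_partial_out. Qed.

Lemma partial_coord i j r : partial i (fun r : 'rV[R]_n => r 0 j) r = (i == j)%:R.
Proof.
rewrite /partial /derive.
rewrite (_ : (fun h : R => _) = fun h => h^-1 * (h * (i == j)%:R)); last first.
  by apply/funext => h; rewrite /= !mxE/= eq_sym addrK.
apply: cvg_lim => //.
apply: (@cvg_trans _ ((fun=> (i == j)%:R : R) @ 0^')); last exact: cvg_cst.
apply: near_eq_cvg; near=> h; rewrite mulKf//.
by near: h; exact: nbhs_dnbhs_neq.
Unshelve. all: by end_near. Qed.

Lemma derivable_coord i j r : derivable (fun r : 'rV[R]_n => r 0 j) r (delta_mx 0 i).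
Proof. by apply: diff_derivable; exact: differentiable_coord. Qed.

(* Integrating [partial i (f g)] over the whole space gives zero. *)
Lemma C1c_ip_partial (f g : 'rV[R]_n -> R) i :
  C1c f -> continuous g -> (forall i r, derivable g r (delta_mx 0 i)) ->
  (forall i, continuous (partial i g)) ->
  ip mu setT f (partial i g) = - ip mu setT (partial i f) g.
Proof.
move=> C1f cg dg cg'; have C1fg := C1cM C1f cg dg cg'.
have [cf df cf' [M fM]] := C1f.
have := integral_partial_eq0 i C1fg.
under eq_integral do rewrite partialM// EFinD.
have i1 : mu.-integrable setT (EFin \o (fun r => f r * partial i g r)).
  apply: (@integrable_continuous_supp _ _ M); last exact: supp_inM.
  exact: continuous_mulr.
have i2 : mu.-integrable setT (EFin \o (fun r => g r * partial i f r)).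
  apply: (@integrable_continuous_supp _ _ M); first exact: continuous_mulr.
  by under eq_fun do rewrite mulrC; apply: supp_inM; exact: supp_in_partial.
rewrite integralD//= => /(congr1 fine); rewrite fineD ?integrable_fin_num//=.
rewrite /ip /Rintegral => /eqP; rewrite addr_eq0 => /eqP ->; congr (- fine _).
by apply: eq_integral => r _; rewrite mulrC.
Qed.

Lemma test_fun_ip_partial phi psi i : test_fun D phi -> test_fun D psi ->
  ip mu D phi (partial i psi) = - ip mu D (partial i phi) psi.
Proof.
move=> tphi tpsi; rewrite !ip_zero_out => [|r|r].
- apply: C1c_ip_partial; first exact: test_fun_C1c.
  + exact: test_fun_continuous.
  + by move=> j r; exact: test_fun_derivable.
  + by move=> j; exact: test_fun_partial_continuous.
- exact: test_fun_partial_out.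
- exact: test_fun_out.
Qed.

(** For [i != j] the coordinate [r 0 j] is constant in direction [i], so the integration by parts
    leaves no term of order zero. *)
Lemma test_fun_ip_coord phi psi i j : i != j -> test_fun D phi -> test_fun D psi ->
  ip mu D (fun r => r 0 j * phi r) (partial i psi) =
  - ip mu D (fun r => r 0 j * partial i phi r) psi.
Proof.
move=> ij tphi tpsi; rewrite !ip_zero_out => [|r Dr|r Dr]; last 2 first.
- by rewrite (test_fun_partial_out i tphi Dr) mulr0.
- by rewrite (test_fun_out tphi Dr) mulr0.
have cc : continuous (fun r : 'rV[R]_n => r 0 j) by exact: coord_continuous.
have cc' k : continuous (partial k (fun r : 'rV[R]_n => r 0 j)).
  rewrite (_ : partial k _ = cst ((k == j)%:R : R)); first exact: cst_continuous.
  by apply/funext => r; exact: partial_coord.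
have E r : partial i (fun r => phi r * r 0 j) r = r 0 j * partial i phi r.
  rewrite partialM; [|exact: test_fun_derivable|exact: derivable_coord].
  by rewrite partial_coord (negbTE ij) mulr0 add0r.
rewrite (_ : (fun r => r 0 j * phi r) = fun r => phi r * r 0 j); last first.
  by apply/funext => r; rewrite mulrC.
rewrite C1c_ip_partial.
- by congr (- ip _ _ _ _); apply/funext => r; exact: E.
- apply: C1cM => //; first exact: test_fun_C1c.
  by move=> k r; exact: derivable_coord.
- exact: test_fun_continuous tpsi.
- by move=> k r; exact: test_fun_derivable tpsi.
- by move=> k; exact: test_fun_partial_continuous tpsi.
Qed.

Lemma test_funD phi psi : test_fun D phi -> test_fun D psi ->
  test_fun D (fun r => phi r + psi r).
Proof.
move=> [sphi [K [cK KD phi0]]] [spsi [L [cL LD psi0]]]; split; last first.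
  exists (K `|` L); split; first exact: compactU.
    by move=> r [/KD|/LD].
  by move=> r /not_orP[/phi0 -> /psi0 ->]; rewrite addr0.
have H s : iter_partial s (fun r => phi r + psi r) =
    (fun r => iter_partial s phi r + iter_partial s psi r).
  elim: s => // i s IH; rewrite /= IH; apply/funext => r; rewrite /partial.
  by rewrite (deriveD (f := iter_partial s phi) (g := iter_partial s psi))//;
    apply: diff_derivable; [exact: sphi|exact: spsi].
by move=> s r; rewrite H; apply: differentiableD; [exact: sphi|exact: spsi].
Qed.

Lemma partial_test_funD phi psi i : test_fun D phi -> test_fun D psi ->
  partial i (fun r => phi r + psi r) = fun r => partial i phi r + partial i psi r.
Proof.
move=> tphi tpsi; apply/funext => r; rewrite /partial.
by rewrite (deriveD (f := phi) (g := psi))//; exact: test_fun_derivable.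
Qed.

Lemma partialZ phi i (c : R) : (forall r, derivable phi r (delta_mx 0 i)) ->
  partial i (fun r => c * phi r) = fun r => c * partial i phi r.
Proof.
by move=> dphi; apply/funext => r; rewrite /partial (deriveZ (f := phi) c (dphi r)).
Qed.

Lemma test_funZ phi (c : R) : test_fun D phi -> test_fun D (fun r => c * phi r).
Proof.
move=> [sphi [K [cK KD phi0]]]; split; last first.
  by exists K; split => // r /phi0 ->; rewrite mulr0.
have H s : iter_partial s (fun r => c * phi r) = (fun r => c * iter_partial s phi r).
  elim: s => // i s IH; rewrite /= IH partialZ// => r.
  exact/diff_derivable/sphi.
by move=> s r; rewrite H; apply: (@differentiableZ _ _ _ (iter_partial s phi)); exact: sphi.
Qed.

Lemma test_fun0 : test_fun D (fun=> 0).
Proof.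
split; last by exists set0; split => //; exact: compact0.
have H s : iter_partial s (fun=> 0 : R) = (fun=> 0) :> ('rV[R]_n -> R).
  by elim: s => // i s IH; rewrite /= IH; apply/funext => r; rewrite /partial derive_cst.
by move=> s r; rewrite H; exact: differentiable_cst.
Qed.

End test_functions.

Opaque ip nm partial.

(** * The closed graph of the gradient *)

Section H10_graph.
Context {R : realType} {n : nat}.
Local Notation mu := (lebesgue_rV R n).
Variable D : set 'rV[R]_n.
Hypothesis mD : measurable D.
Implicit Types (f g phi psi : 'rV[R]_n -> R) (G H : 'I_n -> 'rV[R]_n -> R).
Local Notation sq := (sq_int mu D).
Local Notation nrm := (nm mu D).
Local Notation dot := (ip mu D).

(* The closure in L^2 of the graph of the gradient on test functions: the
   functions [f] of the real space H^1_0 together with their gradients [G]. *)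
Definition grad_rel f G :=
  [/\ sq f, forall i, sq (G i) &
    forall e, 0 < e -> exists phi, [/\ test_fun D phi,
      nrm (fun r => phi r - f r) <= e &
      forall i, nrm (fun r => partial i phi r - G i r) <= e]].

Lemma grad_rel_seq f G : grad_rel f G ->
  exists phi_ : nat -> 'rV[R]_n -> R, [/\ forall k, test_fun D (phi_ k),
    L2_cvg mu D phi_ f & forall i, L2_cvg mu D (fun k => partial i (phi_ k)) (G i)].
Proof.
move=> [sf sG fG].
have e0 k : 0 < k.+1%:R^-1 :> R by rewrite invr_gt0.
have /choice[phi_ phiP] k := fG _ (e0 k).
have cvgE (u : nat -> R) : (forall k, 0 <= u k) -> (forall k, u k <= k.+1%:R^-1) ->
    u k @[k --> \oo] --> 0.
  move=> u0 u1; apply: (cvg0_le (v := fun k => k.+1%:R^-1)); last exact: cvg_harmonic.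
  by move=> k; rewrite u0 u1.
exists phi_; split=> [k||i]; first by case: (phiP k).
- by apply: cvgE => k; [exact: nm_ge0|case: (phiP k)].
- by apply: cvgE => k; [exact: nm_ge0|case: (phiP k)].
Qed.

Lemma grad_rel_closed (f_ : nat -> 'rV[R]_n -> R) (G_ : nat -> 'I_n -> 'rV[R]_n -> R) f G :
  (forall k, grad_rel (f_ k) (G_ k)) -> sq f -> (forall i, sq (G i)) ->
  L2_cvg mu D f_ f -> (forall i, L2_cvg mu D (fun k => G_ k i) (G i)) -> grad_rel f G.
Proof.
move=> fG_ sf sG ff GG; split=> // e e0.
have e20 : 0 < e / 2 by rewrite divr_gt0.
have [k [fk Gk]] : exists k, nrm (fun r => f_ k r - f r) <= e / 2 /\
    forall i, nrm (fun r => G_ k i r - G i r) <= e / 2.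
  have near0 (u : nat -> R) : u k @[k --> \oo] --> 0 -> \forall k \near \oo, u k <= e / 2.
    by move=> u0; exact: (cvgr_le _ u0).
  have [N _ HN] : \forall k \near \oo, nrm (fun r => f_ k r - f r) <= e / 2 /\
      forall i, nrm (fun r => G_ k i r - G i r) <= e / 2.
    apply: filterI; first exact: near0 ff.
    by apply: (@filter_forall _ _ _ \oo) => i; exact: near0 (GG i).
  by exists N; exact: (HN N (leqnn N)).
have [sfk sGk /(_ _ e20)[phi [tphi phif phiG]]] := fG_ k.
have tri (a b c : 'rV[R]_n -> R) : sq a -> sq b -> sq c ->
    nrm (fun r => a r - b r) <= e / 2 -> nrm (fun r => b r - c r) <= e / 2 ->
    nrm (fun r => a r - c r) <= e.
  move=> sa sb sc ab bc.
  have := nmD mD (sq_intB mD sa sb) (sq_intB mD sb sc).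
  under eq_fun do rewrite addrA subrK.
  move=> /le_trans; apply; lra.
exists phi; split => // [|i].
  by apply: tri phif fk => //; exact: test_fun_sq_int.
by apply: tri (phiG i) (Gk i) => //; exact: test_fun_partial_sq_int.
Qed.

Lemma grad_rel_test phi : test_fun D phi -> grad_rel phi (fun i => partial i phi).
Proof.
move=> tphi; split=> [|i|e e0].
- exact: test_fun_sq_int.
- exact: test_fun_partial_sq_int.
exists phi; split=> // [|i]; under eq_fun do rewrite subrr; rewrite nm0; exact: ltW.
Qed.

Lemma grad_relD f g G H : grad_rel f G -> grad_rel g H ->
  grad_rel (fun r => f r + g r) (fun i r => G i r + H i r).
Proof.
move=> fG gH; have [phi [tphi phif phiG]] := grad_rel_seq fG.
have [psi [tpsi psig psiH]] := grad_rel_seq gH.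
have [sf sG _] := fG; have [sg sH _] := gH.
have sphi k := test_fun_sq_int mD (tphi k); have spsi k := test_fun_sq_int mD (tpsi k).
apply: (@grad_rel_closed (fun k r => phi k r + psi k r)
  (fun k i r => partial i (phi k) r + partial i (psi k) r)).
- move=> k; have := grad_rel_test (test_funD (tphi k) (tpsi k)).
  by congr grad_rel; apply/funext => i; rewrite (partial_test_funD i (tphi k) (tpsi k)).
- exact: sq_intD.
- by move=> i; exact: sq_intD.
- exact: L2_cvgD.
- move=> i; apply: L2_cvgD => // k; exact: test_fun_partial_sq_int.
Qed.

Lemma grad_relZ c f G : grad_rel f G -> grad_rel (fun r => c * f r) (fun i r => c * G i r).
Proof.
move=> fG; have [phi [tphi phif phiG]] := grad_rel_seq fG.
have [sf sG _] := fG; have sphi k := test_fun_sq_int mD (tphi k).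
apply: (@grad_rel_closed (fun k r => c * phi k r) (fun k i r => c * partial i (phi k) r)).
- move=> k; have := grad_rel_test (test_funZ c (tphi k)).
  congr grad_rel; apply/funext => i; rewrite partialZ// => r.
  exact: test_fun_derivable (tphi k).
- exact: sq_intZ.
- by move=> i; exact: sq_intZ.
- exact: L2_cvgZ.
- move=> i; apply: L2_cvgZ => // k; exact: test_fun_partial_sq_int.
Qed.

(** The relation is closed, and a constant sequence converges in L^2 to every function almost
    everywhere equal to it. *)
Lemma grad_rel_ae f f' G G' : grad_rel f G -> sq f' -> (forall i, sq (G' i)) ->
  {ae mu, forall r, D r -> f r = f' r} ->
  (forall i, {ae mu, forall r, D r -> G i r = G' i r}) -> grad_rel f' G'.
Proof.
have aeL2 (g g' : 'rV[R]_n -> R) : sq g -> sq g' ->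
    {ae mu, forall r, D r -> g r = g' r} -> L2_cvg mu D (fun=> g) g'.
  move=> sg sg' gg'; rewrite /L2_cvg (_ : nm _ _ _ = 0); first exact: cvg_cst.
  rewrite -(nm0 mu D); apply: ae_eq_nm => //.
    by apply: measurable_funB; [case: sg|case: sg'].
  by apply: filterS gg' => r + Dr => ->//; rewrite subrr.
move=> fG sf' sG' ff' GG'; have [sf sG _] := fG.
apply: (@grad_rel_closed (fun=> f) (fun=> G)) => //; first exact: aeL2.
by move=> i; exact: aeL2.
Qed.

Lemma grad_rel_ip_partial f G psi i : grad_rel f G -> test_fun D psi ->
  dot f (partial i psi) = - dot (G i) psi.
Proof.
move=> fG tpsi; have [phi [tphi phif phiG]] := grad_rel_seq fG.
have [sf sG _] := fG; have spsi := test_fun_sq_int mD tpsi.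
have spsi' := test_fun_partial_sq_int mD i tpsi.
have sphi k := test_fun_sq_int mD (tphi k).
have sphi' k := test_fun_partial_sq_int mD i (tphi k).
have cst_cvg g : sq g -> L2_cvg mu D (fun=> g) g.
  by move=> sg; rewrite /L2_cvg; under eq_fun do under eq_fun do rewrite subrr;
    rewrite nm0; exact: cvg_cst.
have c1 := L2_cvg_ip mD sphi sf (fun=> spsi') spsi' phif (cst_cvg _ spsi').
have c2 := L2_cvg_ip mD sphi' (sG i) (fun=> spsi) spsi (phiG i) (cst_cvg _ spsi).
by apply: cvg_eqN c1 c2 => k; exact: test_fun_ip_partial.
Qed.

(** The identity on test functions passes to the limit because the coordinate is bounded by [M] on
    [D]. It is the source of the symmetry of the rotation term. *)
Lemma grad_rel_ip_coord f g G H i j (M : R) : i != j -> D `<=` cbox (fun=> - M) (fun=> M) ->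
  grad_rel f G -> grad_rel g H ->
  dot (fun r => r 0 j * f r) (H i) = - dot (fun r => r 0 j * G i r) g.
Proof.
move=> ij DM fG gH; have [phi [tphi phif phiG]] := grad_rel_seq fG.
have [psi [tpsi psig psiH]] := grad_rel_seq gH.
have [sf sG _] := fG; have [sg sH _] := gH.
have sphi k := test_fun_sq_int mD (tphi k); have spsi k := test_fun_sq_int mD (tpsi k).
have sphi' k := test_fun_partial_sq_int mD i (tphi k).
have spsi' k := test_fun_partial_sq_int mD i (tpsi k).
have mc : measurable_fun D (fun r : 'rV[R]_n => r 0 j).
  by apply: measurable_funTS; exact: measurable_rV_coord.
have cle r : D r -> `|r 0 j| <= M by move=> /DM/(_ j); rewrite -ler_norml.
have sqc h : sq h -> sq (fun r => r 0 j * h r).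
  move=> sh; apply: (@le_sq_int _ _ _ _ _ mD _ h M) => //.
    by apply: measurable_funM => //; case: sh.
  by apply: aeW => r Dr; rewrite normrM ler_wpM2r// cle.
have nmc h : sq h -> nrm (fun r => r 0 j * h r) <= `|M| * nrm h.
  move=> sh; apply: le_nm => //.
    by apply: measurable_funM => //; case: sh.
  by apply: aeW => r Dr; rewrite normrM ler_wpM2r// (le_trans (cle r Dr))// ler_norm.
have cvgc (h_ : nat -> 'rV[R]_n -> R) h : (forall k, sq (h_ k)) -> sq h ->
    L2_cvg mu D h_ h -> L2_cvg mu D (fun k r => r 0 j * h_ k r) (fun r => r 0 j * h r).
  move=> sh_ sh hh; apply: (cvg0_le (v := fun k => `|M| * nrm (fun r => h_ k r - h r))).
    move=> k; rewrite nm_ge0/=; apply: le_trans (nmc _ _); last exact: sq_intB.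
    by rewrite le_eqVlt; apply/orP/or_introl/eqP; congr nm; apply/funext => r; rewrite mulrBr.
  by rewrite -[X in _ --> X](mulr0 `|M|); apply: cvgM => //; exact: cvg_cst.
have c1 := L2_cvg_ip mD (fun k => sqc _ (sphi k)) (sqc _ sf) spsi' (sH i)
  (cvgc _ _ sphi sf phif) (psiH i).
have c2 := L2_cvg_ip mD (fun k => sqc _ (sphi' k)) (sqc _ (sG i)) spsi sg
  (cvgc _ _ sphi' (sG i) (phiG i)) psig.
by apply: cvg_eqN c1 c2 => k; exact: test_fun_ip_coord.
Qed.


Lemma grad_rel_complete (f_ : nat -> 'rV[R]_n -> R) (G_ : nat -> 'I_n -> 'rV[R]_n -> R) :
  (forall k, grad_rel (f_ k) (G_ k)) ->
  (forall e, 0 < e -> exists N, forall k l, (N <= k)%N -> (N <= l)%N ->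
    nrm (fun r => f_ k r - f_ l r) <= e /\
    forall i, nrm (fun r => G_ k i r - G_ l i r) <= e) ->
  exists f G, [/\ grad_rel f G, L2_cvg mu D f_ f &
    forall i, L2_cvg mu D (fun k => G_ k i) (G i)].
Proof.
move=> fG C.
have sf k : sq (f_ k) by case: (fG k).
have sG k i : sq (G_ k i) by case: (fG k).
have [f sqf ff] : exists2 f, sq f & L2_cvg mu D f_ f.
  by apply: L2_complete => // e /C[N HN]; exists N => k l Nk Nl; case: (HN k l Nk Nl).
have /choice[G GP] i : exists g, sq g /\ L2_cvg mu D (fun k => G_ k i) g.
  have [||g sg gg] := @L2_complete _ _ _ mu _ mD (fun k => G_ k i); first by [].
    by move=> e /C[N HN]; exists N => k l Nk Nl; case: (HN k l Nk Nl).
  by exists g.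
exists f, G; split => //; last by move=> i; case: (GP i).
by apply: (grad_rel_closed fG) => // i; case: (GP i).
Qed.

End H10_graph.

(** * Poincare and quartic inequalities by density *)

Section H10_graph_inequalities.
Context {R : realType} {n : nat}.
Variable D : set 'rV[R]_n.+1.
Hypothesis mD : measurable D.
Variable M : R.
Hypothesis M0 : 0 < M.
Hypothesis DM : D `<=` cbox (fun=> - M) (fun=> M).
Local Notation mu := (lebesgue_rV R n.+1).
Local Notation nrm := (nm mu D).
Implicit Types (f phi : 'rV[R]_n.+1 -> R) (G : 'I_n.+1 -> 'rV[R]_n.+1 -> R).

Lemma test_fun_supp phi : test_fun D phi -> supp_in M phi.
Proof.
move=> tphi r [i Mr]; apply: (test_fun_out tphi) => /DM/(_ i).
by rewrite -ler_norml leNgt Mr.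
Qed.

Lemma grad_rel_poincare f G : grad_rel D f G -> nrm f <= 4 * M * nrm (G 0).
Proof.
move=> fG; have [phi [tphi phif phiG]] := grad_rel_seq fG.
have [sf sG _] := fG.
have c1 := L2_cvg_nm mD (fun k => test_fun_sq_int mD (tphi k)) sf phif.
have c2 := L2_cvg_nm mD (fun k => test_fun_partial_sq_int mD 0 (tphi k)) (sG 0) (phiG 0).
have c3 : 4 * M * nrm (partial 0 (phi k)) @[k --> \oo] --> 4 * M * nrm (G 0).
  by apply: cvgM c2; exact: cvg_cst.
apply: (ler_cvg_to c1 c3); apply: nearW => k.
rewrite (test_fun_nm (tphi k)) (test_fun_partial_nm 0 (tphi k)).
by apply: C1c_poincare => //; [exact: test_fun_C1c (tphi k)|exact: test_fun_supp].
Qed.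

Definition grad_sqr G : R := \sum_(i < n.+1) nrm (G i) ^+ 2.

Lemma grad_sqr_ge0 G : 0 <= grad_sqr G.
Proof. by apply: sumr_ge0 => i _; rewrite sqr_ge0. Qed.

(** Convergence in L^2 does not control fourth powers: they are bounded by Fatou's lemma along an
    almost everywhere convergent subsequence, while the squared gradient norms converge. *)
Lemma grad_rel_exp4 (C : R) : 0 <= C ->
  (forall phi, test_fun D phi -> (\int[mu]_(r in D) (phi r ^+ 4)%:E <=
     (C * grad_sqr (fun i => partial i phi) ^+ 2)%:E)%E) ->
  forall f G, grad_rel D f G ->
    (\int[mu]_(r in D) (f r ^+ 4)%:E <= (C * grad_sqr G ^+ 2)%:E)%E.
Proof.
move=> C0 test4 f G fG; have [phi [tphi phif phiG]] := grad_rel_seq fG.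
have [sf sG _] := fG.
have sphi k := test_fun_sq_int mD (tphi k).
have [s ks aes] := L2_cvg_ae mD sphi sf phif.
have cS : C * grad_sqr (fun i => partial i (phi k)) ^+ 2 @[k --> \oo] --> C * grad_sqr G ^+ 2.
  apply: cvgM; first exact: cvg_cst.
  have cS : grad_sqr (fun i => partial i (phi k)) @[k --> \oo] --> grad_sqr G.
    rewrite /grad_sqr; elim: (index_enum _) => [|i l IH].
      by under eq_fun do rewrite big_nil; rewrite big_nil; exact: cvg_cst.
    under eq_fun do rewrite big_cons; rewrite big_cons; apply: cvgD => //.
    have c := L2_cvg_nm mD (fun k => test_fun_partial_sq_int mD i (tphi k)) (sG i) (phiG i).
    by under eq_fun do rewrite expr2; rewrite expr2; exact: (cvgM c c).
  by under eq_fun do rewrite expr2; rewrite expr2; exact: (cvgM cS cS).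
(* The bounds along the sequence are below the limit bound only up to [e], and only from some index
   on. *)
apply/lee_addgt0Pr => e e0.
have [N _ HN] : \forall k \near \oo, C * grad_sqr (fun i => partial i (phi k)) ^+ 2 <=
    C * grad_sqr G ^+ 2 + e by apply: (cvgr_le _ cS); rewrite ltrDl.
apply: (@fatou_le _ _ _ mu D mD (fun k r => phi (s k) r ^+ 4) _ _ N).
- by move=> k; apply: measurable_funX; case: (sphi (s k)).
- by apply: measurable_funX; case: sf.
- by move=> k r _; rewrite (exprM _ 2 2) sqr_ge0.
- apply: filterS aes => r /[swap] Dr /(_ Dr) c.
  rewrite !exprS expr0 mulr1; under eq_fun do rewrite !exprS expr0 mulr1.
  by do 3 apply: (cvgM c).
- move=> k Nk; apply: le_trans (test4 _ (tphi (s k))) _.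
  by rewrite -EFinD lee_fin; apply: HN; rewrite /= (leq_trans Nk).
Qed.

End H10_graph_inequalities.

Section test_functions_exp4.
Context {R : realType}.
Variables (M : R) (M0 : 0 < M).

(** The Poincare bound on the norm [x] of the function eliminates it from the Ladyzhenskaya bound,
    which leaves the gradient alone. *)
Lemma exp4_arith2 (x a b : R) : 0 <= a -> 0 <= b -> 0 <= x -> x <= 4 * M * a ->
  4 * x ^+ 2 * a * b <= 64 * M ^+ 2 * (a ^+ 2 + b ^+ 2) ^+ 2.
Proof.
move=> a0 b0 x0 xa.
have x2 : x ^+ 2 <= 16 * M ^+ 2 * a ^+ 2.
  rewrite (_ : 16 * M ^+ 2 * a ^+ 2 = (4 * M * a) ^+ 2); last by ring.
  by rewrite lerXn2r// nnegrE// mulr_ge0// mulr_ge0// ltW.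
have ab : a * b <= a ^+ 2 + b ^+ 2.
  by have := sqr_ge0 (a - b); have := mulr_ge0 a0 b0; rewrite !expr2; nra.
have aS : a ^+ 2 <= a ^+ 2 + b ^+ 2 by rewrite lerDl sqr_ge0.
rewrite -mulrA; apply: (@le_trans _ _ (4 * (16 * M ^+ 2 * a ^+ 2) * (a * b))).
  by rewrite ler_wpM2r ?mulr_ge0// ler_wpM2l.
rewrite (_ : 4 * (16 * M ^+ 2 * a ^+ 2) * (a * b) = 64 * M ^+ 2 * (a ^+ 2 * (a * b))); last by ring.
apply: ler_wpM2l; first by rewrite mulr_ge0 ?sqr_ge0.
by rewrite [leRHS]expr2 ler_pM ?mulr_ge0 ?sqr_ge0.
Qed.

Lemma exp4_arith3 (x a b c : R) : 0 <= a -> 0 <= x -> x <= 4 * M * a ->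
  4 * x * a * (b ^+ 2 + c ^+ 2) <= 16 * M * (a ^+ 2 + (b ^+ 2 + c ^+ 2)) ^+ 2.
Proof.
move=> a0 x0 xa; set T := b ^+ 2 + c ^+ 2.
have T0 : 0 <= T by rewrite addr_ge0 ?sqr_ge0.
apply: (@le_trans _ _ (4 * (4 * M * a) * a * T)).
  by rewrite !ler_wpM2r// ler_wpM2l.
rewrite (_ : 4 * (4 * M * a) * a * T = 16 * M * (a ^+ 2 * T)); last by ring.
apply: ler_wpM2l; first by rewrite mulr_ge0 ?ltW.
by rewrite [leRHS]expr2 ler_pM ?sqr_ge0// ?lerDl ?lerDr// sqr_ge0.
Qed.

Lemma sum_ord2 (F : 'I_2 -> R) : \sum_i F i = F 0 + F 1.
Proof.
rewrite !big_ord_recl big_ord0 addr0; congr (F _ + F _); exact: val_inj.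
Qed.

Lemma sum_ord3 (F : 'I_3 -> R) : \sum_i F i = F 0 + (F (lift 0 0) + F (lift 0 1)).
Proof.
rewrite !big_ord_recl big_ord0 addr0; congr (F _ + (F _ + F _)); exact: val_inj.
Qed.

(** The constant is the sum of [64 * M ^+ 2], from dimension 2, and [16 * M], from dimension 3, so
    that one expression serves both. *)
Lemma test_fun_exp4 (n : nat) (D : set 'rV[R]_n.+2) (phi : 'rV[R]_n.+2 -> R) :
  n.+2 = 2%N \/ n.+2 = 3%N -> measurable D -> D `<=` cbox (fun=> - M) (fun=> M) ->
  test_fun D phi ->
  (\int[lebesgue_rV R n.+2]_(r in D) (phi r ^+ 4)%:E <=
    ((64 * M ^+ 2 + 16 * M) * grad_sqr D (fun i => partial i phi) ^+ 2)%:E)%E.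
Proof.
case: n D phi => [|[|n]] D phi hn mD DM tphi; last by case: hn.
all: rewrite integral_zero_out; last by move=> r /(test_fun_out tphi) ->; rewrite expr0n.
all: have C1phi := test_fun_C1c tphi; have x0 := nm_ge0 (lebesgue_rV R _) setT phi.
all: have a0 i := nm_ge0 (lebesgue_rV R _) setT (partial i phi).
all: have xa := C1c_poincare M0 C1phi (test_fun_supp DM tphi).
all: rewrite /grad_sqr; under eq_bigr do rewrite (test_fun_partial_nm _ tphi).
all: have M20 : 0 <= 64 * M ^+ 2 by rewrite mulr_ge0 ?sqr_ge0.
all: have M10 : 0 <= 16 * M by rewrite mulr_ge0 ?ltW.
- apply: le_trans (C1c_ladyzhenskaya2 C1phi) _; rewrite lee_fin.
  apply: (le_trans (exp4_arith2 (a0 0) (a0 1) x0 xa)).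
  rewrite sum_ord2.
  by rewrite ler_wpM2r ?sqr_ge0// lerDl.
- apply: le_trans (C1c_ladyzhenskaya3 C1phi) _; rewrite lee_fin.
  apply: (le_trans (exp4_arith3 _ _ (a0 0) x0 xa)).
  rewrite sum_ord3.
  by rewrite ler_wpM2r ?sqr_ge0// lerDr.
Qed.

End test_functions_exp4.

(** * The complex space H^1_0 *)

Section complex_parts.
Context {R : realType}.
Implicit Types z w : R[i].

(** Indexing the two parts by a boolean allows a single proof for both, and sums over [bool] in the
    scalar products. *)
Definition cpart (b : bool) z : R := if b then complex.Im z else complex.Re z.

Lemma cpartD b z w : cpart b (z + w) = cpart b z + cpart b w.
Proof. by case: b z w => -[a c] [e f]. Qed.

Lemma cpartB b z w : cpart b (z - w) = cpart b z - cpart b w.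
Proof. by case: b z w => -[a c] [e f]. Qed.

Lemma cpart_mulC b z (x : R) : cpart b (z * real_complex R x) = cpart b z * x.
Proof. by case: b z => -[a c] /=; ring. Qed.

Lemma normc_sqr z : Normc.normc z ^+ 2 = cpart false z ^+ 2 + cpart true z ^+ 2.
Proof. by case: z => a b /=; rewrite sqr_sqrtr// addr_ge0 ?sqr_ge0. Qed.

Lemma Re_conjM z w :
  complex.Re (conjc z * w) = cpart false z * cpart false w + cpart true z * cpart true w.
Proof. by case: z w => [a b] [c d] /=; ring. Qed.

Lemma Im_conjM z w :
  complex.Im (conjc z * w) = cpart false z * cpart true w - cpart true z * cpart false w.
Proof. by case: z w => [a b] [c d] /=; ring. Qed.

Lemma Re_mul z w :
  complex.Re (z * w) = cpart false z * cpart false w - cpart true z * cpart true w.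
Proof. by case: z w => [a b] [c d] /=; ring. Qed.

Lemma Im_mul z w :
  complex.Im (z * w) = cpart false z * cpart true w + cpart true z * cpart false w.
Proof. by case: z w => [a b] [c d] /=; ring. Qed.

Lemma complex_eq z w : (forall b, cpart b z = cpart b w) -> z = w.
Proof.
by case: z w => [a b] [c d] H; have /= -> := H false; have /= -> := H true.
Qed.

End complex_parts.

Section complex_H10.
Context {R : realType} {n : nat}.
Local Notation mu := (lebesgue_rV R n).
Variable D : set 'rV[R]_n.
Hypothesis mD : measurable D.
Implicit Types (u v w : 'rV[R]_n -> R[i]) (G H : bool -> 'I_n -> 'rV[R]_n -> R).
Local Notation sq := (sq_int mu D).
Local Notation dot := (ip mu D).
Local Notation part b u := (fun r => cpart b (u r)).

Lemma in_L2P u : in_L2 D u <-> forall b, sq (part b u).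
Proof.
split=> [[[mr mi] foo] b|su].
  have mb : measurable_fun D (part b u) by case: b.
  split=> //; apply: le_lt_trans foo; apply: ge0_le_integral => //.
  - by move=> r _; rewrite lee_fin sqr_ge0.
  - by apply/measurable_EFinP/measurable_funX.
  - under eq_fun do rewrite normc_sqr.
    by apply/measurable_EFinP; apply: measurable_funD; apply: measurable_funX.
  - move=> r _; rewrite lee_fin normc_sqr; case: b {mb}; first by rewrite lerDr sqr_ge0.
    by rewrite lerDl sqr_ge0.
split; first by split; [case: (su false)|case: (su true)].
under eq_integral do rewrite normc_sqr EFinD.
rewrite ge0_integralD//; last 4 first.
- by move=> r _; rewrite lee_fin sqr_ge0.
- by apply/measurable_EFinP/measurable_funX; case: (su false).
- by move=> r _; rewrite lee_fin sqr_ge0.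
- by apply/measurable_EFinP/measurable_funX; case: (su true).
by rewrite lte_add_pinfty//; [case: (su false)|case: (su true)].
Qed.

Lemma cpart_cintegral b (f : 'rV[R]_n -> R[i]) :
  cpart b (cintegral D f) = \int[mu]_(r in D) cpart b (f r).
Proof. by case: b. Qed.

Lemma is_weak_partialP i u v : is_weak_partial D i u v <->
  (forall b, sq (part b v)) /\
  forall b psi, test_fun D psi -> dot (part b u) (partial i psi) = - dot (part b v) psi.
Proof.
have E b (w : 'rV[R]_n -> R[i]) (g : 'rV[R]_n -> R) :
    cpart b (cintegral D (fun r => w r * real_complex R (g r))) = dot (part b w) g.
  rewrite cpart_cintegral; transitivity (\int[mu]_(r in D) (cpart b (w r) * g r)).
    by apply: eq_Rintegral => r _; rewrite cpart_mulC.
  by rewrite ipE.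
have cpartN b (z : R[i]) : cpart b (- z) = - cpart b z by case: b z => -[].
split=> [[/in_L2P sv uv]|[sv uv]].
  split=> // b psi tpsi; have := uv _ tpsi => /(congr1 (cpart b)).
  by rewrite cpartN !E.
split; first exact/in_L2P.
by move=> psi tpsi; apply: complex_eq => b; rewrite cpartN !E; exact: uv.
Qed.

Hypothesis oD : open D.
Hypothesis fD : (mu D < +oo)%E.

Lemma sq_int_integrable (f : 'rV[R]_n -> R) : sq f -> mu.-integrable D (EFin \o f).
Proof.
move=> sf.
have s1 : sq (fun=> 1).
  split; first exact: measurable_cst.
  by under eq_integral do rewrite expr1n; rewrite integral_cst// mul1e.
have := sq_int_integrable_mul mD sf s1.
by apply: eq_integrable => // r _ /=; rewrite mulr1.
Qed.

Lemma dot_test_unique (f g : 'rV[R]_n -> R) : sq f -> sq g ->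
  (forall psi, test_fun D psi -> dot f psi = dot g psi) ->
  {ae mu, forall r, D r -> f r = g r}.
Proof.
move=> sf sg fg; have := @test_fun_uniqueness R n D (fun r => f r - g r) oD.
move=> /(_ (sq_int_integrable (sq_intB mD sf sg)))H.
have {H} : {ae mu, forall r, D r -> f r - g r = 0}.
  apply: H => psi tpsi; have spsi := test_fun_sq_int mD tpsi.
  have := ipBl mD sf sg spsi; rewrite fg// subrr => <-.
  by rewrite ipE.
by apply: filterS => r + Dr => /(_ Dr)/eqP; rewrite subr_eq0 => /eqP.
Qed.

Lemma is_weak_partial_unique i u v w : is_weak_partial D i u v -> is_weak_partial D i u w ->
  forall b, {ae mu, forall r, D r -> cpart b (v r) = cpart b (w r)}.
Proof.
move=> /is_weak_partialP[sv uv] /is_weak_partialP[sw uw] b.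
apply: dot_test_unique => // psi tpsi.
by apply: oppr_inj; rewrite -uv// uw.
Qed.

Definition h10 u G := forall b, grad_rel D (part b u) (G b).

Definition of_parts (G : bool -> 'I_n -> 'rV[R]_n -> R) (i : 'I_n) : 'rV[R]_n -> R[i] :=
  fun r => Complex (G false i r) (G true i r).

Lemma cpart_of_parts b G i r : cpart b (of_parts G i r) = G b i r.
Proof. by case: b. Qed.

Lemma h10_weak_partial u G i : h10 u G -> is_weak_partial D i u (of_parts G i).
Proof.
move=> uG; apply/is_weak_partialP; split => [b|b psi tpsi].
  under eq_fun do rewrite cpart_of_parts; by have [_ sG _] := uG b.
under [X in - dot X _]eq_fun do rewrite cpart_of_parts.
exact: grad_rel_ip_partial.
Qed.

(** The parts of the selected weak derivatives. A gradient obtained in another way agrees with them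
    almost everywhere only ([h10_grad_ae]). *)
Definition grad u (b : bool) (i : 'I_n) : 'rV[R]_n -> R := part b (weak_partial D i u).

Lemma weak_partial_spec u i : (exists v, is_weak_partial D i u v) ->
  is_weak_partial D i u (weak_partial D i u).
Proof. by move=> [v uv]; rewrite /weak_partial; apply: xgetPex; exists v. Qed.

Lemma grad_ae u v i : is_weak_partial D i u v ->
  forall b, {ae mu, forall r, D r -> cpart b (v r) = grad u b i r}.
Proof.
move=> uv; have wp := weak_partial_spec (ex_intro _ v uv).
exact: is_weak_partial_unique uv wp.
Qed.

Lemma grad_sq_int u v i : is_weak_partial D i u v -> forall b, sq (grad u b i).
Proof.
move=> uv; have /weak_partial_spec : exists v, is_weak_partial D i u v by exists v.
by move=> /is_weak_partialP[].
Qed.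

Lemma h10_grad_ae u G : h10 u G ->
  forall b i, {ae mu, forall r, D r -> G b i r = grad u b i r}.
Proof.
move=> uG b i; have := grad_ae (h10_weak_partial i uG) b.
by apply: filterS => r; rewrite cpart_of_parts.
Qed.

Lemma h10_grad u G : h10 u G -> h10 u (grad u).
Proof.
move=> uG b; apply: (grad_rel_ae mD (uG b)).
- by have [] := uG b.
- by move=> i; exact: grad_sq_int (h10_weak_partial i uG) b.
- by apply: aeW.
- by move=> i; exact: h10_grad_ae.
Qed.

Lemma L2_ipE u v : (forall b, sq (part b u)) -> (forall b, sq (part b v)) ->
  L2_ip D u v = Complex (dot (part false u) (part false v) + dot (part true u) (part true v))
    (dot (part false u) (part true v) - dot (part true u) (part false v)).
Proof.
move=> su sv; apply: complex_eq => b; rewrite /L2_ip cpart_cintegral !ipE.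
have int b1 b2 : mu.-integrable D (EFin \o (fun r => cpart b1 (u r) * cpart b2 (v r))).
  exact: sq_int_integrable_mul.
case: b => /=.
  rewrite -(RintegralB mD (int false true) (int true false)).
  by apply: eq_Rintegral => r _; rewrite Im_conjM.
rewrite -(RintegralD mD (int false false) (int true true)).
by apply: eq_Rintegral => r _; rewrite Re_conjM.
Qed.

Lemma L2_norm_sqr u : (forall b, sq (part b u)) ->
  L2_norm D u ^+ 2 = nm mu D (part false u) ^+ 2 + nm mu D (part true u) ^+ 2.
Proof.
by move=> su; rewrite /L2_norm L2_ipE//= sqr_sqrtr ?sqr_nm// addr_ge0 ?ip_ge0.
Qed.

Lemma H1_norm_sqr u : (forall b, sq (part b u)) -> (forall b i, sq (grad u b i)) ->
  H1_norm D u ^+ 2 = (nm mu D (part false u) ^+ 2 + nm mu D (part true u) ^+ 2) +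
    \sum_(i < n) (nm mu D (grad u false i) ^+ 2 + nm mu D (grad u true i) ^+ 2).
Proof.
move=> su sG; rewrite /H1_norm sqr_sqrtr; last first.
  by rewrite addr_ge0 ?sqr_ge0// sumr_ge0// => i _; rewrite sqr_ge0.
rewrite L2_norm_sqr//; congr (_ + _); apply: eq_bigr => i _.
by rewrite L2_norm_sqr// => b; exact: sG.
Qed.

Lemma ctest_fun_h10 phi : ctest_fun D phi -> h10 phi (fun b i => partial i (part b phi)).
Proof. by move=> [tr ti] [|]; apply: grad_rel_test. Qed.

Lemma h10B u v G H : h10 u G -> h10 v H ->
  h10 (u - v) (fun b i r => G b i r - H b i r).
Proof.
move=> uG vH b; have := grad_relD mD (uG b) (grad_relZ mD (-1) (vH b)).
congr grad_rel; first by apply/funext => r; rewrite [in RHS]/= cpartB mulN1r.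
by apply/funext => i; apply/funext => r; rewrite mulN1r.
Qed.

Lemma h10D u v G H : h10 u G -> h10 v H ->
  h10 (fun r => u r + v r) (fun b i r => G b i r + H b i r).
Proof.
move=> uG vH b; have := grad_relD mD (uG b) (vH b).
by congr grad_rel; apply/funext => r; rewrite cpartD.
Qed.

Lemma h10Z u G (c : R[i]) : h10 u G -> h10 (fun r => c * u r)
  (fun b i r => if b then complex.Re c * G true i r + complex.Im c * G false i r
                else complex.Re c * G false i r + (- complex.Im c) * G true i r).
Proof.
move=> uG [|].
  have := grad_relD mD (grad_relZ mD (complex.Re c) (uG true)) (grad_relZ mD (complex.Im c) (uG false)).
  by congr grad_rel; apply/funext => r; rewrite /cpart Im_mul.
have := grad_relD mD (grad_relZ mD (complex.Re c) (uG false)) (grad_relZ mD (- complex.Im c) (uG true)).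
by congr grad_rel; apply/funext => r; rewrite /cpart Re_mul mulNr.
Qed.

(** From left to right, the H^1 norm dominates the norm of each part of the function and of each
    part of its derivatives. From right to left, the real approximants of the two parts are
    assembled into one complex test function. *)
Lemma in_H10P u : in_H10 D u <-> exists G, h10 u G.
Proof.
split=> [[[/in_L2P su wu] app]|[G uG]].
  exists (grad u) => b; have [v uv] : exists v : 'I_n -> 'rV[R]_n -> R[i],
      forall i, is_weak_partial D i u (v i) by have /choice[v vP] := wu; exists v.
  have sG b' i : sq (grad u b' i) by exact: grad_sq_int (uv i) b'.
  split => // e e0; have [phi tphi Hphi] := app e e0.
  have hphi := ctest_fun_h10 tphi.
  exists (part b phi); have tpart : test_fun D (part b phi) by case: b; case: tphi.
  have su_phi b' : sq (part b' (u - phi)).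
    rewrite (_ : (fun r => _) = fun r => cpart b' (u r) - cpart b' (phi r)).
      by apply: sq_intB => //; have [] := hphi b'.
    by apply/funext => r; rewrite [in LHS]/= cpartB.
  (* [H1_norm D (u - phi)] is built on the weak derivatives selected for [u - phi] itself;
     uniqueness relates them to these differences. *)
  have wuphi i : is_weak_partial D i (u - phi)
      (fun r => weak_partial D i u r - of_parts (fun b i => partial i (part b phi)) i r).
    have /is_weak_partialP[s1 h1] : is_weak_partial D i u (weak_partial D i u).
      by apply: weak_partial_spec; exists (v i).
    have /is_weak_partialP[s2 h2] := h10_weak_partial i hphi.
    apply/is_weak_partialP; split=> [b'|b' psi tpsi].
      under eq_fun do rewrite cpartB; exact: sq_intB.
    have spsi := test_fun_sq_int mD tpsi; have spsi' := test_fun_partial_sq_int mD i tpsi.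
    have sphi : sq (part b' phi) by have [] := hphi b'.
    rewrite (_ : (fun r => cpart b' ((u - phi) r)) = fun r => cpart b' (u r) - cpart b' (phi r)); last first.
      by apply/funext => r; rewrite [in LHS]/= cpartB.
    under [X in - dot X _]eq_fun do rewrite cpartB.
    by rewrite !ipBl// h1// h2// opprB opprK addrC.
  have sgrad b' i : sq (grad (u - phi) b' i) by exact: grad_sq_int (wuphi i) b'.
  have H2 : H1_norm D (u - phi) ^+ 2 <= e ^+ 2.
    by rewrite lerXn2r ?nnegrE ?sqrtr_ge0 ?ltW.
  rewrite H1_norm_sqr// in H2.
  have ge (x : R) : x ^+ 2 <= (nm mu D (part false (u - phi)) ^+ 2 + nm mu D (part true (u - phi)) ^+ 2) +
    \sum_(i < n) (nm mu D (grad (u - phi) false i) ^+ 2 + nm mu D (grad (u - phi) true i) ^+ 2) ->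
    0 <= x -> x <= e.
    move=> xle x0; rewrite -(@ler_pXn2r _ 2)// ?nnegrE ?(ltW e0)//; exact: le_trans xle H2.
  have S0 : 0 <= \sum_(i < n) (nm mu D (grad (u - phi) false i) ^+ 2 + nm mu D (grad (u - phi) true i) ^+ 2).
    by apply: sumr_ge0 => i _; rewrite addr_ge0 ?sqr_ge0.
  split=> // [|i].
    rewrite nmB; apply: ge; last exact: nm_ge0.
    rewrite (_ : (fun r => _) = part b (u - phi)); last by apply/funext => r; rewrite [in RHS]/= cpartB.
    apply: ler_wpDr => //; case: b {tpart}; first by rewrite lerDr sqr_ge0.
    by rewrite lerDl sqr_ge0.
  rewrite nmB; apply: ge; last exact: nm_ge0.
  have -> : nm mu D (fun r => grad u b i r - partial i (part b phi) r) = nm mu D (grad (u - phi) b i).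
    apply: ae_eq_nm => //.
    - by have [] := sq_intB mD (sG b i) (test_fun_partial_sq_int mD i tpart).
    - by case: (sgrad b i).
    have := grad_ae (wuphi i) b; apply: filterS => r + Dr => /(_ Dr) <-.
    by rewrite cpartB cpart_of_parts.
  apply: ler_wpDl; first by rewrite addr_ge0 ?sqr_ge0.
  rewrite (bigD1 i)//=; apply: ler_wpDr.
    by apply: sumr_ge0 => j _; rewrite addr_ge0 ?sqr_ge0.
  by case: b {tpart}; rewrite ?lerDr ?lerDl sqr_ge0.
have su b : sq (part b u) by have [] := uG b.
split.
  split; first exact/in_L2P.
  by move=> i; exists (of_parts G i); exact: h10_weak_partial.
(* The squared norm is a sum of [2 * n.+1] squares, each at most [e' ^+ 2], and
   [e ^+ 2 = 4 * n.+1%:R ^+ 2 * e' ^+ 2] is larger. *)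
move=> e e0; pose e' := e / (2 * (n.+1)%:R).
have e'0 : 0 < e' by rewrite divr_gt0// mulr_gt0.
have /choice[phi phiP] b : exists phi, [/\ test_fun D phi,
      nm mu D (fun r => phi r - cpart b (u r)) <= e' &
      forall i, nm mu D (fun r => partial i phi r - G b i r) <= e'].
  by have [_ _ /(_ _ e'0)] := uG b.
pose Phi r := Complex (phi false r) (phi true r).
have partPhi b : part b Phi = phi b by apply/funext => r; case: b.
have tPhi : ctest_fun D Phi by split; [case: (phiP false)|case: (phiP true)].
exists Phi => //.
have hPhi := ctest_fun_h10 tPhi; have hB := h10B uG hPhi.
have sB b : sq (part b (u - Phi)) by have [] := hB b.
have sgrad b i : sq (grad (u - Phi) b i) by exact: grad_sq_int (h10_weak_partial i hB) b.
rewrite -(@ltr_pXn2r _ 2)// ?nnegrE ?sqrtr_ge0 ?(ltW e0)//.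
rewrite H1_norm_sqr//.
have b1 b : nm mu D (part b (u - Phi)) ^+ 2 <= e' ^+ 2.
  rewrite lerXn2r ?nnegrE ?nm_ge0 ?(ltW e'0)//.
  rewrite (_ : (fun r => _) = fun r => cpart b (u r) - phi b r); last first.
    by apply/funext => r; rewrite [in LHS]/= cpartB -(partPhi b).
  by rewrite nmB; case: (phiP b).
have b2 b i : nm mu D (grad (u - Phi) b i) ^+ 2 <= e' ^+ 2.
  rewrite lerXn2r ?nnegrE ?nm_ge0 ?(ltW e'0)//.
  rewrite -(_ : nm mu D (fun r => G b i r - partial i (phi b) r) =
    nm mu D (grad (u - Phi) b i)).
    by rewrite nmB; case: (phiP b).
  apply: ae_eq_nm => //.
  - have [_ sGb _] := uG b; have [tphi _ _] := phiP b.
    by have [] := sq_intB mD (sGb i) (test_fun_partial_sq_int mD i tphi).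
  - by case: (sgrad b i).
  by have := h10_grad_ae hB b i; rewrite partPhi.
apply: (@le_lt_trans _ _ ((e' ^+ 2 + e' ^+ 2) + \sum_(i < n) (e' ^+ 2 + e' ^+ 2))).
  by apply: lerD; [exact: lerD|apply: ler_sum => i _; exact: lerD].
rewrite sumr_const card_ord -mulrS -mulr_natr.
have N1 : 1 <= n.+1%:R :> R by rewrite ler1n.
have -> : e = e' * (2 * n.+1%:R) by rewrite /e' divfK// mulf_neq0// pnatr_eq0.
have e2 : 0 < e' ^+ 2 by rewrite exprn_gt0.
set N := n.+1%:R in N1 *.
rewrite (_ : (e' * (2 * N)) ^+ 2 = e' ^+ 2 * (4 * N ^+ 2)); last by ring.
rewrite (_ : (e' ^+ 2 + e' ^+ 2) * N = e' ^+ 2 * (2 * N)); last by ring.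
by rewrite ltr_pM2l//; nra.
Qed.

End complex_H10.

(** * Projected gradient descent for a quartic energy *)

Section symmetric_forms.
Context {R : realType} {E : lmodType R}.
Implicit Types (H : set E) (a : E -> E -> R).

Definition subspace H :=
  (forall x y, H x -> H y -> H (x + y)) /\ (forall c x, H x -> H (c *: x)).

(** The conditions bear on [H] only, since the forms to come involve selected weak derivatives,
    which are arbitrary outside H^1_0. *)
Definition sym_form H a :=
  [/\ forall x y, H x -> H y -> a x y = a y x,
      forall x y z, H x -> H y -> H z -> a (x + y) z = a x z + a y z &
      forall c x y, H x -> H y -> a (c *: x) y = c * a x y].

Definition lin_form H (l : E -> R) :=
  (forall x y, H x -> H y -> l (x + y) = l x + l y) /\
  (forall c x, H x -> l (c *: x) = c * l x).

Variables (H : set E) (HS : subspace H).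
Let HD x y : H x -> H y -> H (x + y). Proof. by case: HS => h _; exact: h. Qed.
Let HZ c x : H x -> H (c *: x). Proof. by case: HS => _ h; exact: h. Qed.

Lemma subspaceB x y : H x -> H y -> H (x - y).
Proof. by move=> Hx Hy; rewrite -scaleN1r; exact/HD/HZ. Qed.

Section form.
Variable a : E -> E -> R.
Hypothesis aS : sym_form H a.

Lemma formC x y : H x -> H y -> a x y = a y x.
Proof. by case: aS => h _ _; exact: h. Qed.

Lemma formDl x y z : H x -> H y -> H z -> a (x + y) z = a x z + a y z.
Proof. by case: aS => _ h _; exact: h. Qed.

Lemma formZl c x y : H x -> H y -> a (c *: x) y = c * a x y.
Proof. by case: aS => _ _ h; exact: h. Qed.

Lemma formDr x y z : H x -> H y -> H z -> a z (x + y) = a z x + a z y.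
Proof. by move=> *; rewrite formC ?formDl ?(formC (y := z))//; exact: HD. Qed.

Lemma formZr c x y : H x -> H y -> a y (c *: x) = c * a y x.
Proof. by move=> *; rewrite formC ?formZl ?(formC (y := y))//; exact: HZ. Qed.

Lemma form_lin x : H x -> lin_form H (a x).
Proof. by move=> Hx; split=> *; rewrite (formDr, formZr). Qed.

Lemma form_sqrD c x y : H x -> H y ->
  a (x + c *: y) (x + c *: y) = a x x + 2 * c * a x y + c ^+ 2 * a y y.
Proof.
move=> Hx Hy; have Hc := HZ c Hy; have Hxc := HD Hx Hc.
rewrite formDl// !formDr// !formZl// !formZr// (formC Hy Hx); ring.
Qed.

Hypothesis a0 : forall x, H x -> 0 <= a x x.

Lemma form_CS x y : H x -> H y -> `|a x y| <= Num.sqrt (a x x) * Num.sqrt (a y y).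
Proof.
move=> Hx Hy; rewrite -sqrtrM ?a0// -sqrtr_sqr ler_sqrt; last by rewrite mulr_ge0 ?a0.
have q c : 0 <= a x x + 2 * c * a x y + c ^+ 2 * a y y.
  by rewrite -form_sqrD//; apply: a0; exact/HD/HZ.
have := a0 Hy; rewrite le_eqVlt => /predU1P[y0|y0].
  (* If [a x y] were nonzero, the polynomial would be equal to -1 at this point. *)
  have := q (- (a x x + 1) / (2 * a x y)); rewrite -y0 !mulr0 addr0.
  have [->|xy0] := eqVneq (a x y) 0; first by rewrite expr0n.
  rewrite (_ : 2 * _ * a x y = - (a x x + 1)); first by move=> ?; lra.
  by field.
have := q (- a x y / a y y).
rewrite (_ : _ + _ = (a x x * a y y - a x y ^+ 2) / a y y); last by field; rewrite gt_eqF.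
by rewrite pmulr_lge0 ?invr_gt0// subr_ge0.
Qed.

End form.

(** * Riesz representation for a complete semidefinite form *)

Section riesz.
Variable a : E -> E -> R.
Hypotheses (aS : sym_form H a) (a0 : forall x, H x -> 0 <= a x x).
Hypothesis acomplete : forall F : nat -> E, (forall k, H (F k)) ->
  (forall e : R, 0 < e -> exists N, forall j k, (N <= j)%N -> (N <= k)%N ->
     a (F j - F k) (F j - F k) <= e) ->
  exists2 f, H f & forall e : R, 0 < e -> exists N, forall k, (N <= k)%N ->
     a (F k - f) (F k - f) <= e.

(** Minimizing a quadratic functional stays inside [H]: elements at distance 0 for [a] are never
    identified, and the representative is determined only up to such elements. *)
Lemma riesz (l : E -> R) (C : R) : H !=set0 -> lin_form H l ->
  (forall x, H x -> `|l x| <= C * Num.sqrt (a x x)) ->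
  exists2 z, H z & forall h, H h -> a z h = l h.
Proof.
move=> [x0 Hx0] [lD lZ] lC.
(* The representative is the limit of a minimizing sequence of J. *)
pose J x := a x x - 2 * l x.
have Jge x : H x -> - C ^+ 2 <= J x.
  move=> Hx; have := lC x Hx; have := a0 Hx; rewrite /J.
  move=> /sqr_sqrtr; set s := Num.sqrt _ => <-.
  rewrite ler_norml => /andP[_ ?]; have := sqr_ge0 (s - C); rewrite sqrrB; nra.
pose S := [set J x | x in H].
have Sinf : has_inf S.
  split; first by exists (J x0), x0.
  by exists (- C ^+ 2) => _ [x Hx <-]; exact: Jge.
have Jinf x : H x -> inf S <= J x.
  by move=> Hx; apply: ge_inf; [case: Sinf|exists x].
have /choice[F FP] (k : nat) : exists x, H x /\ J x <= inf S + k.+1%:R^-1.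
  have [|_ [x Hx <-] /ltW Jx] := @inf_adherent _ S k.+1%:R^-1 _ Sinf.
    by rewrite invr_gt0.
  by exists x.
have FH k : H (F k) by case: (FP k).
have small (e : R) : 0 < e -> exists N, forall k, (N <= k)%N -> k.+1%:R^-1 <= e.
  move=> e0; exists (Num.truncn e^-1) => k Nk.
  rewrite invf_ple ?posrE//; apply: ltW; apply: lt_le_trans (truncnS_gt _) _.
  by rewrite ler_nat.
have [|z Hz zF] := acomplete FH.
  (* By the parallelogram identity [a (x - y) (x - y) = 2 J x + 2 J y - 4 J ((x + y) / 2)], excesses
     over the infimum of at most [e / 4] give a distance of at most [e]. *)
  move=> e e0; have [|N NP] := small (e / 4); first by rewrite divr_gt0.
  exists N => j k Nj Nk; have Hj := FH j; have Hk := FH k.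
  have Hm : H (2^-1 *: (F j + F k)) by exact/HZ/HD.
  have := Jinf _ Hm; have [_] := FP j; have [_] := FP k; have := NP _ Nj; have := NP _ Nk.
  rewrite /J lZ ?lD ?formZl ?formZr//; try exact: HD.
  have := form_sqrD aS 1 Hj Hk; rewrite scale1r => ->; rewrite -scaleN1r form_sqrD//.
  by move: (a _ _) (a _ _) (a _ _) (l _) (l _) (inf S) (k.+1%:R^-1) (j.+1%:R^-1) => *; lra.
exists z => // h Hh.
set b := a z h - l h.
(* First-order optimality in the form [J z <= J (z + t h)]. It is proved up to [e] at a term [F k]
   of the sequence: one half pays for the excess of [J (F k)] over the infimum, the other for
   replacing [F k] by [z] in the cross term. *)
have quad t : 0 <= 2 * t * b + t ^+ 2 * a h h.
  rewrite -[X in _ <= X]opprK oppr_ge0; apply/ler_addgt0Pr => e e0; rewrite add0r.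
  pose s := Num.sqrt (a h h); have s0 : 0 <= s by exact: sqrtr_ge0.
  pose dl := e / (4 * (`|t| + 1) * (s + 1)).
  have t0 := normr_ge0 t.
  have dl0 : 0 < dl by rewrite divr_gt0// !mulr_gt0//; lra.
  have [N1 P1] := zF _ (exprn_gt0 2 dl0).
  have [|N2 P2] := small (e / 2); first by rewrite divr_gt0.
  pose k := maxn N1 N2; have := P1 k (leq_maxl _ _); have := P2 k (leq_maxr _ _).
  move=> k2 k1; have Hk := FH k; have HB := subspaceB Hk Hz.
  have B : `|a (F k - z) h| <= dl * s.
    apply: le_trans (form_CS aS a0 HB Hh) _; apply: ler_wpM2r => //.
    by rewrite -[leRHS](ger0_norm (ltW dl0)) -sqrtr_sqr ler_wsqrtr.
  have B2 : `|2 * t * a (F k - z) h| <= e / 2.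
    rewrite !normrM (ger0_norm (_ : 0 <= 2))//.
    apply: le_trans (_ : 2 * `|t| * (dl * s) <= _); first by rewrite ler_wpM2l// mulr_ge0.
    rewrite /dl; set T := `|t| in t0 *.
    rewrite (_ : 2 * T * (e / (4 * (T + 1) * (s + 1)) * s) =
      e / 2 * ((T / (T + 1)) * (s / (s + 1)))); last by field; apply/andP; split; lra.
    rewrite ler_piMr ?divr_ge0 ?(ltW e0)// mulr_ile1 ?divr_ge0//; try lra.
      by rewrite ler_pdivrMr; lra.
    by rewrite ler_pdivrMr; lra.
  have := Jinf _ (HD Hk (HZ t Hh)); have [_] := FP k.
  rewrite /J form_sqrD// lD ?lZ//; last exact: HZ.
  have E1 : a (F k - z) h = a (F k) h - a z h.
    by rewrite -scaleN1r formDl ?formZl ?mulN1r//; exact: HZ.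
  move: B2; rewrite E1 ler_norml => /andP[_ B2] J1 J2.
  rewrite /b; move: J1 J2 B2 k2.
  by move: (a _ _) (a _ _) (a _ _) (a _ _) (l _) (l _) (inf S) (k.+1%:R^-1) => *; lra.
have := a0 Hh; set c := a h h in quad *; move=> c0.
(* The minimizer would be [- b / c], but [c] may vanish; this value already makes the polynomial
   negative unless [b = 0]. *)
have := quad (- b / (c + 1)).
rewrite (_ : _ + _ = - (b ^+ 2 * (c + 2) / (c + 1) ^+ 2)); last by field; lra.
rewrite oppr_ge0 => le0; apply/eqP; rewrite -subr_eq0 -/b -sqrf_eq0 eq_le sqr_ge0 andbT.
move: le0; rewrite pmulr_lle0; last by rewrite invr_gt0 exprn_gt0//; lra.
by rewrite pmulr_lle0//; lra.
Qed.

End riesz.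

(** * One step and all steps of the descent, for abstract forms *)

Section descent.
Variables (a m q T : E -> E -> R) (P : E -> R) (beta kappa Cq CT CP : R).
Hypotheses (aS : sym_form H a) (mS : sym_form H m) (qS : sym_form H q).
Hypotheses (a0 : forall x, H x -> 0 <= a x x) (m0 : forall x, H x -> 0 <= m x x).
Hypotheses (beta0 : 0 <= beta) (kappa0 : 0 < kappa).
Hypotheses (Cq0 : 0 <= Cq) (CT0 : 0 <= CT) (CP0 : 0 <= CP).
Hypothesis coercive : forall x, H x -> kappa * a x x <= a x x + q x x.
Hypothesis q_le : forall x y, H x -> H y ->
  `|q x y| <= Cq * (Num.sqrt (a x x) * Num.sqrt (a y y)).
Hypothesis T_le : forall x y, H x -> H y ->
  `|T x y| <= CT * (Num.sqrt (a x x) ^+ 3 * Num.sqrt (a y y)).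
Hypothesis T_lin : forall x, H x -> lin_form H (T x).
Hypothesis P0 : forall x, H x -> 0 <= P x.
Hypothesis P_le : forall x, H x -> P x <= CP * a x x ^+ 2.
Hypothesis PZ : forall c x, H x -> P (c *: x) = c ^+ 4 * P x.
Hypothesis P_expand : forall x y, H x -> H y ->
  P (x + y) <= P x + 4 * T x y + CP * (a x x * a y y + a y y ^+ 2).

(** [a] stands for the H^1_0 product, [q] for the potential and rotation terms, [P] for the fourth
    power of the L^4 norm. [T x] is a quarter of the derivative of [P] at [x], which cancels the 4
    of [beta / 4] in the derivative below. *)
Definition form_energy x := 2^-1 * (a x x + q x x) + beta / 4 * P x.

Definition form_energy_deriv x y := a x y + q x y + beta * T x y.

Local Notation en := form_energy.
Local Notation den := form_energy_deriv.

Lemma coercive_ge0 x : H x -> 0 <= a x x + q x x.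
Proof. by move=> Hx; apply: le_trans (coercive Hx); rewrite mulr_ge0 ?a0// ltW. Qed.

Lemma form_energy_ge x : H x -> a x x <= 2 / kappa * en x.
Proof.
move=> Hx; have := coercive Hx; have := P0 Hx; rewrite /en => Px Qx.
have : 0 <= beta / 4 * P x by rewrite !mulr_ge0.
move: (beta / 4 * P x) => p p0.
by rewrite mulrAC ler_pdivlMr//; lra.
Qed.

Lemma form_energy_le x : H x ->
  en x <= 2^-1 * (1 + Cq) * a x x + beta / 4 * CP * a x x ^+ 2.
Proof.
move=> Hx; have := q_le Hx Hx; rewrite -expr2 sqr_sqrtr ?a0// ler_norml => /andP[_ ?].
rewrite /en -[X in _ <= _ + X]mulrA; apply: lerD; first by rewrite -mulrA; lra.
by apply: ler_wpM2l; [rewrite mulr_ge0|exact: P_le].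
Qed.

Lemma form_energy_shrink t x : 0 <= t -> t <= 1 -> H x -> en (t *: x) <= en x.
Proof.
move=> t0 t1 Hx; have Htx := HZ t Hx; have := coercive_ge0 Hx.
rewrite /en PZ// (formZl aS)// (formZr aS)// (formZl qS)// (formZr qS)// => h.
rewrite (_ : _ + t * _ = t ^+ 2 * (a x x + q x x)); last by ring.
apply: lerD; apply: ler_wpM2l; rewrite ?mulr_ge0//.
  by rewrite ler_piMl// exprn_ile1.
by rewrite ler_piMl ?P0// exprn_ile1.
Qed.

(** The gradient is tested against itself, and the resulting inequality is divided by its norm. *)
Lemma sobolev_grad_le u s : H u -> H s -> (forall h, H h -> a s h = den u h) ->
  Num.sqrt (a s s) <= (1 + Cq) * Num.sqrt (a u u) + beta * CT * Num.sqrt (a u u) ^+ 3.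
Proof.
move=> Hu Hs sP; have := sP _ Hs; rewrite /den.
have := form_CS aS a0 Hu Hs; have := q_le Hu Hs; have := T_le Hu Hs.
rewrite !ler_norml => /andP[_ t] /andP[_ q'] /andP[_ a'].
have {t} : beta * T u s <= beta * (CT * (Num.sqrt (a u u) ^+ 3 * Num.sqrt (a s s))).
  exact: ler_wpM2l.
have sE := sqr_sqrtr (a0 Hs); have := sqrtr_ge0 (a s s); have := sqrtr_ge0 (a u u).
move: q' a' sE; set X := Num.sqrt (a u u); set Y := Num.sqrt (a s s).
move=> q' a' sE X0; rewrite le_eqVlt => /predU1P[<-|Y0] t' e.
  by rewrite addr_ge0// !mulr_ge0 ?exprn_ge0// addr_ge0.
rewrite -(ler_pM2r Y0) -expr2 sE e.
rewrite (_ : _ * Y = X * Y + Cq * (X * Y) + beta * (CT * (X ^+ 3 * Y))); last by ring.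
by apply: lerD => //; exact: lerD.
Qed.

(** All claims follow from [a g z = 0]: as [z] represents [m u] and [s] the derivative,
    [m u g = a z g = 0] and [den u g = a s g = a g g], while [a g g] is [a s s] minus a square over
    [a z z]. *)
Lemma projected_gradient u s z : H u -> m u u = 1 -> H s -> H z ->
  (forall h, H h -> a s h = den u h) -> (forall h, H h -> a z h = m u h) ->
  let g := s - (a s z / a z z) *: z in
  [/\ H g, m u g = 0, den u g = a g g & a g g <= a s s].
Proof.
move=> Hu mu1 Hs Hz sP zP g.
(* Otherwise the Cauchy-Schwarz inequality gives [a z u = 0], whereas [a z u = m u u = 1]. *)
have zz : 0 < a z z.
  rewrite lt_def a0// andbT; apply/eqP => zz0.
  by have := form_CS aS a0 Hz Hu; rewrite zP// mu1 zz0 sqrtr0 mul0r normr1 ler10.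
have HcZ c : H (c *: z) by exact: HZ.
have Hg : H g by exact: subspaceB.
have gE h : H h -> a g h = a s h - a s z / a z z * a z h.
  by move=> Hh; rewrite /g -scaleNr formDl ?formZl ?mulNr//; rewrite scaleNr -scaleN1r; exact: HZ.
have gz : a g z = 0 by rewrite gE// divfK ?subrr// gt_eqF.
have gg : a g g = a s g by rewrite gE// (formC aS Hz Hg) gz mulr0 subr0.
split=> //; first by rewrite -zP// (formC aS).
- by rewrite gg sP.
- rewrite gg (formC aS Hs Hg) gE//.
  rewrite lerBlDr lerDl (formC aS Hz Hs) -mulrAC divr_ge0//; last exact: ltW.
  by rewrite -expr2 sqr_ge0.
Qed.

(** The first-order terms add up to [- alpha * den u g = - alpha * a g g]. In the remainder,
    [alpha <= 1] allows the term in [alpha ^+ 4] to be counted with those in [alpha ^+ 2]. *)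
Lemma form_energy_step u g (alpha : R) : H u -> H g -> 0 <= alpha -> alpha <= 1 ->
  den u g = a g g ->
  en (u - alpha *: g) <= en u - alpha * a g g + alpha ^+ 2 * a g g *
    (2^-1 * (1 + Cq) + beta / 4 * CP * (a u u + a g g)).
Proof.
move=> Hu Hg al0 al1 dE.
have Hag : H ((- alpha) *: g) by exact: HZ.
rewrite -scaleNr /en (form_sqrD aS)// (form_sqrD qS)//.
have := P_expand Hu Hag; have [_ ->] := T_lin Hu => //.
rewrite formZl// formZr//.
have /andP[_ qg] : - (Cq * a g g) <= q g g <= Cq * a g g.
  by have := q_le Hg Hg; rewrite -expr2 sqr_sqrtr ?a0// ler_norml.
move: dE; rewrite /den.
have := a0 Hu; have := a0 Hg; move: qg.
move: (a u u) (a g g) (a u g) (q u u) (q u g) (q g g) (T u g) (P u) (P (u + _)).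
move=> A G B Q Q1 Q2 t p p' qg G0 A0 dE pp.
have bp : beta / 4 * p' <= beta / 4 * (p + 4 * (- alpha * t) +
    CP * (A * (- alpha * (- alpha * G)) + (- alpha * (- alpha * G)) ^+ 2)).
  by apply: ler_wpM2l => //; rewrite mulr_ge0.
have a2 : alpha ^+ 2 * Q2 <= alpha ^+ 2 * (Cq * G) by rewrite ler_wpM2l ?sqr_ge0.
have a4 : beta / 4 * CP * (alpha ^+ 2 * (alpha ^+ 2 * G ^+ 2)) <=
    beta / 4 * CP * (alpha ^+ 2 * G ^+ 2).
  apply: ler_wpM2l; first by rewrite !mulr_ge0.
  apply: ler_wpM2l; first exact: sqr_ge0.
  by rewrite ler_piMl ?sqr_ge0// exprn_ile1.
have -> : B = G - Q1 - beta * t by rewrite -dE; ring.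
by move: bp a2 a4; lra.
Qed.

Lemma normalized_step u g (alpha : R) : H u -> m u u = 1 -> H g -> m u g = 0 ->
  let v := u - alpha *: g in let w := (Num.sqrt (m v v))^-1 *: v in
  [/\ H w, m w w = 1 & en w <= en v].
Proof.
move=> Hu mu1 Hg ug v w.
have Hv : H v by apply: subspaceB => //; exact: HZ.
have mv : 1 <= m v v.
  rewrite /v -scaleNr (form_sqrD mS)// mu1 ug mulr0 addr0 lerDl.
  by rewrite mulr_ge0 ?sqr_ge0 ?m0.
have mv0 : 0 < m v v by exact: lt_le_trans mv.
have s1 : 1 <= Num.sqrt (m v v) by rewrite -sqrtr1 ler_wsqrtr.
have s0 : 0 < Num.sqrt (m v v) by exact: lt_le_trans s1.
split; first exact: HZ.
  rewrite /w (formZl mS)//; last exact: HZ.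
  rewrite (formZr mS)// mulrA -expr2 exprVn sqr_sqrtr ?ltW// mulVf// gt_eqF//.
by apply: form_energy_shrink => //; rewrite invf_le1.
Qed.

(** The decrease at step [k] uses norm bounds, which themselves come from the energy bound kept by
    the earlier decreases; the induction carries membership, normalization and the energy bound
    together. [s] and [z] are characterized only where [u k] is in [H], which is part of this
    invariant. *)
Lemma gradient_descent (rho : R) : exists Cu Cg Calpha : R,
  [/\ 0 < Cu, 0 < Cg, 0 < Calpha, Calpha <= 1 &
   forall (alpha : nat -> R) (amin amax : R),
     0 < amin -> (forall k, amin <= alpha k <= amax) -> amax <= Calpha ->
   forall u s z g : nat -> E,
     H (u 0%N) -> m (u 0%N) (u 0%N) = 1 -> Num.sqrt (a (u 0%N) (u 0%N)) = rho ->
     (forall k, H (u k) -> H (s k) /\ forall h, H h -> a (s k) h = den (u k) h) ->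
     (forall k, H (u k) -> H (z k) /\ forall h, H h -> a (z k) h = m (u k) h) ->
     (forall k, H (u k) -> g k = s k - (a (s k) (z k) / a (z k) (z k)) *: z k) ->
     (forall k, let v := u k - alpha k *: g k in
        u k.+1 = (Num.sqrt (m v v))^-1 *: v) ->
   forall k, [/\ H (u k), H (g k) & [/\ Num.sqrt (a (u k) (u k)) <= Cu,
     Num.sqrt (a (g k) (g k)) <= Num.sqrt (a (s k) (s k)),
     Num.sqrt (a (s k) (s k)) <= Cg &
     amin / 2 * a (g k) (g k) <= en (u k) - en (u k.+1)]]].
Proof.
(* A bound of the initial energy through [rho] alone, by [form_energy_le]. Adding 1 in the next line
   makes [Cu] positive. *)
pose E0 := 2^-1 * (1 + Cq) * rho ^+ 2 + beta / 4 * CP * (rho ^+ 2) ^+ 2.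
pose Cu := Num.sqrt (2 / kappa * E0) + 1.
have Cu0 : 0 < Cu by rewrite ltr_wpDl ?sqrtr_ge0.
pose Cg := (1 + Cq) * Cu + beta * CT * Cu ^+ 3.
have Cg0 : 0 < Cg.
  by rewrite ltr_wpDr ?mulr_ge0 ?exprn_ge0 ?(ltW Cu0)// mulr_gt0// ltr_wpDr.
pose C := 2^-1 * (1 + Cq) + beta / 4 * CP * (Cu ^+ 2 + Cg ^+ 2).
have C0 : 0 < C.
  apply: ltr_wpDr; first by rewrite !mulr_ge0// addr_ge0// sqr_ge0.
  by rewrite mulr_gt0// ltr_wpDr.
(* [C] bounds the coefficient of the second-order term; [alpha k * C <= 2^-1] makes this term at
   most half of the first-order decrease. *)
exists Cu, Cg, (Num.min 1 (2 * C)^-1); split=> //.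
- by rewrite lt_min ltr01 invr_gt0 mulr_gt0.
- by rewrite ge_min lexx.
move=> alpha amin amax amin0 alphaP; rewrite le_min => /andP[amax1 amaxC].
move=> u s z g Hu0 mu0 urho sP zP gE uE.
have step k : H (u k) -> m (u k) (u k) = 1 -> en (u k) <= E0 ->
    [/\ H (u k.+1), m (u k.+1) (u k.+1) = 1 & en (u k.+1) <= E0] /\
    [/\ H (g k), Num.sqrt (a (u k) (u k)) <= Cu,
     Num.sqrt (a (g k) (g k)) <= Num.sqrt (a (s k) (s k)),
     Num.sqrt (a (s k) (s k)) <= Cg &
     amin / 2 * a (g k) (g k) <= en (u k) - en (u k.+1)].
  move=> Hu mu ue; have [Hs sk] := sP _ Hu; have [Hz zk] := zP _ Hu.
  have := projected_gradient Hu mu Hs Hz sk zk; rewrite -gE//= => -[Hg ug dg gs].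
  have := normalized_step (alpha k) Hu mu Hg ug; rewrite /= -uE => -[Hw mw we].
  have uCu : Num.sqrt (a (u k) (u k)) <= Cu.
    apply: (@le_trans _ _ (Num.sqrt (2 / kappa * E0))); last by rewrite lerDl.
    rewrite ler_wsqrtr//; apply: le_trans (form_energy_ge Hu) _.
    by rewrite ler_wpM2l// divr_ge0// ltW.
  have sCg : Num.sqrt (a (s k) (s k)) <= Cg.
    apply: le_trans (sobolev_grad_le Hu Hs sk) _; apply: lerD.
      by rewrite ler_wpM2l// addr_ge0.
    by rewrite ler_wpM2l ?mulr_ge0// lerXn2r ?nnegrE ?sqrtr_ge0// ltW.
  have /andP[al1 al2] := alphaP k.
  have al0 : 0 < alpha k by exact: lt_le_trans al1.
  have alm1 : alpha k <= 1 by apply: le_trans amax1.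
  have := form_energy_step Hu Hg (ltW al0) alm1 dg => es.
  have sq x b : H x -> Num.sqrt (a x x) <= b -> 0 <= b -> a x x <= b ^+ 2.
    by move=> Hx xb b0; rewrite -(sqr_sqrtr (a0 Hx)) lerXn2r ?nnegrE ?sqrtr_ge0.
  have uu := sq _ _ Hu uCu (ltW Cu0).
  have gg := le_trans gs (sq _ _ Hs sCg (ltW Cg0)).
  have gg0 := a0 Hg.
  have K1 : alpha k * C <= 2^-1.
    have : alpha k <= (2 * C)^-1 by exact: le_trans amaxC.
    by rewrite invfM -ler_pdivlMr.
  have K2 : 2^-1 * (1 + Cq) + beta / 4 * CP * (a (u k) (u k) + a (g k) (g k)) <= C.
    by rewrite lerD2l ler_wpM2l ?lerD// !mulr_ge0.
  have dec : amin / 2 * a (g k) (g k) <= en (u k) - en (u k.+1).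
    apply: (@le_trans _ _ (alpha k / 2 * a (g k) (g k))).
      by rewrite ler_wpM2r// ler_wpM2r.
    have K3 : alpha k ^+ 2 * a (g k) (g k) * (2^-1 * (1 + Cq) +
        beta / 4 * CP * (a (u k) (u k) + a (g k) (g k))) <=
        alpha k * a (g k) (g k) * 2^-1.
      apply: le_trans (_ : alpha k ^+ 2 * a (g k) (g k) * C <= _).
        by rewrite ler_wpM2l// mulr_ge0// sqr_ge0.
      rewrite (_ : _ * C = alpha k * a (g k) (g k) * (alpha k * C)); last by ring.
      by rewrite ler_wpM2l// mulr_ge0// ltW.
    by move: we es K3; lra.
  have dec0 : 0 <= amin / 2 * a (g k) (g k) by rewrite !mulr_ge0// ltW.
  split; split=> //; first by move: dec dec0 ue; lra.
  by rewrite ler_wsqrtr.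
have inv k : [/\ H (u k), m (u k) (u k) = 1 & en (u k) <= E0].
  elim: k => [|k [Hu mu ue]]; last by case: (step k Hu mu ue).
  split=> //; apply: le_trans (form_energy_le Hu0) _.
  by rewrite /E0 -urho sqr_sqrtr// a0.
by move=> k; have [Hu mu ue] := inv k; have [_ [? ? ? ? ?]] := step k Hu mu ue.
Qed.

End descent.
End symmetric_forms.

(** * The Hilbert space structure of H^1_0 *)

Section form_operations.
Context {R : realType} {E : lmodType R}.
Variable H : set E.

Lemma sym_formD a b : sym_form H a -> sym_form H b -> sym_form H (fun x y => a x y + b x y).
Proof.
move=> [aC aD aZ] [bC bD bZ]; split=> [x y Hx Hy|x y z Hx Hy Hz|c x y Hx Hy].
- by rewrite aC// bC.
- by rewrite aD// bD// addrACA.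
- by rewrite aZ// bZ// mulrDr.
Qed.

Lemma sym_formZ k a : sym_form H a -> sym_form H (fun x y => k * a x y).
Proof.
move=> [aC aD aZ]; split=> [x y Hx Hy|x y z Hx Hy Hz|c x y Hx Hy].
- by rewrite aC.
- by rewrite aD// mulrDr.
- by rewrite aZ// mulrCA.
Qed.

Lemma sym_form_sum (I : finType) (f : I -> E -> E -> R) : (forall i, sym_form H (f i)) ->
  sym_form H (fun x y => \sum_i f i x y).
Proof.
move=> fS; split=> [x y Hx Hy|x y z Hx Hy Hz|c x y Hx Hy].
- by apply: eq_bigr => i _; have [e _ _] := fS i; exact: e.
- by rewrite -big_split; apply: eq_bigr => i _; have [_ e _] := fS i; exact: e.
- by rewrite mulr_sumr; apply: eq_bigr => i _; have [_ _ e] := fS i; exact: e.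
Qed.

Lemma eq_sym_form a b : (forall x y, H x -> H y -> a x y = b x y) -> subspace H ->
  sym_form H a -> sym_form H b.
Proof.
move=> ab [HD HZ] [aC aD aZ]; split=> [x y Hx Hy|x y z Hx Hy Hz|c x y Hx Hy].
- by rewrite -!ab// aC.
- by rewrite -!ab// ?aD//; exact: HD.
- by rewrite -!ab// ?aZ//; exact: HZ.
Qed.

End form_operations.

(** * Maps that are linear up to null sets *)

Section ae_linear_maps.
Context {d : measure_display} {T : measurableType d} {R : realType} {E : lmodType R}.
Variables (mu : {measure set T -> \bar R}) (D : set T) (H : set E).
Hypotheses (mD : measurable D) (HS : subspace H).
Local Notation sq := (sq_int mu D).
Local Notation dot := (ip mu D).
Implicit Types (F G : E -> T -> R).

(** Models [u |-> grad D u b i], whose value at a sum is only almost everywhere the sum of the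
    values; scalar products do not see the difference. *)
Definition ae_lin F :=
  [/\ forall x, H x -> sq (F x),
      forall x y, H x -> H y -> {ae mu, forall t, D t -> F (x + y) t = F x t + F y t} &
      forall c x, H x -> {ae mu, forall t, D t -> F (c *: x) t = c * F x t}].

Let HD x y : H x -> H y -> H (x + y). Proof. by case: HS => h _; exact: h. Qed.
Let HZ c x : H x -> H (c *: x). Proof. by case: HS => _ h; exact: h. Qed.

Lemma ae_lin_sq F x : ae_lin F -> H x -> sq (F x).
Proof. by case=> h _ _; exact: h. Qed.

Lemma ae_lin_dotD F f x y : ae_lin F -> H x -> H y -> sq f ->
  dot (F (x + y)) f = dot (F x) f + dot (F y) f.
Proof.
move=> LF Hx Hy sf; have [sF FD _] := LF.
rewrite -ipDl//; try exact: sF.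
apply: ae_eq_ip => //.
- by case: (sF _ (HD Hx Hy)).
- by apply: measurable_funD; [case: (sF _ Hx)|case: (sF _ Hy)].
- by case: sf.
- by case: sf.
- exact: FD.
- exact: aeW.
Qed.

Lemma ae_lin_dotZ F f c x : ae_lin F -> H x -> sq f -> dot (F (c *: x)) f = c * dot (F x) f.
Proof.
move=> LF Hx sf; have [sF _ FZ] := LF.
rewrite -ipZl//; last exact: sF.
apply: ae_eq_ip => //.
- by case: (sF _ (HZ c Hx)).
- by apply: measurable_funM => //; case: (sF _ Hx).
- by case: sf.
- by case: sf.
- exact: FZ.
- exact: aeW.
Qed.

Lemma ae_lin_form F : ae_lin F -> sym_form H (fun x y => dot (F x) (F y)).
Proof.
move=> LF; split=> [x y Hx Hy|x y z Hx Hy Hz|c x y Hx Hy].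
- by rewrite ipC.
- by rewrite ae_lin_dotD//; exact: ae_lin_sq.
- by rewrite ae_lin_dotZ//; exact: ae_lin_sq.
Qed.

Lemma sq_int_bounded_mul (w f : T -> R) (M : R) : measurable_fun D w ->
  {ae mu, forall t, D t -> `|w t| <= M} -> sq f -> sq (fun t => w t * f t).
Proof.
move=> mw wM sf; apply: (le_sq_int mD _ sf (c := M)).
  by apply: measurable_funM => //; case: sf.
by apply: filterS wM => t + Dt => /(_ Dt); rewrite normrM; exact: ler_wpM2r.
Qed.

Lemma nm_bounded_mul (w f : T -> R) (M : R) : 0 <= M -> measurable_fun D w ->
  {ae mu, forall t, D t -> `|w t| <= M} -> sq f ->
  nm mu D (fun t => w t * f t) <= M * nm mu D f.
Proof.
move=> M0 mw wM sf; apply: le_nm => //.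
  by apply: measurable_funM => //; case: sf.
by apply: filterS wM => t + Dt => /(_ Dt); rewrite normrM; exact: ler_wpM2r.
Qed.

Lemma ae_lin_mul (w : T -> R) (M : R) F : measurable_fun D w ->
  {ae mu, forall t, D t -> `|w t| <= M} -> ae_lin F -> ae_lin (fun x t => w t * F x t).
Proof.
move=> mw wM [sF FD FZ]; split=> [x Hx|x y Hx Hy|c x Hx].
- exact: sq_int_bounded_mul wM (sF _ Hx).
- by apply: filterS (FD _ _ Hx Hy) => t + Dt => ->//; rewrite mulrDr.
- by apply: filterS (FZ c _ Hx) => t + Dt => ->//; rewrite mulrCA.
Qed.

Lemma ae_linB F G : ae_lin F -> ae_lin G -> ae_lin (fun x t => F x t - G x t).
Proof.
move=> [sF FD FZ] [sG GD GZ]; split=> [x Hx|x y Hx Hy|c x Hx].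
- by apply: sq_intB => //; [exact: sF|exact: sG].
- by apply: filterS2 (FD _ _ Hx Hy) (GD _ _ Hx Hy) => t + + Dt => -> // ->//; rewrite opprD addrACA.
- by apply: filterS2 (FZ c _ Hx) (GZ c _ Hx) => t + + Dt => -> // ->//; rewrite mulrBr.
Qed.

End ae_linear_maps.

Lemma sum_bool_ord (R : realType) (n : nat) (x : R) :
  \sum_(b : bool) \sum_(i < n) x = 2 * n%:R * x.
Proof. by rewrite sumr_const card_bool sumr_const card_ord -mulrnA -[LHS]mulr_natl natrM (mulrC 2). Qed.

(* [Rcomplex R] is [R[i]] with its structure of real vector space. *)
Section H10_hilbert.
Context {R : realType} {n : nat}.
Local Notation mu := (lebesgue_rV R n.+1).
Local Notation E := ('rV[R]_n.+1 -> Rcomplex R).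
Variable D : set 'rV[R]_n.+1.
Hypotheses (mD : measurable D) (oD : open D) (fD : (mu D < +oo)%E).
Implicit Types (u v w h : E).
Local Notation sq := (sq_int mu D).
Local Notation dot := (ip mu D).
Local Notation nrm := (nm mu D).
Local Notation part b u := (fun r => cpart b (u r)).
Local Notation H := (in_H10 D : set E).

Lemma cpart_scale b c (z : Rcomplex R) : cpart b (c *: z) = c * cpart b z.
Proof. by case: b z => -[]. Qed.

Lemma H10_h10 u : H u -> h10 D u (grad D u).
Proof. by move=> /(in_H10P mD oD fD)[G uG]; exact: h10_grad uG. Qed.

Lemma H10_sq u b : H u -> sq (part b u).
Proof. by move=> /H10_h10/(_ b)[]. Qed.

Lemma H10_grad_sq u b i : H u -> sq (grad D u b i).
Proof. by move=> /H10_h10/(_ b)[_ + _]; exact. Qed.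

Lemma h10_scale u G c : h10 D u G -> h10 D (c *: u : E) (fun b i r => c * G b i r).
Proof.
move=> uG b; have := grad_relZ mD c (uG b).
by congr grad_rel; apply/funext => r; rewrite [in RHS]/= cpart_scale.
Qed.

Lemma H10_cscale u (c : R[i]) : in_H10 D u -> in_H10 D (fun r => c * u r).
Proof.
move=> Hu; have uG := h10Z mD c (H10_h10 Hu).
by apply/(in_H10P mD oD fD); eexists; exact: uG.
Qed.

Lemma H10_subspace : subspace H.
Proof.
split=> [u v /H10_h10 uG /H10_h10 vG|c u /H10_h10 uG]; apply/(in_H10P mD oD fD).
  by exists (fun b i r => grad D u b i r + grad D v b i r); exact: (h10D mD uG vG).
by exists (fun b i r => c * grad D u b i r); exact: h10_scale.
Qed.

Lemma part_ae_lin b : ae_lin mu D H (fun u r => cpart b (u r)).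
Proof.
split=> [u Hu|u v _ _|c u _]; first exact: H10_sq.
  by apply: aeW => r _; rewrite [in LHS]/= cpartD.
by apply: aeW => r _; rewrite [in LHS]/= cpart_scale.
Qed.

Lemma grad_ae_lin b i : ae_lin mu D H (fun u => grad D u b i).
Proof.
split=> [u Hu|u v Hu Hv|c u Hu]; first exact: H10_grad_sq.
  have := h10_grad_ae mD oD fD (h10D mD (H10_h10 Hu) (H10_h10 Hv)) b i.
  by apply: filterS => r + Dr => /(_ Dr) <-.
have := h10_grad_ae mD oD fD (h10_scale c (H10_h10 Hu)) b i.
by apply: filterS => r + Dr => /(_ Dr) <-.
Qed.

(** The products of H^1_0 as a real vector space. Imaginary parts of the complex products are
    recovered by replacing [v] with [i v]. *)
Definition re_L2 u v := complex.Re (L2_ip D u v).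
Definition re_H10 u v := complex.Re (H10_ip D u v).

Lemma re_L2E u v : H u -> H v -> re_L2 u v = \sum_(b : bool) dot (part b u) (part b v).
Proof.
move=> Hu Hv; rewrite /re_L2 L2_ipE//= ?big_bool 1?addrC// => b; exact: H10_sq.
Qed.

Lemma Re_sum (I : finType) (f : I -> R[i]) :
  complex.Re (\sum_i f i) = \sum_i complex.Re (f i).
Proof. by elim/big_rec2: _ => // i x z _ <-; case: (f i) z => ? ? []. Qed.

Lemma Im_sum (I : finType) (f : I -> R[i]) :
  complex.Im (\sum_i f i) = \sum_i complex.Im (f i).
Proof. by elim/big_rec2: _ => // i x z _ <-; case: (f i) z => ? ? []. Qed.

Lemma re_H10E u v : H u -> H v ->
  re_H10 u v = \sum_(b : bool) \sum_i dot (grad D u b i) (grad D v b i).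
Proof.
move=> Hu Hv; rewrite /re_H10 Re_sum exchange_big; apply: eq_bigr => i _.
by rewrite L2_ipE//= ?big_bool 1?addrC// => b; exact: H10_grad_sq.
Qed.

Lemma re_L2_form : sym_form H re_L2.
Proof.
apply: (@eq_sym_form _ _ _ (fun u v => \sum_(b : bool) dot (part b u) (part b v))).
- by move=> u v Hu Hv; rewrite re_L2E.
- exact: H10_subspace.
- by apply: sym_form_sum => b; apply: (ae_lin_form mD H10_subspace (part_ae_lin b)).
Qed.

Lemma re_H10_form : sym_form H re_H10.
Proof.
apply: (@eq_sym_form _ _ _ (fun u v => \sum_(b : bool) \sum_i dot (grad D u b i) (grad D v b i))).
- by move=> u v Hu Hv; rewrite re_H10E.
- exact: H10_subspace.
- apply: sym_form_sum => b; apply: sym_form_sum => i.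
  exact: (ae_lin_form mD H10_subspace (grad_ae_lin b i)).
Qed.

Lemma re_L2_ge0 u : H u -> 0 <= re_L2 u u.
Proof. by move=> Hu; rewrite re_L2E//; apply: sumr_ge0 => b _; exact: ip_ge0. Qed.

Lemma re_H10_ge0 u : H u -> 0 <= re_H10 u u.
Proof.
by move=> Hu; rewrite re_H10E//; do 2 (apply: sumr_ge0 => ? _); exact: ip_ge0.
Qed.

Lemma sqrt_re_H10 u : Num.sqrt (re_H10 u u) = H10_norm D u.
Proof. by []. Qed.

Lemma grad_nm_le u b i : H u -> nrm (grad D u b i) <= H10_norm D u.
Proof.
move=> Hu; rewrite -sqrt_re_H10 -[leLHS](ger0_norm (nm_ge0 _ _ _)) -sqrtr_sqr ler_wsqrtr// sqr_nm.
rewrite re_H10E// (bigD1 b)//= (bigD1 i)//=.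
rewrite -addrA lerDl addr_ge0//; first by apply: sumr_ge0 => j _; exact: ip_ge0.
by do 2 (apply: sumr_ge0 => ? _); exact: ip_ge0.
Qed.

(** The product is linear in its second argument, and [Re (i z) = - Im z]. This turns real
    representation results into complex ones. *)
Lemma Im_L2_ip (u v : 'rV[R]_n.+1 -> R[i]) : (forall b, sq (part b u)) -> (forall b, sq (part b v)) ->
  complex.Im (L2_ip D u v) = - complex.Re (L2_ip D u (fun r => 'i%C * v r)).
Proof.
move=> su sv; have s b : sq (fun r => cpart b ('i%C * v r)).
  case: b.
    rewrite (_ : (fun _ => _) = part false v)//; apply/funext => r.
    by rewrite /cpart Im_mul/= mul0r mul1r add0r.
  rewrite (_ : (fun _ => _) = fun r => - cpart true (v r)); first exact: sq_intN.
  by apply/funext => r; rewrite /cpart Re_mul/= mul0r mul1r add0r.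
rewrite !L2_ipE//=.
rewrite (_ : dot (part false u) (fun r => complex.Re ('i%C * v r)) = - dot (part false u) (part true v)).
  rewrite (_ : dot (part true u) (fun r => complex.Im ('i%C * v r)) = dot (part true u) (part false v)).
    by rewrite opprD opprK.
  by congr ip; apply/funext => r; rewrite Im_mul/= mul0r mul1r add0r.
rewrite -ipNr//; congr ip; apply/funext => r.
by rewrite Re_mul/= mul0r mul1r add0r.
Qed.

(** As for [Im_L2_ip], with the gradient selected for [i v] equal to [i] times that of [v] almost
    everywhere. *)
Lemma Im_H10_ip u v : H u -> H v ->
  complex.Im (H10_ip D u v) = - complex.Re (H10_ip D u (fun r => 'i%C * v r)).
Proof.
move=> Hu Hv; have vi := h10Z mD 'i%C (H10_h10 Hv).
have Hvi : H (fun r => 'i%C * v r) by exact: H10_cscale.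
rewrite -[complex.Re _]/(re_H10 _ _) re_H10E// Im_sum big_bool -big_split -sumrN.
apply: eq_bigr => i _; rewrite L2_ipE//=; try by move=> b; exact: H10_grad_sq.
have E b : dot (grad D u b i) (grad D (fun r => 'i%C * v r) b i) =
    dot (grad D u b i) (if b then grad D v false i else fun r => - grad D v true i r).
  apply: ae_eq_ip => //.
  - by case: (H10_grad_sq b i Hu).
  - by case: (H10_grad_sq b i Hu).
  - by case: (H10_grad_sq b i Hvi).
  - case: b; first by case: (H10_grad_sq false i Hv).
    by apply: measurableT_comp => //; case: (H10_grad_sq true i Hv).
  - exact: aeW.
  - have := h10_grad_ae mD oD fD vi b i; apply: filterS => r + Dr => /(_ Dr) <-.
    by case: b => /=; rewrite mul0r add0r ?mulN1r ?mul1r.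
rewrite (E true) (E false).
rewrite (ipNr mD (H10_grad_sq true i Hv) (H10_grad_sq false i Hu)).
by rewrite opprD opprK addrC.
Qed.

Variable M : R.
Hypotheses (M0 : 0 < M) (DM : D `<=` cbox (fun=> - M) (fun=> M)).

Lemma part_nm_le u b : H u -> nrm (part b u) <= 4 * M * H10_norm D u.
Proof.
move=> Hu; apply: le_trans (grad_rel_poincare mD M0 DM (H10_h10 Hu b)) _.
by rewrite ler_wpM2l ?grad_nm_le// mulr_ge0// ltW.
Qed.

(** The norm contains the gradients only; the Poincare inequality makes the functions themselves
    Cauchy in L^2, and the closed graph contains the limit. *)
Lemma re_H10_complete (F : nat -> E) : (forall k, H (F k)) ->
  (forall e : R, 0 < e -> exists N, forall j k, (N <= j)%N -> (N <= k)%N ->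
     re_H10 (F j - F k) (F j - F k) <= e) ->
  exists2 f, H f & forall e : R, 0 < e -> exists N, forall k, (N <= k)%N ->
     re_H10 (F k - f) (F k - f) <= e.
Proof.
move=> HF FC.
have gradB u v b i : H u -> H v ->
    {ae mu, forall r, D r -> grad D (u - v) b i r = grad D u b i r - grad D v b i r}.
  move=> Hu Hv; have [_ lD lZ] := grad_ae_lin b i.
  have HNv : H (-1 *: v) by have [_] := H10_subspace; apply.
  rewrite -scaleN1r; apply: filterS2 (lD _ _ Hu HNv) (lZ (-1) _ Hv) => r + + Dr.
  by move=> -> // ->//; rewrite mulN1r.
have nmB u v b i : H u -> H v ->
    nrm (grad D (u - v) b i) = nrm (fun r => grad D u b i r - grad D v b i r).
  move=> Hu Hv; apply: ae_eq_nm => //; last exact: gradB.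
    by case: (H10_grad_sq b i (subspaceB H10_subspace Hu Hv)).
  by apply: measurable_funB; [case: (H10_grad_sq b i Hu)|case: (H10_grad_sq b i Hv)].
have /choice[f /choice[G fG]] b : exists f G, [/\ grad_rel D f G,
    L2_cvg mu D (fun k r => cpart b (F k r)) f &
    forall i, L2_cvg mu D (fun k => grad D (F k) b i) (G i)].
  apply: (grad_rel_complete mD) => [k|e e0]; first exact: (H10_h10 (HF k) b).
  (* The first bound is for the gradients, the second for the functions after multiplication by the
     Poincare constant [4 * M]. *)
  pose e' := Num.min e (e / (4 * M)).
  have e'0 : 0 < e' by rewrite lt_min e0 divr_gt0// mulr_gt0.
  have [N NP] := FC _ (exprn_gt0 2 e'0); exists N => j k Nj Nk.
  have Hjk := subspaceB H10_subspace (HF j) (HF k).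
  have le : H10_norm D (F j - F k) <= e'.
    by rewrite -sqrt_re_H10 -[leRHS](ger0_norm (ltW e'0)) -sqrtr_sqr ler_wsqrtr// NP.
  split=> [|i].
    rewrite (_ : (fun r => _) = part b (F j - F k)); last first.
      by apply/funext => r; rewrite [in RHS]/= cpartB.
    apply: le_trans (part_nm_le b Hjk) _; rewrite mulrC -ler_pdivlMr ?mulr_gt0//.
    by apply: le_trans le _; rewrite ge_min lexx orbT.
  rewrite -(nmB _ _ b i (HF j) (HF k)); apply: le_trans (grad_nm_le b i Hjk) _.
  by apply: le_trans le _; rewrite ge_min lexx.
pose u : E := fun r => Complex (f false r) (f true r).
have uG : h10 D u G.
  move=> b; have [+ _ _] := fG b; congr grad_rel.
  by apply/funext => r; case: b.
have Hu : H u by apply/(in_H10P mD oD fD); exists G.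
exists u => // e e0.
(* The number of real components of the gradient, each of which receives the share [e / N] of the
   squared distance. *)
pose N : R := 2 * n.+1%:R.
have N0 : 0 < N by rewrite /N mulr_gt0// ltr0n.
pose e' := Num.sqrt (e / N).
have e'0 : 0 < e' by rewrite sqrtr_gt0 divr_gt0.
have NE : N * e' ^+ 2 = e.
  by rewrite (sqr_sqrtr (ltW (divr_gt0 e0 N0))) mulrC divfK// (gt_eqF N0).
have /choice[Nb NbP] (p : bool * 'I_n.+1) : exists K, forall k, (K <= k)%N ->
    nrm (fun r => grad D (F k) p.1 p.2 r - G p.1 p.2 r) <= e'.
  by have [_ _ /(_ p.2)/L2_cvgP] := fG p.1; apply.
exists (\max_p Nb p)%N => k Nk.
have HB := subspaceB H10_subspace (HF k) Hu; rewrite (re_H10E HB HB).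
apply: (@le_trans _ _ (\sum_(b : bool) \sum_(i < n.+1) e' ^+ 2)); last first.
  rewrite (_ : \sum_b _ = N * e' ^+ 2); first by rewrite NE.
  exact: sum_bool_ord.
apply: ler_sum => b _; apply: ler_sum => i _.
rewrite -sqr_nm (nmB _ _ b i (HF k) Hu) lerXn2r ?nnegrE ?nm_ge0 ?(ltW e'0)//.
rewrite (_ : nrm _ = nrm (fun r => grad D (F k) b i r - G b i r)).
  by apply: (NbP (b, i)); apply: leq_trans Nk; exact: (leq_bigmax (b, i)).
apply: ae_eq_nm => //.
- by apply: measurable_funB; [case: (H10_grad_sq b i (HF k))|case: (H10_grad_sq b i Hu)].
- apply: measurable_funB; first by case: (H10_grad_sq b i (HF k)).
  by have [_ /(_ i)[]] := uG b.
- by have := h10_grad_ae mD oD fD uG b i; apply: filterS => r + Dr => /(_ Dr) ->.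
Qed.

Lemma H10_riesz (l : E -> R) (C : R) : lin_form H l ->
  (forall u, H u -> `|l u| <= C * H10_norm D u) ->
  exists2 z, H z & forall h, H h -> re_H10 z h = l h.
Proof.
move=> ll lC; apply: (riesz H10_subspace re_H10_form re_H10_ge0 re_H10_complete _ ll lC).
exists 0; apply/(in_H10P mD oD fD); exists (fun _ _ => cst 0) => b.
have t0 := grad_rel_test mD (@test_fun0 R _ D).
have := grad_relZ mD 0 t0; congr grad_rel.
  by apply/funext => r; rewrite mul0r; case: b.
by apply/funext => i; apply/funext => r; rewrite mul0r.
Qed.

End H10_hilbert.

(** * The Green operator *)

Section green.
Context {R : realType} {n : nat}.
Local Notation mu := (lebesgue_rV R n.+2).
Local Notation E := ('rV[R]_n.+2 -> Rcomplex R).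
Variable D : set 'rV[R]_n.+2.
Hypotheses (mD : measurable D) (oD : open D) (fD : (mu D < +oo)%E).
Variable M : R.
Hypotheses (M0 : 0 < M) (DM : D `<=` cbox (fun=> - M) (fun=> M)).
Local Notation part b u := (fun r => cpart b (u r)).
Local Notation dot := (ip mu D).
Local Notation H := (in_H10 D : set E).

(** The real Riesz representative of [re_L2 D w], continuous by two uses of the Poincare inequality,
    gives the real part of the identity; testing with [i h] gives the imaginary part. The set behind
    [green] is thus inhabited. *)
Lemma greenP (w : E) : H w -> H (green D w : E) /\
  forall h, H h -> H10_ip D (green D w) h = L2_ip D w h.
Proof.
move=> Hw; suff [z Hz] : exists z : 'rV[R]_n.+2 -> R[i], in_H10 D z /\
    forall h, in_H10 D h -> H10_ip D z h = L2_ip D w h.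
  exact: (@xgetPex _ 0 [set z | in_H10 D z /\ forall h, in_H10 D h -> H10_ip D z h = L2_ip D w h] (ex_intro _ z Hz)).
have [||z Hz zP] := @H10_riesz R n.+1 D mD oD fD M M0 DM (re_L2 D w) (16 * M ^+ 2 * 2 * H10_norm D w).
- have := form_lin (H10_subspace mD oD fD) (re_L2_form mD oD fD) Hw.
  by [].
- move=> u Hu; rewrite (re_L2E mD oD fD)// big_bool; apply: le_trans (ler_normD _ _) _.
  have b1 b : `|dot (part b w) (part b u)| <= (4 * M * H10_norm D w) * (4 * M * H10_norm D u).
    apply: le_trans (ip_CS mD (H10_sq mD oD fD b Hw) (H10_sq mD oD fD b Hu)) _.
    by apply: ler_pM; rewrite ?nm_ge0// (part_nm_le mD oD fD M0 DM).
  apply: le_trans (lerD (b1 true) (b1 false)) _.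
  move: (H10_norm D w) (H10_norm D u) => x y.
  by rewrite le_eqVlt; apply/orP; left; apply/eqP; ring.
exists z; split=> // h Hh; apply: complex_eq => -[]; last exact: zP.
have Hih : H (fun r => 'i%C * h r) by exact: H10_cscale.
rewrite /cpart (Im_H10_ip mD oD fD)// (Im_L2_ip mD); try by move=> b; exact: (H10_sq mD oD fD).
by congr (- _); exact: zP.
Qed.

End green.

(** * The Gross-Pitaevskii energy *)

Section has_integral.
Context {d : measure_display} {T : measurableType d} {R : realType}.
Variables (mu : {measure set T -> \bar R}) (D : set T).
Hypothesis mD : measurable D.
Implicit Types f g : T -> R.

(** Integrability is carried along with the value, because the value of the integral of a sum or a
    multiple is computed from integrable terms. *)
Definition has_int f (x : R) := mu.-integrable D (EFin \o f) /\ \int[mu]_(t in D) f t = x.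

Lemma has_int_mul f g : sq_int mu D f -> sq_int mu D g ->
  has_int (fun t => f t * g t) (ip mu D f g).
Proof. by move=> sf sg; split; [exact: sq_int_integrable_mul|rewrite ipE]. Qed.

Lemma has_intD f g x y : has_int f x -> has_int g y -> has_int (fun t => f t + g t) (x + y).
Proof.
move=> [iF <-] [iG <-]; split; last by rewrite -RintegralD.
by have := integrableD mD iF iG; apply: eq_integrable.
Qed.

Lemma has_intZ c f x : has_int f x -> has_int (fun t => c * f t) (c * x).
Proof.
move=> [iF <-]; split; last by rewrite -RintegralZl.
by have := integrableZl mD c iF; apply: eq_integrable.
Qed.

Lemma has_intB f g x y : has_int f x -> has_int g y -> has_int (fun t => f t - g t) (x - y).
Proof.
move=> iF iG; have := has_intD iF (has_intZ (-1) iG); rewrite mulN1r.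
by congr has_int; apply/funext => t; rewrite mulN1r.
Qed.

Lemma has_int_sum (I : finType) (F : I -> T -> R) (x : I -> R) :
  (forall i, has_int (F i) (x i)) -> has_int (fun t => \sum_i F i t) (\sum_i x i).
Proof.
move=> iF; elim: (index_enum I) => [|i s IH].
  rewrite big_nil (_ : (fun t => _) = fun=> 0); last by apply/funext => t; rewrite big_nil.
  split; last by rewrite /Rintegral; under eq_integral do []; rewrite integral0.
  exact: integrable0.
rewrite big_cons (_ : (fun t => _) = fun t => F i t + \sum_(j <- s) F j t).
  exact: has_intD.
by apply/funext => t; rewrite big_cons.
Qed.

Lemma has_int_ge0 f x : has_int f x -> {ae mu, forall t, D t -> 0 <= f t} -> 0 <= x.
Proof.
move=> [iF <-] f0; rewrite /Rintegral fine_ge0//.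
have mf := measurable_int _ iF.
rewrite (_ : (\int[mu]_(t in D) _)%E = (\int[mu]_(t in D) (Num.max (f t) 0)%:E)%E).
  by apply: integral_ge0 => t _; rewrite lee_fin le_max lexx orbT.
apply: ae_eq_integral => //.
- apply/measurable_EFinP; apply: measurable_maxr; last exact: measurable_cst.
  exact/measurable_EFinP.
- by apply: filterS f0 => t + Dt => /(_ Dt) f0; rewrite /= max_l.
Qed.

End has_integral.

Lemma le_of_sqr (R : realDomainType) (x y : R) : 0 <= y -> x ^+ 2 <= y ^+ 2 -> x <= y.
Proof.
move=> y0 xy; apply: le_trans (ler_norm x) _.
by rewrite -(@ler_pXn2r _ 2)// ?nnegrE// -normrX ger0_norm// sqr_ge0.
Qed.

Lemma double_le (R : realFieldType) (l x : R) : l * x + l * x <= 2 * l * x.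
Proof. by lra. Qed.

(** Here [x] and [y] are the norms of the base point and of the increment. Since
    [4 x y^3 <= 2 x^2 y^2 + 2 y^4], the left side is at most [l^2 (32 x^2 y^2 + 12 y^4)]. *)
Lemma quartic_arith (R : realFieldType) (A B C G l x y : R) :
  `|G| <= 4 * l ^+ 2 * (y * y * (y * y)) -> `|C| <= 4 * l ^+ 2 * (x * y * (y * y)) ->
  `|B| <= 4 * l ^+ 2 * (x * x * (y * y)) -> `|A| <= 4 * l ^+ 2 * (x * y * (x * y)) ->
  4 * A + 2 * B + 4 * C + G <= 48 * l ^+ 2 * (x ^+ 2 * y ^+ 2 + (y ^+ 2) ^+ 2).
Proof.
move=> /(le_trans (ler_norm _)) hG /(le_trans (ler_norm _)) hC.
move=> /(le_trans (ler_norm _)) hB /(le_trans (ler_norm _)) hA.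
have := mulr_ge0 (sqr_ge0 l) (mulr_ge0 (sqr_ge0 y) (sqr_ge0 (x - y))).
have := mulr_ge0 (sqr_ge0 l) (mulr_ge0 (sqr_ge0 x) (sqr_ge0 y)).
have := mulr_ge0 (sqr_ge0 l) (mulr_ge0 (sqr_ge0 y) (sqr_ge0 y)).
lra.
Qed.

(** Equality of the energy densities at a point: [a] and [b] are the parts of [u], [S1] and [S2] the
    squared gradients of these parts, [w0] and [w1] the parts of the rotational derivative. *)
Lemma energy_arith (R : realFieldType) (S1 S2 V a b w1 w0 Omega beta : R) :
  2^-1 * (S1 + S2) + 2^-1 * V * (a ^+ 2 + b ^+ 2) + beta / 4 * (a ^+ 2 + b ^+ 2) ^+ 2 -
    Omega / 2 * (w1 * a - w0 * b) =
  2^-1 * (S1 + S2 + (V * a * a + V * b * b + - Omega * (w1 * a - w0 * b))) +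
    beta / 4 * ((a * a + b * b) * (a * a + b * b)).
Proof. by field. Qed.

Lemma energy_deriv_arith (R : realFieldType) (V a b c d w1 w0 Omega beta : R) :
  (V * a * c + V * b * d) + beta * (a ^+ 2 + b ^+ 2) * (a * c + b * d) -
    Omega * (w1 * c - w0 * d) =
  (V * a * c + V * b * d) + - Omega * (w1 * c - w0 * d) +
    beta * ((a * a + b * b) * (a * c + b * d)).
Proof. by ring. Qed.

Lemma add_arith (R : realFieldType) (a1 a2 q1 q2 t1 t2 beta : R) :
  a1 + a2 + (q1 + q2) + beta * (t1 + t2) = a1 + q1 + beta * t1 + (a2 + q2 + beta * t2).
Proof. by ring. Qed.

Lemma scale_arith (R : realFieldType) (a q t beta c : R) :
  c * a + c * q + beta * (c * t) = c * (a + q + beta * t).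
Proof. by ring. Qed.

Section gross_pitaevskii.
Context {R : realType} {n : nat}.
Local Notation mu := (lebesgue_rV R n.+2).
Local Notation E := ('rV[R]_n.+2 -> Rcomplex R).
Variable D : set 'rV[R]_n.+2.
Hypotheses (mD : measurable D) (oD : open D) (fD : (mu D < +oo)%E).
Variable M : R.
Hypotheses (M0 : 0 < M) (DM : D `<=` cbox (fun=> - M) (fun=> M)).
Variables (V : 'rV[R]_n.+2 -> R) (beta Omega K MV : R).
Hypothesis mV : measurable_fun D V.
Hypothesis MV0 : 0 <= MV.
Hypothesis VM : {ae mu, forall r, D r -> `|V r| <= MV}.
Hypotheses (beta0 : 0 <= beta) (Omega0 : 0 <= Omega) (K0 : 0 < K).
Hypothesis V_lower : {ae mu, forall r, D r ->
  (1 + K) / 4 * Omega ^+ 2 * ((r 0 0) ^+ 2 + (r 0 1) ^+ 2) <= V r}.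
Hypothesis hn : n.+2 = 2%N \/ n.+2 = 3%N.
Implicit Types (u v w h : E).
Local Notation sq := (sq_int mu D).
Local Notation dot := (ip mu D).
Local Notation nrm := (nm mu D).
Local Notation part b u := (fun r => cpart b (u r)).
Local Notation H := (in_H10 D : set E).
Local Notation sa u := (H10_norm D u).

Let HS := H10_subspace mD oD fD.
Let Hsq u b (Hu : H u) : sq (part b u) := H10_sq mD oD fD b Hu.
Let Hgsq u b i (Hu : H u) : sq (grad D u b i) := H10_grad_sq mD oD fD b i Hu.
Let sa_ge0 u : 0 <= sa u. Proof. exact: sqrtr_ge0. Qed.
Let pnm u b (Hu : H u) : nrm (part b u) <= 4 * M * sa u := part_nm_le mD oD fD M0 DM b Hu.

Lemma measurable_coord (i : 'I_n.+2) : measurable_fun D (fun r : 'rV[R]_n.+2 => r 0 i).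
Proof. by apply: measurable_funTS; exact: measurable_rV_coord. Qed.

Lemma coord_le (i : 'I_n.+2) : {ae mu, forall r, D r -> `|r 0 i| <= M}.
Proof. by apply: aeW => r /DM/(_ i); rewrite ler_norml. Qed.

(** Part [b] of [i * Lz u], that is of the derivative of [u] along rotations of the first two
    coordinates. *)
Definition rotgrad (b : bool) (u : E) : 'rV[R]_n.+2 -> R :=
  fun r => r 0 0 * grad D u b 1 r - r 0 1 * grad D u b 0 r.

Lemma rotgrad_lin b : ae_lin mu D H (rotgrad b).
Proof.
have lin i j : ae_lin mu D H (fun u r => r 0 i * grad D u b j r).
  apply: (ae_lin_mul mD (measurable_coord i) (coord_le i)).
  exact: grad_ae_lin.
exact: (ae_linB mD (lin 0 1) (lin 1 0)).
Qed.

Lemma rotgrad_sq b u : H u -> sq (rotgrad b u).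
Proof. exact: ae_lin_sq (rotgrad_lin b). Qed.

Let coord_sq i (f : 'rV[R]_n.+2 -> R) : sq f -> sq (fun r => r 0 i * f r).
Proof. exact: (sq_int_bounded_mul mD (measurable_coord i) (coord_le i)). Qed.

Lemma rotgrad_nm b u : H u -> nrm (rotgrad b u) <= 2 * M * sa u.
Proof.
move=> Hu; have s i j := coord_sq i (Hgsq b j Hu).
rewrite /rotgrad; apply: le_trans (nmD mD (s 0 1) (sq_intN mD (s 1 0))) _.
have le i j : nrm (fun r => r 0 i * grad D u b j r) <= M * sa u.
  apply: le_trans (nm_bounded_mul mD (ltW M0) (measurable_coord i) (coord_le i) (Hgsq b j Hu)) _.
  by apply: ler_wpM2l; [exact: ltW|exact: (grad_nm_le mD oD fD)].
rewrite nmN; apply: le_trans (lerD (le 0 1) (le 1 0)) _.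
by move: (sa u) => x; lra.
Qed.

(** Skew-symmetry of the rotational derivative: each coordinate multiplies the derivative in the
    other direction, so [grad_rel_ip_coord] applies to both terms. *)
Lemma dot_rotgrad b b' u v : H u -> H v ->
  dot (rotgrad b u) (part b' v) = - dot (part b u) (rotgrad b' v).
Proof.
move=> Hu Hv; have uG := H10_h10 mD oD fD Hu b; have vG := H10_h10 mD oD fD Hv b'.
have := grad_rel_ip_coord (i := 1) (j := 0) mD isT DM uG vG.
have := grad_rel_ip_coord (i := 0) (j := 1) mD isT DM uG vG.
have move_coord i (f g : 'rV[R]_n.+2 -> R) : dot (fun r => r 0 i * f r) g = dot f (fun r => r 0 i * g r).
  by rewrite !ipE; apply: eq_Rintegral => r _; rewrite mulrCA mulrA.
rewrite !(move_coord _ (fun r => cpart b (u r))) => e1 e2.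
have s w c (Hw : H w) i j := coord_sq i (Hgsq c j Hw).
have e3 : dot (part b u) (rotgrad b' v) = _ := ipBr mD (s v b' Hv 0 1) (s v b' Hv 1 0) (Hsq b Hu).
have e4 : dot (rotgrad b u) (part b' v) = _ := ipBl mD (s u b Hu 0 1) (s u b Hu 1 0) (Hsq b' Hv).
have ar (p q A B X Y : R) : p = A - B -> q = X - Y -> Y = - B -> X = - A -> p = - q.
  by move=> -> -> -> ->; ring.
exact: ar e4 e3 e1 e2.
Qed.

(** The real part of the L^2 product of [Lz u] and [v], as [- i] turns [W0 + i W1] into [W1 - i W0].
    This exchange of the parts, with its sign, makes a symmetric form out of a skew derivative. *)
Definition rot_form u v : R :=
  dot (rotgrad true u) (part false v) - dot (rotgrad false u) (part true v).

Lemma rot_form_sym : sym_form H rot_form.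
Proof.
have L b := rotgrad_lin b.
split=> [u v Hu Hv|u v w Hu Hv Hw|c u v Hu Hv]; rewrite /rot_form.
- rewrite (dot_rotgrad true false Hu Hv) (dot_rotgrad false true Hu Hv).
  by rewrite (ipC _ _ (part true u)) (ipC _ _ (part false u)) opprK addrC.
- rewrite (ae_lin_dotD mD HS (L true) Hu Hv (Hsq false Hw)).
  rewrite (ae_lin_dotD mD HS (L false) Hu Hv (Hsq true Hw)).
  by rewrite opprD addrACA.
- rewrite (ae_lin_dotZ mD HS c (L true) Hu (Hsq false Hv)).
  rewrite (ae_lin_dotZ mD HS c (L false) Hu (Hsq true Hv)).
  by rewrite mulrBr.
Qed.

Lemma rot_form_le u v : H u -> H v -> `|rot_form u v| <= 16 * M ^+ 2 * (sa u * sa v).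
Proof.
move=> Hu Hv; apply: le_trans (ler_normB _ _) _.
have le b b' : `|dot (rotgrad b u) (part b' v)| <= (2 * M * sa u) * (4 * M * sa v).
  apply: le_trans (ip_CS mD (rotgrad_sq b Hu) (Hsq b' Hv)) _.
  by apply: ler_pM; rewrite ?nm_ge0// ?rotgrad_nm// pnm.
apply: le_trans (lerD (le _ _) (le _ _)) _.
move: (sa u) (sa v) => x y.
by rewrite le_eqVlt; apply/orP; left; apply/eqP; ring.
Qed.

Definition potential_form u v : R := \sum_(b : bool) dot (fun r => V r * cpart b (u r)) (part b v).

Let potential_sq b u (Hu : H u) : sq (fun r => V r * cpart b (u r)).
Proof. exact: (sq_int_bounded_mul mD mV VM (Hsq b Hu)). Qed.

Lemma potential_form_sym : sym_form H potential_form.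
Proof.
apply: sym_form_sum => b.
have L : ae_lin mu D H (fun u r => V r * cpart b (u r)).
  by apply: (ae_lin_mul mD mV VM); exact: part_ae_lin.
split=> [u v Hu Hv|u v w Hu Hv Hw|c u v Hu Hv].
- by rewrite !ipE; apply: eq_Rintegral => r _; ring.
- exact: (ae_lin_dotD mD HS L Hu Hv (Hsq b Hw)).
- have e := ae_lin_dotZ mD HS c L Hu (Hsq b Hv); exact: e.
Qed.

Lemma potential_form_le u v : H u -> H v -> `|potential_form u v| <= 32 * M ^+ 2 * MV * (sa u * sa v).
Proof.
move=> Hu Hv; rewrite /potential_form big_bool; apply: le_trans (ler_normD _ _) _.
have le b : `|dot (fun r => V r * cpart b (u r)) (part b v)| <= MV * (4 * M * sa u) * (4 * M * sa v).
  apply: le_trans (ip_CS mD (potential_sq b Hu) (Hsq b Hv)) _.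
  apply: ler_pM; rewrite ?nm_ge0// ?pnm//.
  apply: le_trans (nm_bounded_mul mD MV0 mV VM (Hsq b Hu)) _.
  by rewrite ler_wpM2l// pnm.
apply: le_trans (lerD (le _) (le _)) _.
move: (sa u) (sa v) => x y.
by rewrite le_eqVlt; apply/orP; left; apply/eqP; ring.
Qed.

Definition quad_form u v : R := potential_form u v + (- Omega) * rot_form u v.

Lemma quad_form_sym : sym_form H quad_form.
Proof. by apply: sym_formD; [exact: potential_form_sym|apply: sym_formZ; exact: rot_form_sym]. Qed.

Lemma quad_form_le u v : H u -> H v ->
  `|quad_form u v| <= (32 * M ^+ 2 * MV + Omega * (16 * M ^+ 2)) * (sa u * sa v).
Proof.
move=> Hu Hv; apply: le_trans (ler_normD _ _) _; rewrite mulrDl; apply: lerD.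
  exact: potential_form_le.
by rewrite normrM normrN (ger0_norm Omega0) -mulrA ler_wpM2l// rot_form_le.
Qed.

(* Pointwise, [(1 + K) * Omega * W * c <= G0^2 + G1^2 + ((1 + K) / 2 * Omega * c)^2 * (x^2 + y^2)]
   with [W = x G1 - y G0], as the difference is
   [(G1 - x X)^2 + (G0 + y X)^2] for [X = (1 + K) / 2 * Omega * c]. *)
Lemma coercive_arith (x y G0 G1 c Vr : R) :
  (1 + K) / 4 * Omega ^+ 2 * (x ^+ 2 + y ^+ 2) <= Vr ->
  Omega * ((x * G1 - y * G0) * c) <= (1 + K)^-1 * (G0 * G0 + G1 * G1) + Vr * c * c.
Proof.
move=> Vle; have s0 : 0 < 1 + K by rewrite ltr_wpDl.
have Vc : (1 + K) / 4 * Omega ^+ 2 * (x ^+ 2 + y ^+ 2) * c ^+ 2 <= Vr * c * c.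
  by rewrite -[leRHS]mulrA -expr2 ler_wpM2r// sqr_ge0.
apply: le_trans (lerD (lexx _) Vc).
pose X := (1 + K) / 2 * Omega * c.
rewrite -subr_ge0.
rewrite (_ : _ - _ = (1 + K)^-1 * ((G1 - x * X) ^+ 2 + (G0 + y * X) ^+ 2)).
  by rewrite mulr_ge0 ?invr_ge0 ?(ltW s0)// addr_ge0 ?sqr_ge0.
by rewrite /X; field; rewrite gt_eqF.
Qed.

(** [rot_form] pairs the gradient of each part with the other part, with opposite signs. The sign
    [e] is moved into the value [c] of [coercive_arith], where only its square survives. Adding the
    two halves uses each gradient and each potential term once. *)
Lemma coercive_half e u b b' : e ^+ 2 = 1 -> H u ->
  e * Omega * dot (rotgrad b u) (part b' u) <=
  (1 + K)^-1 * (\sum_i dot (grad D u b i) (grad D u b i)) +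
  dot (fun r => V r * cpart b' (u r)) (part b' u).
Proof.
move=> e1 Hu.
apply: (@le_trans _ _ ((1 + K)^-1 * (dot (grad D u b 0) (grad D u b 0) +
    dot (grad D u b 1) (grad D u b 1)) + dot (fun r => V r * cpart b' (u r)) (part b' u))); last first.
  rewrite lerD2r ler_wpM2l ?invr_ge0 ?addr_ge0 ?(ltW K0)//.
  rewrite (bigD1 0)//= lerD2l (bigD1 1)//= lerDl.
  by apply: sumr_ge0 => i _; exact: ip_ge0.
rewrite -subr_ge0.
have I1 := has_int_mul mD (rotgrad_sq b Hu) (Hsq b' Hu).
have I2 i := has_int_mul mD (Hgsq b i Hu) (Hgsq b i Hu).
have I3 := has_int_mul mD (potential_sq b' Hu) (Hsq b' Hu).
have I := has_intB mD (has_intD mD (has_intZ mD (1 + K)^-1 (has_intD mD (I2 0) (I2 1))) I3)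
  (has_intZ mD (e * Omega) I1).
apply: (has_int_ge0 mD I); apply: filterS V_lower => r + Dr => /(_ Dr) Vr.
have ar (W c : R) : e * Omega * (W * c) = Omega * (W * (e * c)) by ring.
have ar2 (w c : R) : w * (e * c) * (e * c) = w * c * c.
  by rewrite -[RHS]mulr1 -e1; ring.
rewrite subr_ge0 ar; have := coercive_arith (grad D u b 0 r) (grad D u b 1 r) (e * cpart b' (u r)) Vr.
by rewrite ar2.
Qed.

Lemma quad_form_coercive u : H u ->
  K / (1 + K) * re_H10 D u u <= re_H10 D u u + quad_form u u.
Proof.
move=> Hu; rewrite (re_H10E mD oD fD)// /quad_form /rot_form /potential_form !big_bool.
have ar (S1 S2 P1 P2 A B : R) : 1 * Omega * A <= (1 + K)^-1 * S1 + P2 ->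
    -1 * Omega * B <= (1 + K)^-1 * S2 + P1 ->
    K / (1 + K) * (S1 + S2) <= S1 + S2 + (P1 + P2 + - Omega * (A - B)).
  rewrite (_ : K / (1 + K) = 1 - (1 + K)^-1); first lra.
  by field; rewrite gt_eqF// ltr_wpDl.
apply: ar; first exact: (coercive_half true false (expr1n _ _) Hu).
by apply: (coercive_half false true _ Hu); rewrite sqrrN expr1n.
Qed.

(** * The quartic term *)

Variable L4 : R.
Hypotheses (L4_ge0 : 0 <= L4) (L4E : L4 ^+ 2 = 64 * M ^+ 2 + 16 * M).

(** [L4] is the square root of the constant of [test_fun_exp4]: the L^2 norm of a square is the
    square of an L^4 norm. *)
Lemma sqr_part_sq b u : H u ->
  sq (fun r => cpart b (u r) ^+ 2) /\ nrm (fun r => cpart b (u r) ^+ 2) <= L4 * sa u ^+ 2.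
Proof.
move=> Hu; pose C : R := 64 * M ^+ 2 + 16 * M.
have C0 : 0 <= C by rewrite addr_ge0 ?mulr_ge0 ?sqr_ge0// ltW.
have uG := H10_h10 mD oD fD Hu b.
have e4 := grad_rel_exp4 mD C0
  (fun phi => @test_fun_exp4 R M M0 n D phi hn mD DM) uG.
have mu2 : measurable_fun D (fun r => cpart b (u r) ^+ 2).
  by apply: measurable_funX; case: (Hsq b Hu).
have S : sq (fun r => cpart b (u r) ^+ 2).
  split=> //; under eq_integral do rewrite -exprM.
  by apply: le_lt_trans e4 _; rewrite ltry.
split; first by [].
apply: le_of_sqr; first exact: mulr_ge0 L4_ge0 (sqr_ge0 _).
rewrite sqr_nm exprMn L4E -lee_fin -(integral_sqr_ip mD S).
under eq_integral do rewrite -exprM.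
apply: le_trans e4 _; rewrite lee_fin ler_wpM2l// lerXn2r ?nnegrE ?sqr_ge0 ?grad_sqr_ge0//.
rewrite /H10_norm -/(re_H10 D u u) sqr_sqrtr; last exact: (re_H10_ge0 mD oD fD).
rewrite (re_H10E mD oD fD)// (bigD1 b)//= /grad_sqr.
under [leLHS]eq_bigr do rewrite sqr_nm.
by rewrite lerDl; do 2 (apply: sumr_ge0 => ? _); exact: ip_ge0.
Qed.

(** The Cauchy-Schwarz inequality applied to the two squares, which [sqr_part_sq] places in L^2. *)
Lemma mul_part_sq b b' u v : H u -> H v ->
  sq (fun r => cpart b (u r) * cpart b' (v r)) /\
  nrm (fun r => cpart b (u r) * cpart b' (v r)) <= L4 * (sa u * sa v).
Proof.
move=> Hu Hv; have [su nu] := sqr_part_sq b Hu; have [sv nv] := sqr_part_sq b' Hv.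
have [mu1 _] := Hsq b Hu; have [mv1 _] := Hsq b' Hv.
have S : sq (fun r => cpart b (u r) * cpart b' (v r)).
  apply: integrable_sq_int; first exact: measurable_funM.
  have := sq_int_integrable_mul mD su sv; apply: eq_integrable => // r _ /=.
  by rewrite exprMn.
split; first by [].
apply: le_of_sqr; first exact: mulr_ge0 L4_ge0 (mulr_ge0 (sa_ge0 u) (sa_ge0 v)).
rewrite sqr_nm (_ : dot _ _ = dot (fun r => cpart b (u r) ^+ 2) (fun r => cpart b' (v r) ^+ 2)).
  apply: le_trans (ler_norm _) _; apply: le_trans (ip_CS mD su sv) _.
  rewrite !exprMn; move: nu nv.
  move: (nm_ge0 mu D (fun r => cpart b (u r) ^+ 2)) (nm_ge0 mu D (fun r => cpart b' (v r) ^+ 2)).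
  move=> x0 y0 nu nv; apply: le_trans (ler_pM x0 y0 nu nv) _.
  by rewrite mulrACA -expr2.
by rewrite !ipE; apply: eq_Rintegral => r _; ring.
Qed.

Definition dotp u v (r : 'rV[R]_n.+2) : R :=
  cpart false (u r) * cpart false (v r) + cpart true (u r) * cpart true (v r).

Lemma dotp_sq u v : H u -> H v -> sq (dotp u v).
Proof.
move=> Hu Hv; have [s1 _] := mul_part_sq false false Hu Hv.
by have [s2 _] := mul_part_sq true true Hu Hv; exact: sq_intD.
Qed.

Lemma dotp_nm u v : H u -> H v -> nrm (dotp u v) <= 2 * L4 * (sa u * sa v).
Proof.
move=> Hu Hv; have [s1 n1] := mul_part_sq false false Hu Hv.
have [s2 n2] := mul_part_sq true true Hu Hv.
apply: le_trans (nmD mD s1 s2) _; apply: le_trans (lerD n1 n2) _.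
exact: double_le.
Qed.

Lemma dotpDr u v w : dotp u (v + w) = fun r => dotp u v r + dotp u w r.
Proof. by apply/funext => r; rewrite /dotp !cpartD !mulrDr addrACA. Qed.

Lemma dotpZr c u v : dotp u (c *: v) = fun r => c * dotp u v r.
Proof. by apply/funext => r; rewrite /dotp !cpart_scale mulrDr !(mulrCA c). Qed.

(** The fourth power of the L^4 norm; [quartic_deriv u] is a quarter of its derivative at [u]. *)
Definition quartic u : R := dot (dotp u u) (dotp u u).
Definition quartic_deriv u v : R := dot (dotp u u) (dotp u v).

Lemma quartic_ge0 u : 0 <= quartic u. Proof. exact: ip_ge0. Qed.

Lemma dotp_dot_le u1 u2 v1 v2 : H u1 -> H u2 -> H v1 -> H v2 ->
  `|dot (dotp u1 u2) (dotp v1 v2)| <= 4 * L4 ^+ 2 * (sa u1 * sa u2 * (sa v1 * sa v2)).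
Proof.
move=> Hu1 Hu2 Hv1 Hv2.
apply: le_trans (ip_CS mD (dotp_sq Hu1 Hu2) (dotp_sq Hv1 Hv2)) _.
apply: le_trans (ler_pM (nm_ge0 _ _ _) (nm_ge0 _ _ _) (dotp_nm Hu1 Hu2) (dotp_nm Hv1 Hv2)) _.
move: (L4) (sa u1) (sa u2) (sa v1) (sa v2) => l a b c d.
by rewrite le_eqVlt; apply/orP; left; apply/eqP; ring.
Qed.

Lemma quartic_deriv_le u v : H u -> H v ->
  `|quartic_deriv u v| <= 4 * L4 ^+ 2 * (sa u ^+ 3 * sa v).
Proof. move=> Hu Hv; rewrite (_ : sa u ^+ 3 * sa v = sa u * sa u * (sa u * sa v)).
  exact: dotp_dot_le.
by rewrite !exprS expr0 mulr1 !mulrA. Qed.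

Lemma quartic_deriv_lin u : H u -> lin_form H (quartic_deriv u).
Proof.
move=> Hu; have su := dotp_sq Hu Hu; rewrite /quartic_deriv; split=> [v w Hv Hw|c v Hv].
  by rewrite dotpDr; exact: (ipDr mD (dotp_sq Hu Hv) (dotp_sq Hu Hw) su).
by rewrite dotpZr; exact: (ipZr mD c (dotp_sq Hu Hv) su).
Qed.

Lemma quarticZ c u : H u -> quartic (c *: u) = c ^+ 4 * quartic u.
Proof.
move=> Hu; have su := dotp_sq Hu Hu; rewrite /quartic.
rewrite (_ : dotp (c *: u) (c *: u) = fun r => c ^+ 2 * dotp u u r).
  by rewrite (ipZl mD _ su (sq_intZ mD _ su)) (ipZr mD _ su su) mulrA -exprD.
by apply/funext => r; rewrite /dotp !cpart_scale; ring.
Qed.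

(** Pointwise [|u + w|^2 = f + g], with [f] its part affine in [w] and [g = |w|^2]. Squaring leaves,
    besides the value and the derivative at [u], four terms at least quadratic in [w], which
    [dotp_dot_le] and [quartic_arith] bound. *)
Lemma quartic_expand u w : H u -> H w ->
  quartic (u + w) <= quartic u + 4 * quartic_deriv u w +
    48 * L4 ^+ 2 * (re_H10 D u u * re_H10 D w w + re_H10 D w w ^+ 2).
Proof.
move=> Hu Hw; have suu := dotp_sq Hu Hu; have suw := dotp_sq Hu Hw; have sww := dotp_sq Hw Hw.
pose f r := dotp u u r + 2 * dotp u w r; pose g := dotp w w.
have sf : sq f := sq_intD mD suu (sq_intZ mD 2 suw).
have fE (k : 'rV[R]_n.+2 -> R) : sq k -> dot f k = dot (dotp u u) k + 2 * dot (dotp u w) k.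
  by move=> sh; rewrite (ipDl mD suu (sq_intZ mD 2 suw) sh) (ipZl mD 2 suw sh).
have E1 : quartic (u + w) = dot (dotp u u) (dotp u u) + 4 * dot (dotp u u) (dotp u w) +
    (4 * dot (dotp u w) (dotp u w) + 2 * dot (dotp u u) (dotp w w) +
     4 * dot (dotp u w) (dotp w w) + dot (dotp w w) (dotp w w)).
  rewrite /quartic (_ : dotp (u + w) (u + w) = fun r => f r + g r); last first.
    by apply/funext => r; rewrite /f /g /dotp !cpartD; ring.
  have e := ipDl mD sf sww (sq_intD mD sf sww); rewrite [LHS]e {e}.
  have e := ipDr mD sf sww sf; rewrite [X in X + _]e {e}.
  have e := ipDr mD sf sww sww; rewrite [X in _ + X]e {e}.
  have c1 : dot f f = dot (dotp u u) f + 2 * dot (dotp u w) f := fE _ sf.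
  have c2 : dot f g = dot (dotp u u) (dotp w w) + 2 * dot (dotp u w) (dotp w w) := fE _ sww.
  have c3 : dot (dotp u u) f = dot f (dotp u u) := ipC _ _ _ _.
  have c4 : dot (dotp u w) f = dot f (dotp u w) := ipC _ _ _ _.
  have c5 : dot (dotp w w) f = dot f g := ipC _ _ _ _.
  have c6 : dot f (dotp u u) = dot (dotp u u) (dotp u u) + 2 * dot (dotp u w) (dotp u u) := fE _ suu.
  have c7 : dot f (dotp u w) = dot (dotp u u) (dotp u w) + 2 * dot (dotp u w) (dotp u w) := fE _ suw.
  have c8 : dot (dotp u w) (dotp u u) = dot (dotp u u) (dotp u w) := ipC _ _ _ _.
  have ar (F FG GF GG U UW W2 UF WF FU FW WU UV WV : R) : F = UF + 2 * WF -> FG = UV + 2 * WV ->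
      UF = FU -> WF = FW -> GF = FG -> FU = U + 2 * WU -> FW = UW + 2 * W2 -> WU = UW ->
      F + FG + (GF + GG) = U + 4 * UW + (4 * W2 + 2 * UV + 4 * WV + GG).
    by move=> -> -> -> -> -> -> -> ->; ring.
  exact: ar c1 c2 c3 c4 c5 c6 c7 c8.
rewrite E1 lerD2l.
have sE x : H x -> re_H10 D x x = sa x ^+ 2.
  by move=> Hx; rewrite /H10_norm -/(re_H10 D x x) sqr_sqrtr// (re_H10_ge0 mD oD fD).
rewrite !sE//.
have := dotp_dot_le Hu Hw Hu Hw; have := dotp_dot_le Hu Hu Hw Hw.
have := dotp_dot_le Hu Hw Hw Hw; have := dotp_dot_le Hw Hw Hw Hw.
exact: quartic_arith.
Qed.

(** The factor 4 of [dotp_dot_le] is enlarged to 48, so that one constant [CP] serves here and in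
    [quartic_expand]. *)
Lemma quartic_le u : H u -> quartic u <= 48 * L4 ^+ 2 * re_H10 D u u ^+ 2.
Proof.
move=> Hu; apply: le_trans (ler_norm _) _; apply: le_trans (dotp_dot_le Hu Hu Hu Hu) _.
rewrite -[re_H10 D u u]sqr_sqrtr ?(re_H10_ge0 mD oD fD)// -/(sa u).
have : 0 <= L4 ^+ 2 * ((sa u ^+ 2) ^+ 2) by rewrite mulr_ge0 ?sqr_ge0.
by move: (sa u) (L4) => x l; nra.
Qed.

Lemma sum_bool (f : bool -> R) : \sum_(b : bool) f b = f false + f true.
Proof. by rewrite big_bool addrC. Qed.

Lemma has_int_rot_form u v : H u -> H v ->
  has_int mu D (fun r => rotgrad true u r * cpart false (v r) - rotgrad false u r * cpart true (v r))
    (rot_form u v).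
Proof.
move=> Hu Hv; have i1 := has_int_mul mD (rotgrad_sq true Hu) (Hsq false Hv).
have i2 := has_int_mul mD (rotgrad_sq false Hu) (Hsq true Hv).
have i := has_intB mD i1 i2; exact: i.
Qed.

Lemma has_int_potential_form u v : H u -> H v ->
  has_int mu D (fun r => \sum_(b : bool) V r * cpart b (u r) * cpart b (v r)) (potential_form u v).
Proof.
move=> Hu Hv; apply: (has_int_sum mD) => b.
have i := has_int_mul mD (potential_sq b Hu) (Hsq b Hv); exact: i.
Qed.

Lemma has_int_re_H10 u v : H u -> H v ->
  has_int mu D (fun r => \sum_(b : bool) \sum_i grad D u b i r * grad D v b i r) (re_H10 D u v).
Proof.
move=> Hu Hv; rewrite (re_H10E mD oD fD)//; apply: (has_int_sum mD) => b; apply: (has_int_sum mD) => i.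
have e := has_int_mul mD (Hgsq b i Hu) (Hgsq b i Hv); exact: e.
Qed.

(** The factor [- i] of [Lz] exchanges the parts of [x * w1 - y * w0] up to sign, which produces the
    density of [rot_form]. *)
Lemma Re_Lz_energy (c x y X : R) (z w1 w0 : R[i]) :
  complex.Re (real_complex R X - real_complex R c * conjc z *
    (- 'i%C * (real_complex R x * w1 - real_complex R y * w0))) =
  X - c * ((x * cpart true w1 - y * cpart true w0) * cpart false z -
           (x * cpart false w1 - y * cpart false w0) * cpart true z).
Proof. by case: z w1 w0 => [a b] [p q] [s t] /=; ring. Qed.

Lemma Re_Lz_deriv (c x y X Y : R) (z v w1 w0 : R[i]) :
  complex.Re (conjc (real_complex R X * z + real_complex R Y * z - real_complex R c *
    (- 'i%C * (real_complex R x * w1 - real_complex R y * w0))) * v) =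
  (X * cpart false z * cpart false v + X * cpart true z * cpart true v) +
  Y * (cpart false z * cpart false v + cpart true z * cpart true v) -
  c * ((x * cpart true w1 - y * cpart true w0) * cpart false v -
       (x * cpart false w1 - y * cpart false w0) * cpart true v).
Proof. by case: z v w1 w0 => [a b] [e f] [p q] [s t] /=; ring. Qed.

(** [energy] integrates one density as a whole; splitting it into the forms rests on the
    integrability of each term separately, which the [has_int] facts provide. *)
Lemma energyE u : H u ->
  energy D V beta Omega u = form_energy (re_H10 D) quad_form quartic beta u.
Proof.
move=> Hu; have i1 := has_int_re_H10 Hu Hu; have i2 := has_int_potential_form Hu Hu.
have i3 := has_int_rot_form Hu Hu; have i4 := has_int_mul mD (dotp_sq Hu Hu) (dotp_sq Hu Hu).
have := has_intD mD (has_intZ mD 2^-1 (has_intD mD i1 (has_intD mD i2 (has_intZ mD (- Omega) i3))))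
  (has_intZ mD (beta / 4) i4).
move=> [_ e]; rewrite /form_energy /quad_form /quartic -e.
rewrite /energy /cintegral; apply: eq_Rintegral => r _.
rewrite /Lz Re_Lz_energy sum_bool.
rewrite (exprM _ 2 2) !normc_sqr.
under eq_bigr do rewrite normc_sqr !expr2.
rewrite big_split sum_bool.
exact: energy_arith.
Qed.

Lemma energy_derivE u v : H u -> H v ->
  energy_deriv D V beta Omega u v = form_energy_deriv (re_H10 D) quad_form quartic_deriv beta u v.
Proof.
move=> Hu Hv; have i2 := has_int_potential_form Hu Hv.
have i3 := has_int_rot_form Hu Hv; have i4 := has_int_mul mD (dotp_sq Hu Hu) (dotp_sq Hu Hv).
have := has_intD mD (has_intD mD i2 (has_intZ mD (- Omega) i3)) (has_intZ mD beta i4).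
move=> [_ e]; rewrite /form_energy_deriv /energy_deriv -addrA; congr (_ + _).
rewrite /quad_form /quartic_deriv -e /L2_ip /cintegral; apply: eq_Rintegral => r _.
rewrite /Lz Re_Lz_deriv sum_bool normc_sqr.
exact: energy_deriv_arith.
Qed.

(** The three terms of the derivative are linear and bounded by the H^1_0 norm of the direction, so
    a representative exists and the one that [sobolev_grad] selects has its defining property. *)
Lemma sobolev_gradP u : H u -> H (sobolev_grad D V beta Omega u : E) /\
  forall h, H h -> re_H10 D (sobolev_grad D V beta Omega u) h =
    form_energy_deriv (re_H10 D) quad_form quartic_deriv beta u h.
Proof.
move=> Hu; pose l h := form_energy_deriv (re_H10 D) quad_form quartic_deriv beta u h.
have [aD aZ] := form_lin HS (re_H10_form mD oD fD) Hu.
have [qD qZ] := form_lin HS quad_form_sym Hu.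
have [TD TZ] := quartic_deriv_lin Hu.
have ll : lin_form H l.
  split=> [x y Hx Hy|c x Hx]; rewrite /l /form_energy_deriv.
    by rewrite (aD _ _ Hx Hy) (qD _ _ Hx Hy) (TD _ _ Hx Hy); exact: add_arith.
  by rewrite (aZ c _ Hx) (qZ c _ Hx) (TZ c _ Hx); exact: scale_arith.
have [|z Hz zP] := @H10_riesz R n.+1 D mD oD fD M M0 DM l (sa u +
    (32 * M ^+ 2 * MV + Omega * (16 * M ^+ 2)) * sa u + beta * (4 * L4 ^+ 2 * sa u ^+ 3)) ll.
  move=> h Hh; rewrite /l /form_energy_deriv mulrDl [X in _ <= X + _]mulrDl.
  apply: le_trans (ler_normD _ _) _; apply: lerD; last first.
    by rewrite normrM (ger0_norm beta0) -mulrA ler_wpM2l// -mulrA quartic_deriv_le.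
  apply: le_trans (ler_normD _ _) _; apply: lerD; last first.
    by rewrite -mulrA quad_form_le.
  exact: (form_CS HS (re_H10_form mD oD fD) (re_H10_ge0 mD oD fD) Hu Hh).
have ex : exists g : 'rV[R]_n.+2 -> R[i], in_H10 D g /\
    forall h, in_H10 D h -> complex.Re (H10_ip D g h) = energy_deriv D V beta Omega u h.
  by exists z; split=> // h Hh; rewrite energy_derivE//; exact: zP.
have [Hg gP] := @xgetPex _ 0 [set g | in_H10 D g /\
    forall h, in_H10 D h -> complex.Re (H10_ip D g h) = energy_deriv D V beta Omega u h] ex.
split; first exact: Hg.
by move=> h Hh; rewrite -energy_derivE//; exact: gP.
Qed.

Lemma scale_real_complex (c : R) (z : Rcomplex R) : c *: z = real_complex R c * z.
Proof. by case: z => a b; congr Complex; ring. Qed.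

Lemma proj_gradE u : H u -> proj_grad D V beta Omega u =
  (let s : E := sobolev_grad D V beta Omega u in let z : E := green D u in
   s - (re_H10 D s z / re_H10 D z z) *: z).
Proof.
move=> Hu; apply/funext => r; rewrite /proj_grad /tangent_proj.
have [Hz _] := greenP mD oD fD M0 DM Hu.
rewrite /H10_norm sqr_sqrtr; last exact: (re_H10_ge0 mD oD fD Hz).
transitivity (sobolev_grad D V beta Omega u r - ((re_H10 D (sobolev_grad D V beta Omega u) (green D u) /
    re_H10 D (green D u) (green D u)) *: (green D u r : Rcomplex R) : Rcomplex R)); last by [].
by rewrite scale_real_complex.
Qed.

Lemma retractionE v : retraction D v = (Num.sqrt (re_L2 D v v))^-1 *: v.
Proof.
apply/funext => r; rewrite /retraction [in RHS]/= [RHS]scale_real_complex mulrC.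
by congr (_ * _); rewrite -fmorphV.
Qed.

End gross_pitaevskii.

(* The dimension is d = n.+2; rho is the value of the H^1_0 norm of u0. *)
Theorem theorem3p1 (R : realType) (n : nat)
    (hn : n.+2 = 2%N \/ n.+2 = 3%N)
    (D : set 'rV[R]_n.+2)
    (D_open : open D) (D_connected : connected D) (D_bounded : bounded_set D)
    (V : 'rV[R]_n.+2 -> R) (beta Omega K : R)
    (V_meas : measurable_fun D V)
    (V_bounded : exists M : R,
       {ae lebesgue_rV R n.+2, forall r, D r -> `|V r| <= M})
    (V_ge0 : {ae lebesgue_rV R n.+2, forall r, D r -> 0 <= V r})
    (beta_gt0 : 0 < beta) (Omega_ge0 : 0 <= Omega) (K_gt0 : 0 < K)
    (V_lower : {ae lebesgue_rV R n.+2, forall r, D r ->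
       (1 + K) / 4 * Omega ^+ 2 * ((r 0 0) ^+ 2 + (r 0 1) ^+ 2) <= V r})
    (rho : R) :
  exists Cu Cg Calpha : R,
    [/\ 0 < Cu, 0 < Cg, 0 < Calpha, Calpha <= 1 &
     forall u0 : 'rV[R]_n.+2 -> R[i],
       manifold D u0 -> H10_norm D u0 = rho ->
     forall (alpha : nat -> R) (amin amax : R),
       0 < amin -> (forall k, amin <= alpha k <= amax) -> amax <= Calpha ->
     forall k : nat,
       let u := H10_scheme D V beta Omega alpha u0 in
       let g := proj_grad D V beta Omega (u k) in
       [/\ H10_norm D (u k) <= Cu,
           H10_norm D g <= H10_norm D (sobolev_grad D V beta Omega (u k)),
           H10_norm D (sobolev_grad D V beta Omega (u k)) <= Cg &
           energy D V beta Omega (u k) - energy D V beta Omega (u k.+1)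
             >= amin / 2 * H10_norm D g ^+ 2]].
Proof.
have mD := measurable_open_rV D_open.
have [M M0 DM] := bounded_set_rVP D_bounded.
have fD : (lebesgue_rV R n.+2 D < +oo)%E.
  apply: le_lt_trans (lebesgue_rV_cbox n.+2 (- M) M).
  by apply: le_measure; rewrite ?inE//; exact: measurable_cbox.
(* The absolute value covers a negative bound, possible when [D] is null. *)
have [MV0 VMV0] := V_bounded; pose MV := `|MV0|; have MV_ge0 : 0 <= MV by exact: normr_ge0.
have VM : {ae lebesgue_rV R n.+2, forall r, D r -> `|V r| <= MV}.
  by apply: filterS VMV0 => r + Dr => /(_ Dr) /le_trans; apply; exact: ler_norm.
pose L4 := Num.sqrt (64 * M ^+ 2 + 16 * M).
have L4_ge0 : 0 <= L4 by exact: sqrtr_ge0.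
have L4E : L4 ^+ 2 = 64 * M ^+ 2 + 16 * M.
  by rewrite sqr_sqrtr// addr_ge0// mulr_ge0 ?sqr_ge0// ltW.
(* From here on [L4] is known through its sign and its square only. *)
clearbody L4.
have beta0 := ltW beta_gt0.
have HS := H10_subspace mD D_open fD.
have kappa0 : 0 < K / (1 + K) by rewrite divr_gt0// ltr_wpDl.
have Cq0 : 0 <= 32 * M ^+ 2 * MV + Omega * (16 * M ^+ 2).
  by rewrite addr_ge0// !mulr_ge0// ltW.
have CT0 : 0 <= 4 * L4 ^+ 2 by rewrite mulr_ge0// sqr_ge0.
have CP0 : 0 <= 48 * L4 ^+ 2 by rewrite mulr_ge0// sqr_ge0.
(* The constants are fixed from [rho] before [u0] is introduced. *)
have [Cu [Cg [Ca [Cu0 Cg0 Ca0 Ca1 P]]]] := @gradient_descent R _ _ HS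
  (re_H10 D) (re_L2 D) (quad_form D V Omega) (quartic_deriv D) (quartic D)
  beta _ _ _ _ (re_H10_form mD D_open fD) (re_L2_form mD D_open fD)
  (quad_form_sym mD D_open fD DM Omega V_meas VM)
  (re_H10_ge0 mD D_open fD) (re_L2_ge0 mD D_open fD)
  beta0 kappa0 Cq0 CT0 CP0
  (quad_form_coercive mD D_open fD DM V_meas VM K_gt0 V_lower)
  (quad_form_le mD D_open fD M0 DM V_meas MV_ge0 VM Omega_ge0)
  (quartic_deriv_le mD D_open fD M0 DM hn L4_ge0 L4E)
  (quartic_deriv_lin mD D_open fD M0 DM hn L4_ge0 L4E)
  (fun u _ => quartic_ge0 D u)
  (quartic_le mD D_open fD M0 DM hn L4_ge0 L4E)
  (quarticZ mD D_open fD M0 DM hn L4_ge0 L4E)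
  (quartic_expand mD D_open fD M0 DM hn L4_ge0 L4E) rho.
exists Cu, Cg, Ca; split; [exact: Cu0|exact: Cg0|exact: Ca0|exact: Ca1|].
move=> u0 [Hu0 u01] u0rho alpha amin amax amin0 alphaP amaxC.
(* The iterates are given values in [Rcomplex R], whose real scaling is the one of the abstract
   descent. *)
pose U k : 'rV[R]_n.+2 -> Rcomplex R := H10_scheme D V beta Omega alpha u0 k.
have mu0 : re_L2 D (U 0%N) (U 0%N) = 1.
  by rewrite -(sqr_sqrtr (re_L2_ge0 mD D_open fD Hu0)) [Num.sqrt _]u01 expr1n.
have uE k : U k.+1 = (let v := U k - alpha k *: (proj_grad D V beta Omega (U k) : 'rV[R]_n.+2 -> Rcomplex R) in
    (Num.sqrt (re_L2 D v v))^-1 *: v).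
  rewrite /= -retractionE /U /=; congr retraction; apply/funext => r.
  by rewrite -scale_real_complex.
have Q := P alpha amin amax amin0 alphaP amaxC U
  (fun k => sobolev_grad D V beta Omega (U k)) (fun k => green D (U k))
  (fun k => proj_grad D V beta Omega (U k)) Hu0 mu0 u0rho.
have zP k : in_H10 D (U k) -> in_H10 D (green D (U k)) /\
    forall h, in_H10 D h -> re_H10 D (green D (U k)) h = re_L2 D (U k) h.
  move=> Hk; have [Hz zP] := greenP mD D_open fD M0 DM Hk; split; first exact: Hz.
  by move=> h Hh; rewrite /re_H10 (zP h Hh).
have {}Q := Q
  (fun k => sobolev_gradP mD D_open fD M0 DM V_meas MV_ge0 VM beta0 Omega_ge0 hn L4_ge0 L4E
     (u := U k)) zP
  (fun k => proj_gradE mD D_open fD M0 DM V beta Omega (u := U k)) uE.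
move=> k u g.
(* The statement at [k.+1] supplies the membership of the next iterate, which [energyE] asks for. *)
have [Hu Hg [b1 b2 b3 b4]] := Q k; have [Hu' _ _] := Q k.+1.
split; [exact: b1|exact: b2|exact: b3|].
have eE := energyE mD D_open fD M0 DM beta Omega V_meas VM hn L4_ge0 L4E.
rewrite (sqr_sqrtr (re_H10_ge0 mD D_open fD Hg)) (eE _ Hu) (eE _ Hu').
exact: b4.
Qed.
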